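(* Let $\bm{T}$ be a sesqui-type branching tree with types $\{1,2\}$ and root of type $1$, in which type $2$ vertices have no offspring and type $1$ vertices receive offspring according to an ordered branching mechanism $\bm{\sigma}_1$, and let $(\xi,\zeta)$ be the numbers of occurrences of type $1$ and type $2$ in $\bm{\sigma}_1$. Assume that $\mathbb{P}(\xi=0)>0$, $\mathbb{P}(\xi\ge2)>0$, that the support of $(\xi,\zeta)$ is not contained on a straight line, that $\mathbb{E}[\xi]=1$, and that $(\xi,\zeta)$ has a finite covariance matrix. Let $$a:=\min(\mathrm{supp}(\#\bm{T})),\qquad D:=\gcd(\mathrm{supp}(\#\bm{T})-a).$$ Let $\bm{T}_n$ be $\bm{T}$ conditioned on $\#\bm{T}=n$ and let $v_n$ be a uniformly at random selected vertex of $\bm{T}_n$. Then $$\mathfrak{L}((\bm{T}_n,v_n)\mid\bm{T}_n)\xrightarrow{\;p\;}\mathfrak{L}(\hat{\bm{T}}(1,\eta))$$ as $n\in a+D\mathbb{N}$ tends to infinity. Here $\eta$ denotes an independent random type from $\{1,2\}$ with $$\mathbb{P}(\eta=1)=\frac{1}{1+\mathbb{E}[\zeta]}\qquad\text{and}\qquad\mathbb{P}(\eta=2)=\frac{\mathbb{E}[\zeta]}{1+\mathbb{E}[\zeta]} .$$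
   Context: $\xrightarrow{p}$ is convergence in probability; $\mathfrak{L}$ denotes (conditional) laws. $\mathrm{supp}(\#\bm{T})$ is the set of positive integers $n$ with $\mathbb{P}(\#\bm{T}=n)>0$; $\mathbb{P}(\#\bm{T}=n)>0$ for all sufficiently large $n\in a+D\mathbb{N}$. Trees. $\mathfrak{G}=\{1,2\}$. A $\mathfrak{G}$-type plane tree is a rooted ordered tree, each vertex having finitely many children, with a type assigned to each vertex. $\#T$ is the total number of vertices and $\#_iT$ the number of type $i$ vertices. The branching mechanism $\bm{\sigma}_1$ is a random finite word over $\{1,2\}$; each type $1$ vertex of $\bm{T}$ independently receives an ordered list of children with types given by an independent copy of $\bm{\sigma}_1$. The fringe subtree at a vertex is the tree formed by that vertex and all its descendants. The limit trees. $\bm{T}(1)$ is $\bm{T}$ (started with a type $1$ root). $\bm{T}^1$ is defined like $\bm{T}(1)$, except that non-root vertices of type $1$ receive no offspring; so it consists of a type $1$ root with children according to $\bm{\sigma}_1$, $\mathbb{E}[\#_1\bm{T}^1]=2$ and $\mathbb{E}[\#_2\bm{T}^1]=\mathbb{E}[\zeta]$. $\hat{\bm{T}}^1=\hat{\bm{T}}^{1,1}$ is the random marked tree with $\mathbb{P}(\hat{\bm{T}}^1=(T,u))=\mathbb{P}(\bm{T}^1=T)$ for every non-root vertex $u$ of $T$ of type $1$. $\hat{\bm{T}}^{1,2}$ is the random marked tree with $\mathbb{P}(\hat{\bm{T}}^{1,2}=(T,u))=\mathbb{P}(\bm{T}^1=T)/\mathbb{E}[\zeta]$ for every vertex $u$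 of $T$ of type $2$. For $\gamma\in\{1,2\}$ the infinite tree $\hat{\bm{T}}(1,\gamma)$ is built as follows: there are vertices $u_0,u_1,\ldots$ of type $1$; $u_0$ is the root of an independent copy of $\hat{\bm{T}}^{1,\gamma}$, whose marked vertex is the marked vertex of $\hat{\bm{T}}(1,\gamma)$ and whose non-root type $1$ vertices all become roots of independent copies of $\bm{T}(1)$; for each $i\ge1$, $u_i$ is the root of an independent copy of $\hat{\bm{T}}^1$, whose marked vertex is identified with $u_{i-1}$ and whose non-marked, non-root type $1$ vertices become roots of independent copies of $\bm{T}(1)$. $\hat{\bm{T}}(1,\eta)$ with random $\eta$ is the corresponding mixture. Space and convergence. For a marked tree $(T_1,v_1)$, $f^{[h]}(T_1,v_1)$ is the fringe subtree at the $h$-th ancestor of $v_1$ (the $0$-th being $v_1$), marked at $v_1$; if that ancestor does not exist it is $(T_1,v_1)$ with an overflow flag. $\mathfrak{X}$ is the set of all finite marked $\mathfrak{G}$-type plane trees together with all locally finite $\mathfrak{G}$-type plane trees having a marked vertex with a countably infinite number of ancestors (hence no root) and all $f^{[h]}$ finite. Its metric is $d(T_1^\bullet,T_2^\bullet)=2$ if $f^{[0]}(T_1^\bullet)\neq f^{[0]}(T_2^\bullet)$, and $2^{-\sup\{h\ge0:\,f^{[h]}(T_1^\bullet)=f^{[h]}(T_2^\bullet)\}}$ otherwise ($2^{-\infty}=0$). The conditional law $\mathfrak{L}((\bm{T}_n,v_n)\mid\bm{T}_n)$ is the random Borel probability measure on $\mathfrak{X}$ which is uniform on the pairs $(\bm{T}_n,v)$,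 $v$ a vertex of $\bm{T}_n$; convergence in probability is with respect to the topology of weak convergence of probability measures on $\mathfrak{X}$. *)

(* Defs.v *)
From HB Require Import structures.
From mathcomp Require Import all_boot all_order all_algebra zify.
From mathcomp Require Import all_classical all_reals all_analysis.

Set Implicit Arguments.
Unset Strict Implicit.
Unset Printing Implicit Defensive.

Import Order.TTheory GRing.Theory Num.Theory.
Import numFieldNormedType.Exports.

Local Open Scope classical_set_scope.
Local Open Scope ring_scope.

Inductive gtype := type1 | type2.

Definition bool_of_gtype (g : gtype) : bool := if g is type1 then true else false.
Definition gtype_of_bool (b : bool) : gtype := if b then type1 else type2.
Lemma bool_of_gtypeK : cancel bool_of_gtype gtype_of_bool. Proof. by case. Qed.
HB.instance Definition _ := Countable.copy gtype (can_type bool_of_gtypeK).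
HB.instance Definition _ := isPointed.Build gtype type1.
HB.instance Definition _ := @isMeasurable.Build default_measure_display
  gtype discrete_measurable discrete_measurable0
  discrete_measurableC discrete_measurableU.

Definition word := seq gtype.
HB.instance Definition _ := Countable.on word.
HB.instance Definition _ := isPointed.Build word [::].
HB.instance Definition _ := @isMeasurable.Build default_measure_display
  word discrete_measurable discrete_measurable0
  discrete_measurableC discrete_measurableU.

Definition xi (w : word) : nat := count_mem type1 w.
Definition zeta (w : word) : nat := count_mem type2 w.

Inductive tree := Node of gtype & seq tree.

Definition root_type (t : tree) : gtype := let: Node g _ := t in g.
Definition children (t : tree) : seq tree := let: Node _ ts := t in ts.
Definition leaf (g : gtype) : tree := Node g [::].

(* A vertex is denoted by its Ulam-Harris address: the positions, from the root
   downwards, of the successive children leading to it; [::] is the root. *)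
Fixpoint vertices (t : tree) : seq (seq nat) :=
  let: Node _ ts := t in
  let vs := map vertices ts in
  [::] :: flatten [seq map (cons iv.1) iv.2 | iv <- zip (iota 0 (size vs)) vs].

Definition tree_size (t : tree) : nat := size (vertices t).

Fixpoint fringe_subtree (t : tree) (v : seq nat) {struct v} : option tree :=
  if v is i :: v' then
    if onth (children t) i is Some s then fringe_subtree s v' else None
  else Some t.

(* One step of the ancestral line of a marked vertex: the type of the parent, and
   the fringe subtrees at the siblings to the left and to the right (both lists
   read from left to right). *)
Inductive context := Context of gtype & seq tree & seq tree.

(* A marked tree, up to isomorphism, is given by the fringe subtree at the marked
   vertex together with the contexts met when going up the ancestral line, closest
   to the marked vertex first. In [FiniteMarked s cs] the root is the [size cs]-th
   ancestor; in [InfiniteMarked s cs] there are infinitely many ancestors and no root.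
   The fringe subtrees at all the ancestors are automatically finite. *)
Inductive marked :=
  | FiniteMarked of tree & seq context
  | InfiniteMarked of tree & (nat -> context).

Fixpoint ancestral_line (t : tree) (v : seq nat) {struct v} : tree * seq context :=
  if v is i :: v' then
    let: Node g ts := t in
    let: (s, cs) := ancestral_line (nth t ts i) v' in
    (s, rcons cs (Context g (take i ts) (drop i.+1 ts)))
  else (t, [::]).

(* The pair (t, v), for v \in vertices t; junk at other addresses. *)
Definition mark (t : tree) (v : seq nat) : marked :=
  let: (s, cs) := ancestral_line t v in FiniteMarked s cs.

(* The fringe subtree at the h-th ancestor, marked at the original vertex (i.e.
   the finite marked tree whose ancestral line is the first h contexts), paired
   with the overflow flag, which is set when there is no h-th ancestor. *)
Definition fringe_at (h : nat) (x : marked) : (tree * seq context) * bool :=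
  match x with
  | FiniteMarked s cs => (s, take h cs, (size cs < h)%N)
  | InfiniteMarked s cs => (s, mkseq cs h, false)
  end.

Section marked_dist.
Variable R : realType.

(* The infimum is 2^(- sup {h | ...}), with value 0 when the set is unbounded. *)
Definition marked_dist (x y : marked) : R :=
  if `[< fringe_at 0 x = fringe_at 0 y >] then
    inf [set 2^-1 ^+ h | h in [set h : nat | fringe_at h x = fringe_at h y]]
  else 2.

Lemma fringe_atW h x y :
  fringe_at h.+1 x = fringe_at h.+1 y -> fringe_at h x = fringe_at h y.
Proof.
have tk (cs : seq context) : take h cs = take h (take h.+1 cs).
  by rewrite take_takel.
have mk (cs : nat -> context) : mkseq cs h = take h (mkseq cs h.+1).
  rewrite /mkseq -map_take.
  by congr map; rewrite -addn1 iotaD take_size_cat // size_iota.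
move=> E; have {E} : let: (s, cs, b) := fringe_at h.+1 x in
    let: (s', cs', b') := fringe_at h.+1 y in [/\ s = s', cs = cs' & b = b'].
  by rewrite E; case: (fringe_at _ _) => [[]].
case: x => s cs; case: y => s' cs' /= [-> e1 e2].
- rewrite tk e1 -tk; congr (_, _, _).
  have : size (take h.+1 cs) = size (take h.+1 cs') by rewrite e1.
  by rewrite !size_take_min => e3; lia.
- rewrite mk -e1 -tk; congr (_, _, _).
  by apply/negbTE; move/negbT: e2; rewrite -!leqNgt; exact: ltnW.
- rewrite mk e1 -tk; congr (_, _, _).
  by apply/esym/negbTE; move/esym/negbT: e2; rewrite -!leqNgt; exact: ltnW.
- by rewrite mk e1 -mk.
Qed.

Lemma fringe_at_le h k x y : (h <= k)%N ->
  fringe_at k x = fringe_at k y -> fringe_at h x = fringe_at h y.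
Proof.
move=> /subnKC <-; elim: (k - h)%N => [|n ih]; first by rewrite addn0.
by rewrite addnS => /fringe_atW.
Qed.

Lemma fringe_at_inj x y : (forall h, fringe_at h x = fringe_at h y) -> x = y.
Proof.
case: x => s cs; case: y => s' cs' E.
- move: (E (maxn (size cs) (size cs'))) => /= [-> + _].
  by rewrite !take_oversize ?leq_maxl ?leq_maxr // => ->.
- by move: (E (size cs).+1) => /=; rewrite ltnS leqnn => -[].
- by move: (E (size cs').+1) => /=; rewrite ltnS leqnn => -[].
- have /= [->] := E 0%N; congr InfiniteMarked; apply/funext => i.
  have := congr1 (fun m => nth (cs i) m.1.2 i) (E i.+1).
  by rewrite !nth_mkseq.
Qed.

Let H x y := [set 2^-1 ^+ h | h in [set h : nat | fringe_at h x = fringe_at h y]] : set R.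

Let H_ge0 x y : lbound (H x y) 0.
Proof. by move=> _ [h _ <-]; rewrite exprn_ge0. Qed.

Let H_has_inf x y : fringe_at 0 x = fringe_at 0 y -> has_inf (H x y).
Proof.
by move=> e; split; [exists (2^-1 ^+ 0); exists 0%N|exists 0; exact: H_ge0].
Qed.

Let dist_le x y h : fringe_at h x = fringe_at h y -> marked_dist x y <= 2^-1 ^+ h.
Proof.
move=> e; have e0 := fringe_at_le (leq0n h) e.
rewrite /marked_dist asboolT //; apply: ge_inf; last by exists h.
by exists 0; exact: H_ge0.
Qed.

Let dist_ge0 x y : 0 <= marked_dist x y.
Proof.
rewrite /marked_dist; case: asboolP => // e.
by apply: lb_le_inf; [exact: (H_has_inf e).1|exact: H_ge0].
Qed.

Let dist_le2 x y : marked_dist x y <= 2.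
Proof.
have [e|ne] := pselect (fringe_at 0 x = fringe_at 0 y).
  by rewrite (le_trans (dist_le e)) // expr0 ler1n.
by rewrite /marked_dist asboolF.
Qed.

Lemma marked_distxx x : marked_dist x x = 0.
Proof.
apply/eqP; rewrite eq_le dist_ge0 andbT; apply/ler_addgt0Pl => e e0.
have h1 : `|2^-1 : R| < 1 by rewrite ger0_norm // invf_lt1 // ltr1n.
have /cvgr0Pnorm_lt /(_ e e0) [n _ ne] := cvg_expr h1.
rewrite addr0; apply: (le_trans (dist_le (erefl (fringe_at n x)))).
have := ne n (leqnn n); rewrite /= ger0_norm ?exprn_ge0 //; exact: ltW.
Qed.

Lemma marked_dist_eq0 x y : marked_dist x y = 0 -> x = y.
Proof.
move=> d0; apply: fringe_at_inj => h; apply: contrapT => ne.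
have : 2^-1 ^+ h <= marked_dist x y.
  rewrite /marked_dist; case: asboolP => e; last first.
    by rewrite (le_trans (y := 1)) ?ler1n // exprn_ile1 ?invf_le1 ?ler1n.
  apply: lb_le_inf; first exact: (H_has_inf e).1.
  move=> _ [k ek <-]; apply: ler_wiXn2l; rewrite ?invf_le1 ?ler1n //.
  rewrite leqNgt; apply/negP => hk; apply: ne.
  exact: (fringe_at_le (ltnW hk)).
by rewrite d0 leNgt exprn_gt0.
Qed.

Lemma marked_dist_sym x y : marked_dist x y = marked_dist y x.
Proof.
rewrite /marked_dist (_ : `[< fringe_at 0 x = _ >] = `[< fringe_at 0 y = fringe_at 0 x >]).
  by congr (if _ then inf _ else _); apply/seteqP; split=> _ [h e <-]; exists h.
by apply/asbool_equiv_eq; split.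
Qed.

Lemma marked_dist_triangle y x z :
  marked_dist x z <= marked_dist x y + marked_dist y z.
Proof.
have [exy|nxy] := pselect (fringe_at 0 x = fringe_at 0 y); last first.
  by rewrite {2}/marked_dist asboolF // (le_trans (dist_le2 _ _)) // lerDl.
have [eyz|nyz] := pselect (fringe_at 0 y = fringe_at 0 z); last first.
  by rewrite {3}/marked_dist asboolF // (le_trans (dist_le2 _ _)) // lerDr.
rewrite -lerBlDr {3}/marked_dist asboolT //.
apply: lb_le_inf; first exact: (H_has_inf exy).1.
move=> _ [h1 e1 <-]; rewrite lerBlDr addrC -lerBlDr {2}/marked_dist asboolT //.
apply: lb_le_inf; first exact: (H_has_inf eyz).1.
move=> _ [h2 e2 <-]; rewrite lerBlDr.
have exz : fringe_at (minn h1 h2) x = fringe_at (minn h1 h2) z.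
  by rewrite (fringe_at_le (geq_minl _ _) e1) (fringe_at_le (geq_minr _ _) e2).
apply: (le_trans (dist_le exz)).
by case: leqP => _; rewrite ?lerDl ?lerDr exprn_ge0.
Qed.

End marked_dist.

(* R is only the codomain of the distance. *)
Definition marked_space (R : realType) : Type := marked.
HB.instance Definition _ (R : realType) := gen_eqMixin (marked_space R).
HB.instance Definition _ (R : realType) := gen_choiceMixin (marked_space R).
HB.instance Definition _ (R : realType) :=
  isPointed.Build (marked_space R) (FiniteMarked (leaf type1) [::]).
HB.instance Definition _ (R : realType) := @isMetric.Build R (marked_space R)
  (@marked_dist R) (@marked_distxx R) (@marked_dist_eq0 R)
  (@marked_dist_sym R) (@marked_dist_triangle R).

Definition borel_marked (R : realType) :=
  g_sigma_algebraType (@open (marked_space R)).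
HB.instance Definition _ (R : realType) := Measurable.on (borel_marked R).

Definition marked_law (R : realType) := probability (borel_marked R) R.
HB.instance Definition _ (R : realType) := Choice.on (marked_law R).

Definition bounded_continuous (R : realType) :=
  {f : marked_space R -> R | continuous f /\ exists M, forall x, `|f x| <= M}.

Definition test (R : realType) (f : bounded_continuous R) (mu : marked_law R) : R :=
  (\int[mu]_x (sval f x))%R.

(* The coarsest topology making every map [test f] continuous. *)
Definition weak_law (R : realType) := sup_topology
  (fun f : bounded_continuous R => Topological.class (initial_topology (test f))).
HB.instance Definition _ (R : realType) := Topological.on (weak_law R).

(* The law of (t, v) with v a uniformly random vertex of t: the normalized sum of
   the Dirac masses at the pairs (t, v). The last argument of mnormalize is not
   used, as the total mass tree_size t is positive. *)
Definition uniform_mark (R : realType) (t : tree) : marked_law R :=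
  mnormalize
    (msum (fun i => \d_(mark t (nth [::] (vertices t) i) : borel_marked R))
          (tree_size t))
    (\d_(point : borel_marked R)).

Definition mutually_independent d (Om : measurableType d) (R : realType)
    (P : probability Om R) (I : Type) (F : I -> set_system Om) : Prop :=
  forall (n : nat) (i : 'I_n -> I) (E : 'I_n -> set Om), injective i ->
    (forall k, F (i k) (E k)) ->
    fine (P (\bigcap_(k in [set: 'I_n]) E k)) = \prod_(k < n) fine (P (E k)).

Definition sigma_of d d' (Om : measurableType d) (T : measurableType d')
    (X : Om -> T) : set_system Om :=
  preimage_set_system setT X measurable.

Definition cond_prob d (Om : measurableType d) (R : realType)
    (P : probability Om R) (A B : set Om) : R :=
  fine (P (A `&` B)) / fine (P B).

(* [t] is the tree in which the vertex with address v, if it has type 1, receives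
   children with types [sigma v], type 2 vertices receiving none. *)
Definition grown (sigma : seq nat -> word) (t : tree) : Prop :=
  root_type t = type1 /\
  forall v s, fringe_subtree t v = Some s ->
    map root_type (children s) = if root_type s is type1 then sigma v else [::].

(* [None] stands for an infinite tree. *)
Definition branching_tree (sigma : seq nat -> word) : option tree :=
  if pselect (exists t, grown sigma t) is left e then Some (sval (cid e)) else None.

Section branching.
Context d (Om : measurableType d) (R : realType) (P : probability Om R).

Definition iid_copies (I : Type) (p : probability word R)
    (sigma : I -> {RV P >-> word}) : Prop :=
  (forall v A, P (sigma v @^-1` A) = p A) /\
  mutually_independent P (fun v => sigma_of (sigma v)).

Definition random_tree (sigma : seq nat -> {RV P >-> word}) (omega : Om) : option tree :=
  branching_tree (fun v => sigma v omega).

Definition size_event (T : Om -> option tree) (n : nat) : set Om :=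
  [set omega | omap tree_size (T omega) = Some n].

Definition size_support (T : Om -> option tree) : set nat :=
  [set n | (0 < P (size_event T n))%E].

End branching.

Definition is_minimum (S : set nat) (a : nat) : Prop :=
  S a /\ forall n, S n -> (a <= n)%N.

(* D is the gcd of S - a, for a the minimum of S. *)
Definition is_span (S : set nat) (a D : nat) : Prop :=
  (forall n, S n -> D %| n - a)%N /\
  (forall e, (forall n, S n -> e %| n - a)%N -> (e %| D)%N).

Definition support_on_line (R : realType) (p : probability word R) : Prop :=
  exists alpha beta c : R, (alpha, beta) != (0, 0) /\
    forall x y : nat, (0 < p [set w | xi w = x /\ zeta w = y])%E ->
      alpha * x%:R + beta * y%:R = c.

Definition mean_zeta (R : realType) (p : probability word R) : R :=
  fine ('E_p[fun w => (zeta w)%:R])%E.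

(* As type 1 non-root vertices have no offspring in T^1, this tree is determined
   by the word of the types of the children of its root, and a non-root vertex is
   a position in that word: a marked T^1 is encoded by a pair in word * nat. *)
Section limit_tree.
Context d (Om : measurableType d) (R : realType) (P : probability Om R).

Inductive part :=
  | Eta                      (* the random type eta *)
  | Base of gtype            (* \hat T^{1,gamma}, for u_0 *)
  | Spine of nat             (* \hat T^1, for u_{i+1} *)
  | Copy of nat & seq nat.   (* words driving the copies of T(1) *)

Record limit_parts (p : probability word R) := LimitParts {
  eta : {RV P >-> gtype} ;
  base : gtype -> {RV P >-> (word * nat)%type} ;
  spine : nat -> {RV P >-> (word * nat)%type} ;
  copy : nat -> seq nat -> {RV P >-> word} ;

  eta_law1 : P (eta @^-1` [set type1]) = (1 / (1 + mean_zeta p))%:E ;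
  eta_law2 : P (eta @^-1` [set type2]) = (mean_zeta p / (1 + mean_zeta p))%:E ;
  base_law1 : forall w k, (k < size w)%N -> nth type2 w k = type1 ->
    P (base type1 @^-1` [set (w, k)]) = p [set w] ;
  base_law2 : forall w k, (k < size w)%N -> nth type1 w k = type2 ->
    P (base type2 @^-1` [set (w, k)]) = (fine (p [set w]) / mean_zeta p)%:E ;
  spine_law : forall i w k, (k < size w)%N -> nth type2 w k = type1 ->
    P (spine i @^-1` [set (w, k)]) = p [set w] ;
  copy_law : forall i v A, P (copy i v @^-1` A) = p A ;
  parts_indep : mutually_independent P (fun c : part =>
    match c with
    | Eta => sigma_of eta
    | Base g => sigma_of (base g)
    | Spine i => sigma_of (spine i)
    | Copy i v => sigma_of (copy i v)
    end)
}.

Variables (p : probability word R) (L : limit_parts p).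

(* The marked T^1 whose root is u_i. *)
Definition piece (i : nat) (omega : Om) : word * nat :=
  if i is i'.+1 then spine L i' omega else base L (eta L omega) omega.

(* The fringe subtree at the j-th child of u_i, when that child is not u_{i-1}:
   the independent copy of T(1) driven by the words copy i (j :: v) if it has
   type 1, a leaf otherwise. The default value is for infinite copies of T(1). *)
Definition hanging (i : nat) (omega : Om) (j : nat) : tree :=
  if nth type2 (piece i omega).1 j is type1 then
    odflt (leaf type1) (branching_tree (fun v => copy L i (j :: v) omega))
  else leaf type2.

Definition spine_context (omega : Om) (i : nat) : context :=
  let: (w, k) := piece i omega in
  Context type1 (map (hanging i omega) (iota 0 k))
                (map (hanging i omega) (iota k.+1 (size w - k.+1))).

(* The spine is u_0, u_1, ...; the marked vertex is the marked child of u_0, which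
   for eta = 1 is itself the root of a copy of T(1). *)
Definition limit_tree (omega : Om) : marked :=
  InfiniteMarked (hanging 0 omega (piece 0 omega).2) (spine_context omega).

End limit_tree.

(* Main.v *)
Require Import Defs.
From HB Require Import structures.
From mathcomp Require Import all_boot all_order all_algebra zify ring lra.
From mathcomp Require Import all_classical all_reals all_analysis.

(** The word of offspring types of the type 1 vertices in preorder codes a tree
    by a first passage path of the random walk with steps xi - 1; the size of the
    tree is the sum of the numbers zeta + 1 along the path. By the cycle lemma and a
    local lower bound for this pair of walks, P(#T = n) is at least c / n^2 along
    the admissible n. On the other hand, for a fixed tree t of probability w(t),
    the event that fewer than (w(t) / (1 + E zeta) - delta) n fringe subtrees of a
    tree of size n equal t has probability o(1 / n^2): either some step is of order
    n, or the number of steps or the number of occurrences of the code of t deviates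
    linearly, which is exponentially unlikely for truncated steps. So, conditionally
    on #T = n, the proportion of the vertices around which the tree looks like a given
    finite pattern is with high probability at least its limit minus delta. The limit
    is the probability of the pattern in the limit tree, and these probabilities sum up
    to 1 over the partition of the infinite marked trees into balls on which a
    continuous function oscillates little; so lower bounds are all that is needed. *)

Set Implicit Arguments.
Unset Strict Implicit.
Unset Printing Implicit Defensive.

Import Order.TTheory GRing.Theory Num.Theory.
Import numFieldNormedType.Exports.

Local Open Scope classical_set_scope.
Local Open Scope ring_scope.

(** * Trees and their codes *)

(** The obstacle is that only second moments are available, while the conditioning event is itself
    of polynomially small probability. The lower bound uses a single number m of words, close to n /
    (1 + E zeta): the planar local bound gives 1/m and the cycle lemma another 1/m, whence the
    exponent 2. On the side of the rare events, a union bound over the positions of one long word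
    would lose a factor n. It is recovered from the cycle lemma, whose 1/m pays for the choice of
    the position, and a renewal estimate sums over m; what remains is the tail of zeta + 1 at delta
    n, which is o(1 / n^2) by finiteness of the variance. The walk may live on a proper sublattice.
    Three affinely independent points of the support yield two families of fair coins, whose
    binomial laws reach the points of a sublattice of finite index, and finitely many fixed lists of
    words correct the residue. Every estimate is a finite sum over words of length at most n, as a
    tree of size n has no others. The truncated law has mass slightly below 1 and a slightly wrong
    mean, which all these bounds tolerate. *)

Fixpoint tree_nested_ind (Q : tree -> Prop)
    (HQ : forall g ts, foldr (fun t A => Q t /\ A) True ts -> Q (Node g ts)) t : Q t :=
  let: Node g ts := t in
  HQ g ts ((fix F ts : foldr (fun t A => Q t /\ A) True ts :=
    if ts is t :: ts' then conj (tree_nested_ind HQ t) (F ts') else I) ts).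

(** An embedding into [GenTree.tree] makes trees, and then contexts, countable; the patterns of
    marked trees can thus be enumerated by [pickle]. *)
Fixpoint gentree_of_tree (t : tree) : GenTree.tree unit :=
  let: Node g ts := t in GenTree.Node (bool_of_gtype g) (map gentree_of_tree ts).

Fixpoint tree_of_gentree (t : GenTree.tree unit) : tree :=
  if t is GenTree.Node g ts then Node (gtype_of_bool (g == 1%N)) (map tree_of_gentree ts)
  else leaf type1.

Lemma gentree_of_treeK : cancel gentree_of_tree tree_of_gentree.
Proof.
elim/tree_nested_ind => g ts ih /=; congr Node; first by case: g.
by elim: ts ih => //= t ts iht [-> /iht ->].
Qed.

HB.instance Definition _ := Countable.copy tree (can_type gentree_of_treeK).

Definition tuple_of_context (c : context) := let: Context g l r := c in (g, l, r).
Definition context_of_tuple (c : gtype * seq tree * seq tree) :=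
  let: (g, l, r) := c in Context g l r.
Lemma tuple_of_contextK : cancel tuple_of_context context_of_tuple.
Proof. by case. Qed.
HB.instance Definition _ := Countable.copy context (can_type tuple_of_contextK).

Lemma tree_ind_mem (Q : tree -> Prop) :
  (forall g ts, {in ts, forall t, Q t} -> Q (Node g ts)) -> forall t, Q t.
Proof.
move=> HQ; elim/tree_nested_ind => g ts H; apply: HQ.
elim: ts H => //= t ts ih [Qt /ih {}ih] u; rewrite in_cons => /orP[/eqP->//|]; exact: ih.
Qed.

Fixpoint valid_tree (t : tree) : bool :=
  let: Node g ts := t in ((g == type1) || nilp ts) && all valid_tree ts.

Fixpoint code (t : tree) : seq word :=
  let: Node g ts := t in
  if g is type1 then map root_type ts :: flatten (map code ts) else [::].

Definition forest_code (ts : seq tree) : seq word := flatten (map code ts).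

Lemma forest_code_cons t ts : forest_code (t :: ts) = code t ++ forest_code ts.
Proof. by []. Qed.

Lemma forest_code_cat ts us : forest_code (ts ++ us) = forest_code ts ++ forest_code us.
Proof. by rewrite /forest_code map_cat flatten_cat. Qed.

(** Codes form a prefix code. The remainders [r] and [r'] let an induction cut a concatenation of
    codes. The root types are compared separately because a code does not record a root of type
    2. *)
Definition uniquely_coded t := forall t' r r', valid_tree t' ->
  root_type t = root_type t' -> code t ++ r = code t' ++ r' -> t = t' /\ r = r'.

Lemma forest_code_inj_of ts : {in ts, forall t, uniquely_coded t} ->
  forall ts' r r', all valid_tree ts' -> map root_type ts = map root_type ts' ->
  forest_code ts ++ r = forest_code ts' ++ r' -> ts = ts' /\ r = r'.
Proof.
elim: ts => [|t ts ih] H [|t' ts'] //= r r'.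
move=> /andP[vt' vts'] [e1 e2]; rewrite !forest_code_cons -!catA => e.
have [-> e3] := H _ (mem_head _ _) _ _ _ vt' e1 e.
have [|-> ->] // := ih _ _ _ _ vts' e2 e3.
by move=> u uts; apply: H; rewrite in_cons uts orbT.
Qed.

Lemma code_inj t : valid_tree t -> uniquely_coded t.
Proof.
elim/tree_ind_mem: t => g ts ih /= /andP[v1 v2] [g' ts'] r r' /=.
case: g v1 => v1; case: g' => // /andP[v1' v2'] _ /=.
- move=> [e1 e2].
  have [|-> ->] // := forest_code_inj_of _ v2' e1 e2.
  by move=> t tts; apply: ih => //; apply: (allP v2).
- by case: ts v1 {ih v2} => // _; case: ts' v1' {v2'} => // _ /= ->.
Qed.

Lemma code_inj0 t t' : valid_tree t -> valid_tree t' ->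
  root_type t = root_type t' -> code t = code t' -> t = t'.
Proof.
move=> vt vt' e1 e2.
by have [|-> _] // := @code_inj t vt t' [::] [::] vt' e1; rewrite e2.
Qed.

Fixpoint fringes (t : tree) : seq tree :=
  let: Node _ ts := t in t :: flatten (map fringes ts).

Definition occurrences (c s : seq word) : nat :=
  count (fun i => prefix c (drop i s)) (iota 0 (size s)).

Lemma occurrences_cons c w s :
  occurrences c (w :: s) = (prefix c (w :: s) + occurrences c s)%N.
Proof.
by rewrite /occurrences /= (iotaDl 1 0) count_map.
Qed.

(** Reading from the word of a type 1 vertex, one meets the code of its fringe subtree first. By
    unique decoding the code of [u] starts there exactly when this subtree is [u]. The remainder [r]
    serves the induction over siblings. *)
Lemma occurrences_code_cat u t r : valid_tree u -> root_type u = type1 -> valid_tree t ->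
  occurrences (code u) (code t ++ r) =
  (count_mem u (fringes t) + occurrences (code u) r)%N.
Proof.
move=> vu u1; elim/tree_ind_mem: t r => -[] ts ih r vt; last first.
  move: vt => /= /andP[/nilP -> _] /=.
  suff /negbTE -> : Node type2 [::] != u by [].
  by apply/eqP => e; rewrite -e in u1.
rewrite [code _]/= cat_cons occurrences_cons.
have -> : prefix (code u) (map root_type ts :: flatten (map code ts) ++ r) =
    (Node type1 ts == u).
  rewrite -cat_cons; apply/idP/eqP => [/prefixP[s]|<-]; last by exact: prefix_prefix.
  by move=> e; have [] := code_inj vt vu (esym u1) e.
rewrite [fringes _]/= [count _ (_ :: _)]/= -addnA; congr addn.
have {}vt : all valid_tree ts by [].
rewrite -/(forest_code _).
elim: ts ih vt => //= t ts iht ih /andP[vt vts].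
rewrite forest_code_cons -catA ih ?mem_head // iht //; last first.
  by move=> x xts; apply: ih; rewrite in_cons xts orbT.
by rewrite count_cat addnA.
Qed.

Lemma occurrences_code u t : valid_tree u -> root_type u = type1 -> valid_tree t ->
  occurrences (code u) (code t) = count_mem u (fringes t).
Proof.
by move=> vu u1 vt; rewrite -[code t]cats0 occurrences_code_cat // addn0.
Qed.

Definition drift (s : seq word) : int := \sum_(w <- s) ((xi w)%:Z - 1).
(** Each type 1 vertex is counted together with its type 2 children, so for a root of type 1 the
    weight of the code is the size of the tree. *)
Definition weight (s : seq word) : nat := \sum_(w <- s) (zeta w).+1.

Lemma drift_cons w s : drift (w :: s) = (xi w)%:Z - 1 + drift s.
Proof. by rewrite /drift big_cons. Qed.
Lemma drift_nil : drift [::] = 0. Proof. by rewrite /drift big_nil. Qed.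
Lemma drift_cat s s' : drift (s ++ s') = drift s + drift s'.
Proof. by rewrite /drift big_cat. Qed.
Lemma weight_cons w s : weight (w :: s) = ((zeta w).+1 + weight s)%N.
Proof. by rewrite /weight big_cons. Qed.
Lemma weight_nil : weight [::] = 0%N. Proof. by rewrite /weight big_nil. Qed.
Lemma weight_cat s s' : weight (s ++ s') = (weight s + weight s')%N.
Proof. by rewrite /weight big_cat. Qed.

Lemma size_le_weight s : (size s <= weight s)%N.
Proof. by elim: s => // w s ih; rewrite weight_cons /=; lia. Qed.

Definition lukasiewicz (s : seq word) : bool :=
  (drift s == -1) && all (fun i => 0 <= drift (take i s)) (iota 0 (size s)).

Lemma xi_cat w w' : xi (w ++ w') = (xi w + xi w')%N. Proof. exact: count_cat. Qed.

Lemma size_word w : size w = (xi w + zeta w)%N.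
Proof. by elim: w => //= -[] w ->; rewrite /xi /zeta /=; lia. Qed.

Lemma xi_root_types t ts :
  xi (map root_type (t :: ts)) = ((root_type t == type1) + xi (map root_type ts))%N.
Proof. by []. Qed.

Lemma zeta_root_types t ts :
  zeta (map root_type (t :: ts)) = ((root_type t == type2) + zeta (map root_type ts))%N.
Proof. by []. Qed.

Lemma forest_drift ts : {in ts, forall t, drift (code t) = - (root_type t == type1 : nat)%:Z} ->
  drift (forest_code ts) = - (xi (map root_type ts))%:Z.
Proof.
elim: ts => [|t ts ih] H; first by rewrite drift_nil.
rewrite forest_code_cons drift_cat H ?mem_head // xi_root_types ih; last first.
  by move=> u uts; apply: H; rewrite in_cons uts orbT.
by lia.
Qed.

Lemma drift_code t : valid_tree t -> drift (code t) = - (root_type t == type1 : nat)%:Z.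
Proof.
elim/tree_ind_mem: t => -[] ts ih /=; last by rewrite drift_nil.
move=> vts; rewrite drift_cons forest_drift; last by move=> t tts; apply: ih => //; apply: (allP vts).
by lia.
Qed.

(** A tree with root of type 1 lowers the walk by one, and does so only with its last word; before
    the end of the forest at least one root is therefore still pending. *)
Lemma forest_prefix ts : all valid_tree ts ->
  {in ts, forall t i, (i < size (code t))%N -> 0 <= drift (take i (code t))} ->
  forall i, (i < size (forest_code ts))%N ->
  1 - (xi (map root_type ts))%:Z <= drift (take i (forest_code ts)).
Proof.
elim: ts => [|t ts ih] // /andP[vt vts] H i.
rewrite xi_root_types forest_code_cons size_cat take_cat => Hi.
case: ltnP => Hit.
  have h1 := H _ (mem_head _ _) _ Hit.
  have : root_type t == type1 by move: Hit; case: (t) => -[].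
  by move=> ->; lia.
have Hi2 : (i - size (code t) < size (forest_code ts))%N by lia.
rewrite drift_cat drift_code //.
have := ih vts _ _ Hi2; case: (root_type t == type1) => H2.
all: have {}H2 := H2 (fun u uts => H u (mem_behead (s := t :: ts) uts)); lia.
Qed.

Lemma drift_take_code t : valid_tree t ->
  forall i, (i < size (code t))%N -> 0 <= drift (take i (code t)).
Proof.
elim/tree_ind_mem: t => -[] ts ih // vt [|i] Hi; first by rewrite take0 drift_nil.
have {}vt : all valid_tree ts by [].
have : (i < size (forest_code ts))%N by [].
move=> /(forest_prefix vt (fun t tts => ih t tts (allP vt t tts))) H.
by rewrite /= drift_cons; move: H; rewrite /forest_code; lia.
Qed.

Lemma lukasiewicz_code t : valid_tree t -> root_type t = type1 -> lukasiewicz (code t).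
Proof.
move=> vt t1; rewrite /lukasiewicz drift_code // t1 /=.
apply/allP => i; rewrite mem_iota add0n /=; exact: drift_take_code.
Qed.

(** Decoding with a stack: [w] is the list of types of the pending roots, and the hypothesis on
    prefixes says that a pending root of type 1 is available whenever a word is to be read. The
    inner induction on [w] discards pending leaves of type 2. *)
Lemma forest_of_walk s w : drift s = - (xi w)%:Z ->
  (forall i, (i < size s)%N -> - (xi w)%:Z < drift (take i s)) ->
  exists ts, [/\ map root_type ts = w, all valid_tree ts & forest_code ts = s].
Proof.
have leaves c v : forall ts, [/\ map root_type ts = v, all valid_tree ts & forest_code ts = c] ->
   exists ts, [/\ map root_type ts = type2 :: v, all valid_tree ts & forest_code ts = c].
  by move=> ts [e1 e2 e3]; exists (leaf type2 :: ts); rewrite /= e1 e2.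
elim: s w => [|u s ih] w.
  elim: w => [|[] w ihw] d H; first by exists [::].
    by move: d; rewrite drift_nil (_ : xi (type1 :: w) = (xi w).+1) //; lia.
  by have [ts /leaves] := ihw d H.
elim: w => [|[] w ihw] d H; last by have [ts /leaves] := ihw d H.
  by have := H 0%N isT; rewrite take0 drift_nil.
(* Reading u replaces the first pending root by its children. *)
have xw : xi (type1 :: w) = (xi w).+1 by [].
rewrite {}xw in d H.
have [ts [e1 e2 e3]] : exists ts,
    [/\ map root_type ts = u ++ w, all valid_tree ts & forest_code ts = s].
  apply: ih => [|i Hi]; first by move: d; rewrite drift_cons xi_cat; lia.
  by have := H i.+1 Hi; rewrite /= drift_cons xi_cat; lia.
have st : size ts = (size u + size w)%N by rewrite -(size_map root_type) e1 size_cat.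
move: e1; rewrite -{1}(cat_take_drop (size u) ts) map_cat.
move/eqP; rewrite eqseq_cat; last by rewrite size_map size_takel // st leq_addr.
move=> /andP[/eqP e4 /eqP e5].
exists (Node type1 (take (size u) ts) :: drop (size u) ts); split.
- by rewrite /= e5.
- by rewrite /= -all_cat cat_take_drop.
- by rewrite forest_code_cons /= -cat_cons -/(forest_code _) cat_cons -forest_code_cat
    cat_take_drop e3 e4.
Qed.

Lemma tree_of_lukasiewicz s : lukasiewicz s ->
  exists t, [/\ valid_tree t, root_type t = type1 & code t = s].
Proof.
move=> /andP[/eqP d /allP H].
have [ts [e1 vts e3]] : exists ts,
    [/\ map root_type ts = [:: type1], all valid_tree ts & forest_code ts = s].
  apply: forest_of_walk => [|i Hi]; first by rewrite d.
  by have := H i; rewrite mem_iota add0n Hi => /(_ isT) /(lt_le_trans _)->.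
case: ts e1 vts e3 => [|t []] //= [e1]; rewrite andbT /forest_code /= cats0 => vt et.
by exists t.
Qed.

(** * Vertices, ancestral lines and offspring words of a finite tree *)

Lemma big_flatten_addresses (V : Type) (idx : V) (op : Monoid.law idx) k
    (L : seq (seq (seq nat))) (F : seq nat -> V) :
  \big[op/idx]_(v <- flatten [seq map (cons iv.1) iv.2 | iv <- zip (iota k (size L)) L]) F v =
  \big[op/idx]_(i < size L) \big[op/idx]_(v <- nth [::] L i) F ((k + i)%N :: v).
Proof.
elim: L k => [|l L ih] k /=; first by rewrite big_nil big_ord0.
rewrite big_cat big_map ih big_ord_recl /= addn0; congr (op _ _).
by apply: eq_bigr => i _; rewrite addSnnS.
Qed.

Lemma big_vertices (V : Type) (idx : V) (op : Monoid.law idx) (F : seq nat -> V) g ts :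
  \big[op/idx]_(v <- vertices (Node g ts)) F v =
  op (F [::]) (\big[op/idx]_(i < size ts)
    \big[op/idx]_(v <- vertices (nth (leaf type1) ts i)) F (val i :: v)).
Proof.
rewrite /= big_cons big_flatten_addresses size_map; congr (op _ _).
by apply: eq_bigr => i _; rewrite (nth_map (leaf type1)).
Qed.

Lemma sum_vertices (V : nmodType) (F : seq nat -> V) g ts :
  \sum_(v <- vertices (Node g ts)) F v =
  F [::] + \sum_(i < size ts) \sum_(v <- vertices (nth (leaf type1) ts i)) F (val i :: v).
Proof. exact: big_vertices. Qed.

Lemma sum_ord_nth (V : nmodType) (T : Type) (x0 : T) (F : T -> V) (s : seq T) :
  \sum_(i < size s) F (nth x0 s i) = \sum_(x <- s) F x.
Proof. by rewrite (big_nth x0) big_mkord. Qed.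

Lemma count_sum (T : Type) (a : pred T) (s : seq T) :
  count a s = \sum_(x <- s) (a x : nat).
Proof. by elim: s => [|x s ih]; rewrite ?big_nil // big_cons /= ih. Qed.

Lemma tree_size_Node g ts : tree_size (Node g ts) = (\sum_(t <- ts) tree_size t).+1.
Proof.
have E t : tree_size t = \sum_(v <- vertices t) 1%N by rewrite sum1_size.
rewrite E (sum_vertices (fun=> 1%N)) -(sum_ord_nth (leaf type1)); congr S.
by apply: eq_bigr => i _; rewrite E.
Qed.

Lemma tree_size_gt0 t : (0 < tree_size t)%N. Proof. by case: t. Qed.

Lemma tree_size_code t : valid_tree t ->
  tree_size t = ((root_type t == type2) + weight (code t))%N.
Proof.
elim/tree_ind_mem: t => g ts ih /= /andP[v1 v2]; rewrite tree_size_Node.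
case: g v1 => v1; last by move: v1 => /= /nilP ->; rewrite big_nil weight_nil.
rewrite weight_cons /= add0n addSn; congr S; rewrite -/(forest_code ts).
elim: ts ih v2 {v1} => [|t ts iht] ih; first by rewrite big_nil weight_nil.
move=> /andP[vt vts]; rewrite big_cons iht //; last first.
  by move=> x xts; apply: ih; rewrite in_cons xts orbT.
rewrite (ih _ (mem_head _ _) vt) forest_code_cons weight_cat zeta_root_types; lia.
Qed.

Lemma onth_ltn (T : Type) (x0 : T) (s : seq T) i :
  (i < size s)%N -> onth s i = Some (nth x0 s i).
Proof. by move=> Hi; rewrite onthE (nth_map x0). Qed.

(** Computing the multiplicity settles at once that addresses are not repeated and which addresses
    occur. *)
Lemma count_vertices t v :
  count_mem v (vertices t) = (fringe_subtree t v != None).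
Proof.
elim: v t => [|i v ih] [g ts]; rewrite count_sum sum_vertices.
  by rewrite big1 => [|i _]; rewrite ?big1.
have -> : pred1 (i :: v) [::] = 0%N :> nat by [].
rewrite add0r [fringe_subtree _ _]/=.
case: (ltnP i (size ts)) => Hi; last first.
  rewrite (onth_default Hi) big1 => [//|j _]; rewrite big1 => // u _.
  by rewrite /= eqseq_cons; case: eqP => // e; have := ltn_ord j; rewrite /= e ltnNge Hi.
rewrite (onth_ltn (leaf type1) Hi) (bigD1 (Ordinal Hi)) //= -ih count_sum.
rewrite [X in (_ + X)%R]big1 ?addr0 => [|j ji].
  by apply: eq_bigr => u _; rewrite /= eqseq_cons eqxx.
rewrite big1 // => u _; rewrite /= eqseq_cons; case: eqP => // e.
by case/eqP: ji; apply: val_inj.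
Qed.

Lemma uniq_vertices t : uniq (vertices t).
Proof.
apply: count_mem_uniq => v; rewrite count_vertices.
have := count_vertices t v; case: (fringe_subtree t v == None) => /= e.
  by move/count_memPn/negbTE: e => ->.
by rewrite -has_pred1 has_count e.
Qed.

Lemma mem_vertices t v : (v \in vertices t) = (fringe_subtree t v != None).
Proof.
have := count_vertices t v; rewrite count_uniq_mem ?uniq_vertices //.
by case: (v \in _); case: (_ != None).
Qed.

(** Inverse of [ancestral_line]: it rebuilds the fringe subtree at the topmost ancestor, with the
    contexts again listed from the marked vertex upwards. *)
Fixpoint plug (s : tree) (cs : seq context) : tree :=
  if cs is Context g l r :: cs' then plug (Node g (l ++ s :: r)) cs' else s.

Definition address (cs : seq context) : seq nat :=
  rev [seq (let: Context _ l _ := c in size l) | c <- cs].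

Lemma plug_rcons s cs g l r :
  plug s (rcons cs (Context g l r)) = Node g (l ++ plug s cs :: r).
Proof. by elim: cs s => //= -[g' l' r'] cs ih s; rewrite ih. Qed.

Lemma ancestral_lineP t v s cs : v \in vertices t ->
  (ancestral_line t v == (s, cs)) = (plug s cs == t) && (v == address cs).
Proof.
rewrite mem_vertices.
elim: v t s cs => [|i v ih] [g ts] s cs /=.
  case: cs => [|[g' l r] cs] _.
    by rewrite /= andbT; apply/eqP/eqP => [[->]|->].
  by rewrite -pair_eqE /= andbF /address /= rev_cons; case: (rev _) => *; rewrite andbF.
case: (ltnP i (size ts)) => Hi; last by rewrite (onth_default Hi).
rewrite (onth_ltn (leaf type1) Hi) (set_nth_default (leaf type1)) // => /ih {}ih.
case E : (ancestral_line _ v) => [s' cs'].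
case/lastP: cs => [|cs [g' l r]].
  by rewrite /= andbF; apply/eqP => -[_]; case: (cs').
rewrite plug_rcons /address map_rcons rev_rcons eqseq_cons.
have -> : ((s', rcons cs' (Context g (take i ts) (drop i.+1 ts))) ==
   (s, rcons cs (Context g' l r))) =
   (ancestral_line (nth (leaf type1) ts i) v == (s, cs)) &&
   (Context g (take i ts) (drop i.+1 ts) == Context g' l r).
  by rewrite E -!pair_eqE /= eqseq_rcons andbA.
rewrite ih; apply/andP/andP => -[].
- move=> /andP[/eqP -> /eqP ->] /eqP[-> <- <-].
  rewrite size_takel ?(ltnW Hi) // !eqxx; split=> //.
  by rewrite -drop_nth // cat_take_drop.
- move=> /eqP[-> ets] /andP[/eqP il /eqP ->]; rewrite -ets il.
  rewrite nth_cat ltnn subnn /= !eqxx; split=> //.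
  by rewrite take_size_cat // drop_cat ltnNge leqW //= subSn // subnn /= drop0.
Qed.

Definition has_pattern (s : tree) (cs : seq context) (t : tree) (v : seq nat) : bool :=
  let: (s', cs') := ancestral_line t v in
  [&& s' == s, take (size cs) cs' == cs & (size cs <= size cs')%N].

(** A vertex sees the pattern exactly when the fringe subtree at its [size cs]-th ancestor is
    [plug s cs] and the vertex sits in it at [address cs]. Each copy of [plug s cs] thus accounts
    for one vertex, and local statistics reduce to counts of fringe subtrees. *)
Lemma count_pattern s cs t :
  count (has_pattern s cs t) (vertices t) = count_mem (plug s cs) (fringes t).
Proof.
elim/tree_ind_mem: t => g ts ih.
have -> : count_mem (plug s cs) (fringes (Node g ts)) =
   (Node g ts == plug s cs : nat) + \sum_(t <- ts) count_mem (plug s cs) (fringes t).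
  by rewrite /= count_flatten -map_comp sumnE big_map.
have -> : \sum_(t <- ts) count_mem (plug s cs) (fringes t) =
   \sum_(t <- ts) count (has_pattern s cs t) (vertices t).
  by apply: eq_big_seq => t tts; rewrite ih.
have -> : (Node g ts == plug s cs) =
    count (fun v => ancestral_line (Node g ts) v == (s, cs)) (vertices (Node g ts)) :> nat.
  rewrite (eq_in_count (a2 := fun v => (plug s cs == Node g ts) && (v == address cs))); last first.
    by move=> v vt /=; rewrite ancestral_lineP.
  rewrite eq_sym; case: eqP => [e|_] /=; last by rewrite count_pred0.
  rewrite -[X in _ = X]/(count_mem (address cs) (vertices (Node g ts))) count_vertices -e.
  elim/last_ind: cs {e ih} => // cs [g' l r] ihc.
  rewrite plug_rcons /address map_rcons rev_rcons /=.
  by rewrite (onth_ltn (leaf type1)) ?size_cat ?nth_cat ?ltnn ?subnn //= addnS ltnS leq_addr.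
rewrite -(sum_ord_nth (leaf type1)) !count_sum !sum_vertices.
rewrite -addrA; congr +%R.
  rewrite /has_pattern /=; case: cs {ih} => [|c cs] /=.
    by rewrite andbT -pair_eqE /= andbT.
  by rewrite andbF -pair_eqE /= andbF.
rewrite -big_split /=; apply: eq_bigr => i _.
rewrite count_sum -big_split /=; apply: eq_bigr => v _.
rewrite /has_pattern /= (set_nth_default (leaf type1) (Node g ts)) //.
case: (ancestral_line _ v) => s' cs'; rewrite size_rcons -pair_eqE /=.
case: eqP => //= _.
set c := Context _ _ _.
(* Here [cs'] is the line inside the child and [rcons cs' c] the full line: a match stays inside the
   child, or uses the full line, or is too long, according to the length of [cs]. *)
case: (ltngtP (size cs) (size cs').+1) => [|h|h].
- rewrite ltnS => h; rewrite h !andbT -[in LHS]cats1 takel_cat //.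
  have /negbTE -> : rcons cs' c != cs by apply/eqP => e; move: h; rewrite -e size_rcons ltnn.
  by rewrite add0r.
- have /negbTE -> : rcons cs' c != cs by apply/eqP => e; move: h; rewrite -e size_rcons ltnn.
  by rewrite leqNgt (ltnW h) !andbF.
- rewrite h ltnn andbF addr0 andbT take_oversize // size_rcons; exact: leqnn.
Qed.

Lemma fringe_at_mark s cs t v :
  (fringe_at (size cs) (mark t v) = (s, cs, false)) <-> has_pattern s cs t v.
Proof.
rewrite /mark /has_pattern; case: (ancestral_line t v) => s' cs' /=.
split=> [[-> -> /negbT]|/and3P[/eqP -> /eqP -> ]]; first by rewrite !eqxx -leqNgt.
by rewrite leqNgt => /negbTE ->.
Qed.

Definition internal_at (t : tree) (v : seq nat) : bool :=
  if fringe_subtree t v is Some s then root_type s == type1 else false.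
Definition word_at (t : tree) (v : seq nat) : word :=
  if fringe_subtree t v is Some s then map root_type (children s) else [::].
Definition internal (t : tree) : seq (seq nat) := [seq v <- vertices t | internal_at t v].

Lemma fringe_subtree_child g ts i v : (i < size ts)%N ->
  fringe_subtree (Node g ts) (i :: v) = fringe_subtree (nth (leaf type1) ts i) v.
Proof. by move=> Hi /=; rewrite (onth_ltn (leaf type1) Hi). Qed.

(** Independence is indexed by addresses while weights are indexed by the letters of the code; this
    identity passes from the former to the latter. *)
Lemma prod_internal (R : comPzSemiRingType) (f : word -> R) t : valid_tree t ->
  \prod_(v <- internal t) f (word_at t v) = \prod_(w <- code t) f w.
Proof.
rewrite big_filter big_mkcond /=.
elim/tree_ind_mem: t => g ts ih /andP[v1 v2].
rewrite big_vertices [code _]/=.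
have -> : \prod_(i < size ts) \prod_(v <- vertices (nth (leaf type1) ts i))
    (if internal_at (Node g ts) (val i :: v) then f (word_at (Node g ts) (val i :: v)) else 1) =
    \prod_(w <- forest_code ts) f w.
  rewrite big_flatten big_map /= (big_nth (leaf type1)) big_mkord.
  apply: eq_bigr => i _.
  have m : nth (leaf type1) ts i \in ts by exact: mem_nth.
  rewrite -(ih _ m (allP v2 _ m)).
  by apply: eq_bigr => v _; rewrite /internal_at /word_at !(fringe_subtree_child g).
case: g v1 => v1; rewrite /internal_at /word_at /=; first by rewrite big_cons.
by move: v1 => /= /nilP ->; rewrite /forest_code /= big_nil mulr1.
Qed.

Lemma valid_treeP t : valid_tree t <-> forall v s, fringe_subtree t v = Some s ->
  (root_type s == type1) || nilp (children s).
Proof.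
elim/tree_ind_mem: t => g ts ih /=; split=> [/andP[v1 v2] [|i v] s /=|H].
- by move=> [<-].
- case: (ltnP i (size ts)) => Hi; last by rewrite (onth_default Hi).
  rewrite (onth_ltn (leaf type1) Hi).
  have m : nth (leaf type1) ts i \in ts by rewrite mem_nth.
  by apply: (ih _ m).1; apply: (allP v2).
- rewrite (H [::] _ erefl) /=; apply/(all_nthP (leaf type1)) => i Hi.
  apply/(ih _ (mem_nth _ Hi)) => v s e; apply: (H (i :: v)).
  by rewrite /= (onth_ltn (leaf type1) Hi).
Qed.

Lemma grown_valid sigma t : grown sigma t -> valid_tree t.
Proof.
move=> [_ H]; apply/valid_treeP => v s /H; case: (root_type s) => //=.
by case: (children s).
Qed.

Lemma grownP sigma t : valid_tree t -> root_type t = type1 ->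
  grown sigma t <-> {in internal t, forall v, sigma v = word_at t v}.
Proof.
move=> /valid_treeP vt t1; split=> [[_ H] v|H].
  rewrite mem_filter /internal_at /word_at.
  by case E : fringe_subtree => [s|] //= /andP[/eqP s1 _]; have := H _ _ E; rewrite s1.
split=> // v s E; have := vt v s E.
case s1 : (root_type s) => /= H2; last by rewrite (nilP H2).
have := H v; rewrite mem_filter /internal_at /word_at E s1 mem_vertices E.
by move=> /(_ isT) ->.
Qed.

(** The offspring word may depend on the address and on the type, a form that is stable under the
    shift [v] to [i :: v] made by the induction. *)
Lemma types_determine_tree (sigma : seq nat -> gtype -> word) t t' :
  root_type t = root_type t' ->
  (forall v s, fringe_subtree t v = Some s ->
    map root_type (children s) = sigma v (root_type s)) ->
  (forall v s, fringe_subtree t' v = Some s ->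
    map root_type (children s) = sigma v (root_type s)) -> t = t'.
Proof.
elim/tree_ind_mem: t t' sigma => g ts ih [g' ts'] sigma /= eg H H'; subst g'; congr Node.
have := H [::] _ erefl; rewrite -(H' [::] _ erefl) /= => e.
have es : size ts = size ts' by have := congr1 size e; rewrite !size_map.
apply: (eq_from_nth (x0 := leaf type1)) => // i Hi.
apply: (ih _ (mem_nth _ Hi) _ (fun v => sigma (i :: v))).
- by have := congr1 (nth type1 ^~ i) e; rewrite !(nth_map (leaf type1)) -?es.
- by move=> v s E; apply: H; rewrite /= (onth_ltn (leaf type1) Hi).
- by move=> v s E; apply: H'; rewrite /= (onth_ltn (leaf type1)) -?es.
Qed.

Lemma grown_inj sigma t t' : grown sigma t -> grown sigma t' -> t = t'.
Proof.
move=> [t1 H] [t1' H'].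
apply: (@types_determine_tree (fun v g => if g is type1 then sigma v else [::])) => //.
by rewrite t1.
Qed.

Lemma branching_treeE sigma t : (branching_tree sigma = Some t) <-> grown sigma t.
Proof.
rewrite /branching_tree; case: pselect => [e|ne]; last by split=> // H; case: ne; exists t.
split=> [[<-]|H]; first exact: (svalP (cid e)).
by congr Some; apply: grown_inj H; exact: (svalP (cid e)).
Qed.

(** * Rotations and the cycle lemma *)

Lemma drift_drop i s : drift (drop i s) = drift s - drift (take i s).
Proof. by rewrite -{2}(cat_take_drop i s) drift_cat addrC addKr. Qed.

(** Rotating at [i] gives a first passage path exactly when [i] is the first time at which the walk
    attains its minimum. *)
Lemma lukasiewicz_rot s i : drift s = -1 -> (i < size s)%N ->
  lukasiewicz (rot i s) <->
  (forall l, (l < i)%N -> drift (take i s) < drift (take l s)) /\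
  (forall l, (i <= l < size s)%N -> drift (take i s) <= drift (take l s)).
Proof.
move=> d Hi.
have P1 j : (j <= size s - i)%N ->
    drift (take j (rot i s)) = drift (take (i + j) s) - drift (take i s).
  move=> Hj; rewrite /rot takel_cat ?size_drop // takeD drift_cat; lia.
(* Past the wrap the total drift -1 has been added; this is why the inequality is strict for times
   before [i] and weak for times after. *)
have P2 l : (l <= i)%N ->
    drift (take (size s - i + l) (rot i s)) = -1 - drift (take i s) + drift (take l s).
  move=> Hl; rewrite takeD drift_cat {1}/rot take_size_cat ?size_drop // drift_drop d.
  by rewrite /rot drop_size_cat ?size_drop // take_takel.
rewrite /lukasiewicz size_rot; split.
  move=> /andP[_ /allP H]; split=> l Hl.
    have /H : (size s - i + l)%N \in iota 0 (size s) by rewrite mem_iota; lia.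
    by rewrite P2; [lia|exact: ltnW].
  have /H : (l - i)%N \in iota 0 (size s) by rewrite mem_iota; lia.
  by rewrite P1; [rewrite subnKC; lia|lia].
move=> [H1 H2]; apply/andP; split.
  by rewrite /rot drift_cat drift_drop d; lia.
apply/allP => j; rewrite mem_iota add0n /= => Hj.
case: (leqP (size s - i) j) => h.
  case: (ltnP (j - (size s - i)) i) => h2; last by lia.
  have -> : j = (size s - i + (j - (size s - i)))%N by lia.
  by rewrite P2; [have := H1 _ h2; lia|exact: ltnW].
rewrite P1; last exact: ltnW.
have := H2 (i + j)%N; rewrite leq_addr /= -ltn_subRL h => /(_ isT); lia.
Qed.

(** The time of the first minimum exists and is unique. *)
Lemma cycle_lemma s : drift s = -1 ->
  (\sum_(i < size s) (lukasiewicz (rot i s) : nat) = 1)%N.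
Proof.
move=> d.
have s0 : (0 < size s)%N by case: s d => //; rewrite drift_nil.
pose c i := drift (take i s).
have [i0 i0P] : exists i : 'I_(size s), forall l : 'I_(size s), c i <= c l.
  by case: (@arg_minP _ _ _ (Ordinal s0) xpredT (fun i => c i) isT) => i _ H; exists i => l; exact: H.
pose Q i := (i < size s)%N && [forall l : 'I_(size s), c i <= c l].
have exQ : exists i, Q i by exists i0; rewrite /Q ltn_ord; apply/forallP.
have [i /andP[Hi /forallP mini] firsti] := ex_minnP exQ.
have luki : lukasiewicz (rot i s).
  apply/lukasiewicz_rot => //; split=> l Hl; last first.
    by case/andP: Hl => _ Hl; exact: (mini (Ordinal Hl)).
  rewrite -/(c i) -/(c l) ltNge; apply/negP => h.
  suff /firsti : Q l by rewrite leqNgt Hl.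
  rewrite /Q (ltn_trans Hl Hi); apply/forallP => l'; exact: le_trans h (mini l').
rewrite (bigD1 (Ordinal Hi)) //= luki big1 // => j ji.
case E : (lukasiewicz _) => //; have [E1 E2] := (lukasiewicz_rot d (ltn_ord j)).1 E.
have [L1 L2] := (lukasiewicz_rot d Hi).1 luki.
case: (ltngtP j i) => h.
- have := L1 _ h; have := E2 i; rewrite (ltnW h) Hi => /(_ isT) h1 h2.
  by have := lt_le_trans h2 h1; rewrite ltxx.
- have := E1 _ h; have := L2 j; rewrite (ltnW h) ltn_ord => /(_ isT) h1 h2.
  by have := lt_le_trans h2 h1; rewrite ltxx.
- by case/eqP: ji; apply: val_inj.
Qed.

Lemma drift_rot i s : drift (rot i s) = drift s.
Proof. by rewrite /rot drift_cat addrC -drift_cat cat_take_drop. Qed.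

Lemma weight_rot i s : weight (rot i s) = weight s.
Proof. by rewrite /rot weight_cat addnC -weight_cat cat_take_drop. Qed.

(** * Weighted sums over lists *)

Section weighted_lists.
Context {R : realType} {A : eqType}.
Variables (ws : seq A) (q : A -> R).

Fixpoint lists (m : nat) : seq (seq A) :=
  if m is m'.+1 then [seq w :: s | w <- ws, s <- lists m'] else [:: [::]].

Lemma mem_lists m s : (s \in lists m) = (size s == m) && all (mem ws) s.
Proof.
elim: m s => [|m ih] s /=; first by rewrite inE; case: s.
apply/allpairsP/idP => [[[w s'] /= [ww s's ->]]|].
  by move: s's; rewrite ih eqSS /= ww => /andP[-> ->].
by case: s => //= w s; rewrite eqSS => /and3P[e ww ws']; exists (w, s); rewrite /= ih e.
Qed.

Lemma uniq_lists m : uniq ws -> uniq (lists m).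
Proof.
move=> uws; elim: m => //= m ih; apply: allpairs_uniq => //.
by move=> [w s] [w' s'] _ _ /= [-> ->].
Qed.

Definition lists_upto (n : nat) : seq (seq A) := flatten [seq lists k | k <- iota 0 n.+1].

Lemma mem_lists_upto n s : (s \in lists_upto n) = (size s <= n)%N && all (mem ws) s.
Proof.
apply/flatten_mapP/andP => [[k]|[sn sw]].
  by rewrite mem_iota mem_lists => /andP[_ kn] /andP[/eqP -> ->].
by exists (size s); rewrite ?mem_iota // mem_lists eqxx.
Qed.

Lemma uniq_lists_upto n : uniq ws -> uniq (lists_upto n).
Proof.
move=> uws; rewrite /lists_upto; elim: n.+1 => // k ih.
rewrite -addn1 iotaD map_cat flatten_cat cat_uniq ih /= cats0 uniq_lists // andbT.
apply/hasPn => s; rewrite mem_lists add0n => /andP[/eqP sk _].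
apply/negP => /flatten_mapP[j]; rewrite mem_iota mem_lists add0n => /andP[_ jk] /andP[/eqP sj _].
by move: jk; rewrite -sj sk ltnn.
Qed.

(** The expectation of [F] over [m] independent letters, except that the total mass of [q] on [ws]
    is only assumed to be at most 1 later on. *)
Definition lsum (m : nat) (F : seq A -> R) : R :=
  \sum_(s <- lists m) (\prod_(w <- s) q w) * F s.

Lemma lsum0 F : lsum 0 F = F [::].
Proof. by rewrite /lsum /= big_seq1 big_nil mul1r. Qed.

Lemma lsumS m F : lsum m.+1 F = \sum_(w <- ws) q w * lsum m (fun s => F (w :: s)).
Proof.
rewrite /lsum /= big_allpairs_dep; apply: eq_bigr => w _.
by rewrite mulr_sumr; apply: eq_bigr => s _; rewrite big_cons mulrA.
Qed.

Lemma eq_lsum m F G : (forall s, size s = m -> F s = G s) -> lsum m F = lsum m G.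
Proof.
move=> FG; apply: eq_big_seq => s; rewrite mem_lists => /andP[/eqP/FG -> //].
Qed.

Lemma lsumD m F G : lsum m (fun s => F s + G s) = lsum m F + lsum m G.
Proof. by rewrite -big_split; apply: eq_bigr => s _; rewrite mulrDr. Qed.

Lemma lsumZ m c F : lsum m (fun s => c * F s) = c * lsum m F.
Proof. by rewrite mulr_sumr; apply: eq_bigr => s _; rewrite mulrCA. Qed.

Lemma lsum_sum (I : Type) (r : seq I) (P : pred I) m (F : I -> seq A -> R) :
  lsum m (fun s => \sum_(i <- r | P i) F i s) = \sum_(i <- r | P i) lsum m (F i).
Proof. by rewrite exchange_big; apply: eq_bigr => s _; rewrite mulr_sumr. Qed.

Lemma sum_lists_upto n F :
  \sum_(s <- lists_upto n) (\prod_(w <- s) q w) * F s = \sum_(m < n.+1) lsum m F.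
Proof.
by rewrite big_flatten big_map -[X in iota 0 X]subn0 -/(index_iota _ _) big_mkord.
Qed.

Lemma lsum_cat k m F :
  lsum (k + m) F = lsum k (fun s => lsum m (fun s' => F (s ++ s'))).
Proof.
elim: k F => [|k ih] F; first by rewrite lsum0.
by rewrite addSn !lsumS; apply: eq_bigr => w _; rewrite ih.
Qed.

Lemma lsum_exchange k m (F : seq A -> seq A -> R) :
  lsum k (fun s => lsum m (fun s' => F s s')) = lsum m (fun s' => lsum k (fun s => F s s')).
Proof.
rewrite /lsum; under eq_bigr do rewrite mulr_sumr.
rewrite exchange_big /=; apply: eq_bigr => s _; rewrite mulr_sumr.
by apply: eq_bigr => s' _; rewrite mulrCA.
Qed.

Lemma lsum_rot m i F : (i <= m)%N -> lsum m (fun s => F (rot i s)) = lsum m F.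
Proof.
move=> im; rewrite -{1}(subnKC im) lsum_cat.
transitivity (lsum i (fun s => lsum (m - i) (fun s' => F (s' ++ s)))).
  by apply: eq_lsum => s s1; apply: eq_lsum => s' _; rewrite -s1 rot_size_cat.
by rewrite lsum_exchange -lsum_cat subnK.
Qed.

Lemma lsum_prod m (f : A -> R) :
  lsum m (fun s => \prod_(w <- s) f w) = (\sum_(w <- ws) q w * f w) ^+ m.
Proof.
elim: m => [|m ih]; first by rewrite lsum0 big_nil.
rewrite lsumS exprS mulr_suml; apply: eq_bigr => w _.
under eq_lsum do rewrite big_cons.
by rewrite lsumZ ih mulrA.
Qed.

Lemma lsum_cst m c : lsum m (fun=> c) = (\sum_(w <- ws) q w) ^+ m * c.
Proof.
have /= := lsum_prod m (fun=> 1); under eq_bigr do rewrite mulr1.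
move=> <-; rewrite mulrC -lsumZ; apply: eq_lsum => s _.
by rewrite big1 ?mulr1.
Qed.

Hypothesis q_ge0 : forall w, 0 <= q w.

Lemma prod_weight_ge0 s : 0 <= \prod_(w <- s) q w.
Proof. exact: prodr_ge0. Qed.

Lemma le_lsum m F G : (forall s, size s = m -> all (mem ws) s -> F s <= G s) ->
  lsum m F <= lsum m G.
Proof.
move=> FG; rewrite /lsum big_seq [leRHS]big_seq; apply: ler_sum => s.
by rewrite mem_lists => /andP[/eqP sm sw]; rewrite ler_wpM2l ?prod_weight_ge0 ?FG.
Qed.

Lemma lsum_ge0 m F : (forall s, 0 <= F s) -> 0 <= lsum m F.
Proof. by move=> F0; apply: sumr_ge0 => s _; rewrite mulr_ge0 ?prod_weight_ge0. Qed.

Lemma lsum_prefix_le m f F : (forall s, 0 <= F s) -> all (mem ws) f -> uniq ws ->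
  (\prod_(w <- f) q w) * lsum m (fun s => F (f ++ s)) <= lsum (size f + m) F.
Proof.
move=> F0 fw uws; rewrite lsum_cat {2}/lsum.
rewrite (bigD1_seq f) ?uniq_lists //= ?mem_lists ?eqxx ?fw //.
by rewrite lerDl sumr_ge0 // => s _; rewrite mulr_ge0 ?prod_weight_ge0 ?lsum_ge0.
Qed.

Hypothesis q_le1 : \sum_(w <- ws) q w <= 1.
Let M : R := \sum_(w <- ws) q w.
Let M_ge0 : 0 <= M. Proof. exact: sumr_ge0. Qed.

Lemma lsum_le_cst m F c : 0 <= c -> (forall s, size s = m -> F s <= c) -> lsum m F <= c.
Proof.
move=> c0 Fc; apply: (@le_trans _ _ (lsum m (fun=> c))).
  by apply: le_lsum => s sm _; exact: Fc.
by rewrite lsum_cst ler_piMl // exprn_ile1.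
Qed.

(** Bernoulli's inequality: the mass lost in [m] draws is at most [m] times the mass lost in one. *)
Lemma lsum_ge_mass m : 1 - m%:R * (1 - M) <= lsum m (fun=> 1).
Proof.
rewrite lsum_cst mulr1 -/M; elim: m => [|m ih]; first by rewrite mul0r subr0.
rewrite exprS; have Mm : M ^+ m <= 1 by exact: exprn_ile1.
have Mm0 : 0 <= M ^+ m by exact: exprn_ge0.
have M1 : M <= 1 by [].
rewrite -addn1 natrD; nra.
Qed.

Lemma lsum_moment1 m (h : A -> R) :
  `|lsum m (fun s => \sum_(w <- s) h w)| <= m%:R * `|\sum_(w <- ws) q w * h w|.
Proof.
set d := \sum_(w <- ws) _; elim: m => [|m ih]; first by rewrite lsum0 big_nil normr0 mul0r.
have -> : lsum m.+1 (fun s => \sum_(w <- s) h w) =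
    d * M ^+ m + M * lsum m (fun s => \sum_(w <- s) h w).
  rewrite lsumS /d /M !mulr_suml -big_split; apply: eq_bigr => w _ /=.
  under eq_lsum do rewrite big_cons.
  by rewrite lsumD lsum_cst -/M; ring.
rewrite (le_trans (ler_normD _ _)) // !normrM (ger0_norm M_ge0) (ger0_norm (exprn_ge0 _ _)) //.
have Mm : M ^+ m <= 1 by exact: exprn_ile1.
have Mm0 : 0 <= M ^+ m by exact: exprn_ge0.
have M1 : M <= 1 by [].
have d0 := normr_ge0 d; have := normr_ge0 (lsum m (fun s => \sum_(w <- s) h w)).
move: `|lsum _ _| `|d| ih d0 => b e ih e0 b0; rewrite -addn1 natrD; nra.
Qed.

(** After truncation the letters are only nearly centred, so the squared mean remains with a factor
    [m ^+ 2]; a missing mass only decreases the terms. *)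
Lemma lsum_moment2 m (h : A -> R) :
  lsum m (fun s => (\sum_(w <- s) h w) ^+ 2) <=
  m%:R * (\sum_(w <- ws) q w * h w ^+ 2) + m%:R ^+ 2 * (\sum_(w <- ws) q w * h w) ^+ 2.
Proof.
set v := \sum_(w <- ws) q w * _ ^+ 2; set d := \sum_(w <- ws) _.
elim: m => [|m ih]; first by rewrite lsum0 big_nil !expr0n /= !mul0r addr0.
have -> : lsum m.+1 (fun s => (\sum_(w <- s) h w) ^+ 2) =
    v * M ^+ m + 2 * d * lsum m (fun s => \sum_(w <- s) h w) +
    M * lsum m (fun s => (\sum_(w <- s) h w) ^+ 2).
  rewrite lsumS /v /d /M [2 * _]mulrC -mulrA !mulr_suml -!big_split; apply: eq_bigr => w _ /=.
  rewrite (eq_lsum (G := fun s => h w ^+ 2 + ((2 * h w) * (\sum_(w <- s) h w) +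
    (\sum_(w <- s) h w) ^+ 2))) => [|s _]; last by rewrite big_cons; ring.
  by rewrite !lsumD lsum_cst -/M lsumZ; ring.
have v0 : 0 <= v by apply: sumr_ge0 => w _; rewrite mulr_ge0 ?sqr_ge0.
have Mm : M ^+ m <= 1 by exact: exprn_ile1.
have Mm0 : 0 <= M ^+ m by exact: exprn_ge0.
have M1 : M <= 1 by [].
have c0 : 0 <= lsum m (fun s => (\sum_(w <- s) h w) ^+ 2) by apply: lsum_ge0 => s; exact: sqr_ge0.
have b := lsum_moment1 m h; rewrite -/d in b.
have db : 2 * d * lsum m (fun s => \sum_(w <- s) h w) <= 2 * m%:R * d ^+ 2.
  rewrite (le_trans (ler_norm _)) // !normrM -(real_normK (num_real d)) expr2.
  rewrite (ger0_norm (ler0n _ 2)).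
  by have := ler_wpM2l (normr_ge0 d) b; nra.
move: (lsum m _) (lsum m _) ih c0 db => c b' ih c0 db.
have d2 : 0 <= d ^+ 2 by exact: sqr_ge0.
have m0 : 0 <= m%:R :> R by [].
have h1 : v * M ^+ m <= v by rewrite ler_piMr.
have h2 : M * b' <= b' by rewrite ler_piMl.
rewrite -addn1 natrD; nra.
Qed.

Lemma lsum_chebyshev m (h : A -> R) (t : R) : 0 < t ->
  lsum m (fun s => (t <= `|\sum_(w <- s) h w|)%R%:R) <=
  (m%:R * (\sum_(w <- ws) q w * h w ^+ 2) + m%:R ^+ 2 * (\sum_(w <- ws) q w * h w) ^+ 2) / t ^+ 2.
Proof.
move=> t0; rewrite ler_pdivlMr ?exprn_gt0 // (le_trans _ (lsum_moment2 m h)) //.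
rewrite mulrC -lsumZ; apply: le_lsum => s _ _.
case: (boolP (t <= _)) => [h1|_] /=; last by rewrite mulr0 sqr_ge0.
by rewrite mulr1 -(real_normK (num_real (\sum_(w <- s) _))) lerXn2r ?nnegrE // ltW.
Qed.

(** The partial sums strictly increase, so they visit [j] at most once, and the probabilities of
    visiting it at time [m] add up to at most 1. *)
Lemma lsum_renewal (x : A -> nat) N j : (forall w, 0 < x w)%N ->
  \sum_(m < N) lsum m (fun s => (\sum_(w <- s) x w == j)%N%:R) <= 1.
Proof.
move=> x0; elim: N j => [|N ih] j; first by rewrite big_ord0.
rewrite big_ord_recl /= lsum0 big_nil.
under eq_bigr do rewrite /bump add1n lsumS.
rewrite exchange_big /=.
case: j => [|j].
  rewrite big1 ?addr0 // => w _; rewrite big1 // => m _.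
  rewrite (eq_lsum (G := fun=> 0)) ?lsum_cst ?mulr0 // => s _.
  by rewrite big_cons addn_eq0 eqn0Ngt x0.
rewrite add0r (le_trans _ q_le1) //; apply: ler_sum => w _.
rewrite -mulr_sumr ler_piMr //.
case: (leqP (x w) j.+1) => h.
  rewrite (le_trans _ (ih (j.+1 - x w)%N)) // ler_sum // => m _.
  apply: le_lsum => s _ _; rewrite big_cons ler_nat.
  by case: eqP => // <-; rewrite addKn eqxx.
rewrite (le_trans _ ler01) // big1 // => m _.
rewrite (eq_lsum (G := fun=> 0)) ?lsum_cst ?mulr0 // => s _.
by rewrite big_cons; case: eqP => // e; move: h; rewrite -e ltnNge leq_addr.
Qed.

End weighted_lists.

Arguments eq_lsum {R A ws q m F G}.

(** * Exponential tail bounds for truncated sums and for occurrences of a code *)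

Lemma expR_le_quadratic (R : realType) (u b : R) : 0 <= u -> u <= b ->
  expR u <= 1 + u + u ^+ 2 * expR b.
Proof.
move=> u0 ub; apply: (@le_trans _ _ (1 + u + u ^+ 2 * expR u)); last first.
  by rewrite lerD2l ler_wpM2l ?sqr_ge0 // ler_expR.
have e0 := expR_gt0 u.
have h : expR u * (1 - u) <= 1.
  rewrite -(ler_pM2r (expR_gt0 (- u))) mul1r mulrAC -expRD subrr expR0 mul1r.
  exact: expR_ge1Dx.
case: (leP u 1) => u1; nra.
Qed.

Lemma expRN_le_quadratic (R : realType) (u : R) : 0 <= u -> expR (- u) <= 1 - u + u ^+ 2.
Proof.
move=> u0; have e0 := expR_gt0 (- u).
have : expR (- u) * (1 + u) <= 1.
  rewrite -(ler_pM2r (expR_gt0 u)) mul1r mulrAC -expRD addNr expR0 mul1r.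
  exact: expR_ge1Dx.
nra.
Qed.

(** Polynomial decay of order 4 suffices: the sum over the at most n + 1 possible lengths of a code
    is then of order n^-3, below n^-2. *)
Lemma expRN_le_inv4 (R : realType) (u : R) : 0 < u -> expR (- u) <= 256 / u ^+ 4.
Proof.
move=> u0; rewrite expRN -[leRHS]invrK invf_div lef_pV2 ?posrE ?expR_gt0 ?divr_gt0 ?exprn_gt0 //.
have -> : u ^+ 4 / 256 = (u / 4) ^+ 4 by field.
have -> : expR u = expR (u / 4) ^+ 4 by rewrite -expRM_natl; congr expR; field.
rewrite lerXn2r ?nnegrE ?expR_ge0 //; first by rewrite divr_ge0 // ltW.
by rewrite (le_trans _ (expR_ge1Dx _)) // lerDr.
Qed.

Section chernoff.
Context {R : realType} {A : eqType}.
Variables (ws : seq A) (q : A -> R).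
Hypothesis q_ge0 : forall w, 0 <= q w.
Hypothesis q_le1 : \sum_(w <- ws) q w <= 1.

(* The exponential moment is taken at l = ln n / (2 delta n), for which a word of
   weight at most delta n contributes a factor at most sqrt n. *)
Lemma lsum_no_big_jump (x : A -> nat) (mu C eps : R) (n m : nat) : 0 <= C -> 0 < eps ->
  \sum_(w <- ws) q w * (x w)%:R <= mu -> \sum_(w <- ws) q w * (x w)%:R ^+ 2 <= C ->
  (0 < n)%N -> (m <= n)%N -> m%:R * mu <= (1 - eps) * n%:R ->
  lsum ws q m (fun s => (all (fun w => (x w)%:R <= eps / 8 * n%:R) s &&
     ((\sum_(w <- s) x w)%N == n))%:R) <= expR (256 * C / eps ^+ 2) / n%:R ^+ 4.
Proof.
move=> C0 e0 mu1 mu2 n0 mn mmu.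
(* The value [eps / 8] makes [l * n * eps] equal to 4 ln n, which produces the factor n^-4. *)
set d := eps / 8; have d0 : 0 < d by rewrite divr_gt0.
have n0' : 0 < n%:R :> R by rewrite ltr0n.
have n1 : 1 <= n%:R :> R by rewrite ler1n.
set L : R := ln n%:R; have L0 : 0 <= L by rewrite ln_ge0.
set l := L / (2 * d * n%:R).
have l0 : 0 <= l by rewrite divr_ge0 // !mulr_ge0 // ltW.
set rr := expR (L / 2).
have rr2 : rr ^+ 2 = n%:R.
  by rewrite /rr -expRM_natl (_ : 2 * (L / 2) = L); [rewrite lnK // posrE|field].
have rr0 : 0 < rr := expR_gt0 _.
(* As [rr] is the square root of n, this keeps the quadratic error [m * (l ^+ 2 * rr * C)]
   bounded. *)
have L2 : L ^+ 2 <= 16 * rr.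
  have -> : rr = expR (L / 4) ^+ 2.
    by rewrite /rr -expRM_natl; congr expR; field.
  have h : L / 4 <= expR (L / 4) by rewrite (le_trans _ (expR_ge1Dx _)) // lerDr.
  have := expR_gt0 (L / 4); nra.
(* The Laplace transform restricted to light letters, for which [expR (l * x)] is at most [rr] and
   the quadratic bound applies. *)
set E := \sum_(w <- ws) q w * (if (x w)%:R <= d * n%:R then expR (l * (x w)%:R) else 0).
have E0 : 0 <= E.
  by apply: sumr_ge0 => w _; rewrite mulr_ge0 //; case: ifP => // _; rewrite expR_ge0.
have step : lsum ws q m (fun s => (all (fun w => (x w)%:R <= d * n%:R) s &&
     ((\sum_(w <- s) x w)%N == n))%:R) <= expR (- (l * n%:R)) * E ^+ m.
  rewrite -lsum_prod -lsumZ; apply: le_lsum => // s _ _.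
  case: (boolP (_ && _)) => [/andP[sb /eqP sn]|_]; last first.
    rewrite mulr_ge0 ?expR_ge0 // prodr_ge0 // => w _.
    by case: ifP => // _; rewrite expR_ge0.
  have -> : l * n%:R = \sum_(w <- s) l * (x w)%:R by rewrite -sn natr_sum mulr_sumr.
  have -> : \prod_(w <- s) (if (x w)%:R <= d * n%:R then expR (l * (x w)%:R) else 0) =
     expR (\sum_(w <- s) l * (x w)%:R).
    elim: s sb {sn} => [|w s ih] /=; first by rewrite !big_nil expR0.
    by move=> /andP[xw /ih e]; rewrite !big_cons e xw expRD.
  by rewrite -expRD addNr expR0.
have Eb : E <= expR (l * mu + l ^+ 2 * rr * C).
  apply: le_trans (expR_ge1Dx _).
  apply: (@le_trans _ _ (\sum_(w <- ws) (q w + l * (q w * (x w)%:R) +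
     l ^+ 2 * rr * (q w * (x w)%:R ^+ 2)))).
    apply: ler_sum => w _.
    have -> : q w + l * (q w * (x w)%:R) + l ^+ 2 * rr * (q w * (x w)%:R ^+ 2) =
      q w * (1 + l * (x w)%:R + (l * (x w)%:R) ^+ 2 * rr) by ring.
    rewrite ler_wpM2l //; case: ifP => [xw|_].
      apply: expR_le_quadratic; first by rewrite mulr_ge0.
      rewrite (le_trans (ler_wpM2l l0 xw)) //.
      by rewrite /l le_eqVlt; apply/orP; left; apply/eqP; field; rewrite !gt_eqF.
    have := sqr_ge0 (l * (x w)%:R); have : 0 <= l * (x w)%:R by rewrite mulr_ge0.
    nra.
  rewrite !big_split /= -!mulr_sumr -addrA lerD // lerD // ler_wpM2l //.
  by rewrite mulr_ge0 ?sqr_ge0 ?ltW.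
rewrite (le_trans step) //.
have -> : expR (256 * C / eps ^+ 2) / n%:R ^+ 4 = expR (256 * C / eps ^+ 2 - 4 * L).
  by rewrite expRB -[4]/(4%:R) expRM_natl lnK // posrE.
rewrite (le_trans (ler_wpM2l (expR_ge0 _) (lerXn2r m _ _ Eb))) ?nnegrE ?expR_ge0 //.
rewrite -expRM_natl -expRD ler_expR.
have h1 : l * n%:R * eps = 4 * L by rewrite /l /d; field; rewrite !gt_eqF.
have h2 : m%:R * (l ^+ 2 * rr * C) <= 256 * C / eps ^+ 2.
  have -> : m%:R * (l ^+ 2 * rr * C) = (m%:R / n%:R) * (L ^+ 2 / (16 * rr)) * (256 * C / eps ^+ 2).
    by rewrite /l /d -rr2; field; rewrite !gt_eqF.
  apply: ler_piMl; first by rewrite divr_ge0 ?sqr_ge0 ?mulr_ge0.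
  have r16 : 0 < 16 * rr by rewrite mulr_gt0.
  apply: mulr_ile1.
  - by rewrite divr_ge0.
  - by rewrite divr_ge0 ?sqr_ge0 ?ltW.
  - by rewrite ler_pdivrMr ?mul1r ?ler_nat.
  - by rewrite ler_pdivrMr ?mul1r.
have h3 : l * (m%:R * mu) <= l * ((1 - eps) * n%:R) by rewrite ler_wpM2l.
rewrite -mulr_natl mulrDr; nra.
Qed.

(** Occurrences in consecutive disjoint blocks are independent. Summing over the offsets smaller
    than the block length recovers all positions. *)
Fixpoint block_occurrences (c : seq A) (M : nat) (s : seq A) : nat :=
  if M is M'.+1 then (take (size c) s == c) + block_occurrences c M' (drop (size c) s)
  else 0.

Lemma sum_block_occurrences c M s :
  (\sum_(r < size c) block_occurrences c M (drop r s) =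
   \sum_(i < M * size c) (take (size c) (drop i s) == c))%N.
Proof.
elim: M s => [|M ih] s; first by rewrite mul0n big_ord0 big1.
rewrite mulSn big_split_ord /= big_split /=; congr addn.
have {}ih := ih (drop (size c) s).
under eq_bigr do rewrite drop_drop addnC -drop_drop.
by rewrite ih; apply: eq_bigr => i _; rewrite drop_drop addnC.
Qed.

Lemma lsum_pred1 c : uniq ws -> all (mem ws) c ->
  lsum ws q (size c) (fun s => (s == c)%:R) = \prod_(w <- c) q w.
Proof.
move=> uws cws; rewrite /lsum (bigD1_seq c) ?uniq_lists ?mem_lists ?eqxx //= mulr1.
by rewrite [X in _ + X]big1 ?addr0 // => s /negbTE ->; rewrite mulr0.
Qed.

(** Chernoff's bound for the lower tail, with [l = eps / 2]: the exponent is at most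
    [(p * l ^+ 2 - l * eps) * M], hence at most [- M * eps ^+ 2 / 4] since [p <= 1]. The last [r]
    letters are free. *)
Lemma lsum_block_occurrences c (eps : R) M r : uniq ws -> all (mem ws) c -> 0 <= eps ->
  lsum ws q (M * size c + r) (fun s =>
    ((block_occurrences c M s)%:R <= (\prod_(w <- c) q w - eps) * M%:R)%R%:R) <=
  expR (- (M%:R * eps ^+ 2 / 4)).
Proof.
move=> uws cws e0; set p := \prod_(w <- c) q w.
have p0 : 0 <= p by exact: prodr_ge0.
have p1 : p <= 1 by rewrite /p -lsum_pred1 // lsum_le_cst // => s _; case: (_ == _).
set l := eps / 2; have l0 : 0 <= l by rewrite divr_ge0.
have el : expR (- l) <= 1 - l + l ^+ 2 by exact: expRN_le_quadratic.
have H : lsum ws q (M * size c + r) (fun s => expR (- (l * (block_occurrences c M s)%:R))) <=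
    expR (- (p * (l - l ^+ 2) * M%:R)).
  elim: M => [|M ih].
    have -> : - (p * (l - l ^+ 2) * 0%:R) = 0 by rewrite mulr0 oppr0.
    rewrite expR0; apply: lsum_le_cst => // s _.
    by rewrite mulr0 oppr0 expR0.
  rewrite mulSn -addnA lsum_cat.
  (* The first block factors out; its contribution is 1, corrected by [expR (- l) - 1] when the
     block equals [c]. *)
  rewrite (eq_lsum (G := fun s => (lsum ws q (M * size c + r) (fun s' =>
     expR (- (l * (block_occurrences c M s')%:R)))) * (1 + (expR (- l) - 1) * (s == c)%:R))); last first.
    move=> s sc; rewrite mulrC -lsumZ; apply: eq_lsum => s' _ /=.
    rewrite -sc take_size_cat // drop_size_cat // natrD mulrDr opprD expRD; congr *%R.
    by case: (s == c); rewrite ?mulr1 ?mulr0 ?oppr0 ?expR0 ?addr0 // addrC subrK.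
  have -> : - (p * (l - l ^+ 2) * M.+1%:R) = - (p * (l - l ^+ 2) * M%:R) - p * (l - l ^+ 2).
    by rewrite -natr1; ring.
  rewrite lsumZ lsumD lsumZ lsum_pred1 // -/p expRD.
  apply: ler_pM => //.
  - by apply: lsum_ge0 => // s; exact: expR_ge0.
  - have h : lsum ws q (size c) (fun s => (s == c)%:R) <= lsum ws q (size c) (fun=> 1).
      by apply: le_lsum => // s _ _; case: (_ == _).
    move: h; rewrite lsum_pred1 // -/p; have := expR_gt0 (- l); nra.
  - apply: le_trans (expR_ge1Dx _).
    have : lsum ws q (size c) (fun=> 1) <= 1 by exact: lsum_le_cst.
    nra.
apply: (@le_trans _ _ (expR (l * ((p - eps) * M%:R)) *
   lsum ws q (M * size c + r) (fun s => expR (- (l * (block_occurrences c M s)%:R))))).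
  rewrite -lsumZ; apply: le_lsum => // s _ _.
  case: (boolP (_ <= (p - eps) * M%:R)) => h /=; last by rewrite mulr_ge0 ?expR_ge0.
  rewrite -expRD (le_trans _ (expR_ge1Dx _)) // lerDl subr_ge0; exact: ler_wpM2l.
rewrite (le_trans (ler_wpM2l (expR_ge0 _) H)) // -expRD ler_expR.
have M0 : 0 <= M%:R :> R by [].
have : 0 <= l ^+ 2 * (1 - p) * M%:R by rewrite !mulr_ge0 ?sqr_ge0 // subr_ge0.
by rewrite /l; nra.
Qed.

End chernoff.

Lemma occurrences_ge_blocks (c : seq word) M s : (M * size c <= size s)%N ->
  (\sum_(r < size c) block_occurrences c M (drop r s) <= occurrences c s)%N.
Proof.
move=> h; rewrite sum_block_occurrences /occurrences -(subnKC h) iotaD count_cat.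
apply: leq_trans (leq_addr _ _).
rewrite -sum1_count -[X in iota 0 X]subn0 -/(index_iota _ _) big_mkord [leqRHS]big_mkcond /=.
by apply: leq_sum => i _; rewrite prefixE; case: eqP.
Qed.

(** One block fewer than fits leaves room for every offset smaller than [k], at the cost of fewer
    than two blocks of letters plus rounding. *)
Lemma block_count k m : (0 < k)%N -> (2 * k <= m)%N ->
  (k * (m %/ k).-1 + k <= m)%N /\ (m <= k * (m %/ k).-1 + 2 * k)%N.
Proof.
move=> k0 km; have d0 : (0 < m %/ k)%N by rewrite divn_gt0 // (leq_trans _ km) // leq_pmull.
rewrite mul2n -addnn addnA -mulnSr prednK // mulnC leq_trunc_div; split=> //.
by rewrite {1}(divn_eq m k) leq_add2l ltnW // ltn_mod.
Qed.

Section occurrences_tail.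
Context {R : realType}.
Variables (ws : seq word) (q : word -> R).
Hypothesis q_ge0 : forall w, 0 <= q w.
Hypothesis q_le1 : \sum_(w <- ws) q w <= 1.

Lemma lsum_drop_le m r (F : seq word -> R) : (forall s, 0 <= F s) ->
  lsum ws q (r + m) (fun s => F (drop r s)) <= lsum ws q m F.
Proof.
move=> F0; rewrite lsum_cat.
apply: lsum_le_cst => //; first exact: lsum_ge0.
by move=> s <-; apply: le_lsum => // s' _ _; rewrite drop_size_cat.
Qed.

(** If [c] occurs too rarely, then at one of the [size c] offsets it occurs too rarely among the
    blocks. The union bound costs the factor [size c], and the letters lost at the ends are absorbed
    by half of [eps]. *)
Lemma lsum_occurrences_small c (eps : R) m : uniq ws -> all (mem ws) c -> 0 < eps ->
  (0 < size c)%N -> 4 * (size c)%:R <= eps * m%:R ->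
  lsum ws q m (fun s =>
    ((occurrences c s)%:R < (\prod_(w <- c) q w - eps) * m%:R)%R%:R) <=
  (size c)%:R * (256 / (eps ^+ 2 / (32 * (size c)%:R) * m%:R) ^+ 4).
Proof.
move=> uws cws e0 c0 Hm; set k := size c; set p := \prod_(w <- c) q w.
have p0 : 0 <= p by exact: prodr_ge0.
have p1 : p <= 1.
  by rewrite /p -(@lsum_pred1 _ _ ws) // lsum_le_cst // => s _; case: (_ == _).
have k0 : 0 < k%:R :> R by rewrite ltr0n.
(* In this case the threshold is not positive and the event is empty. *)
case: (leP p eps) => pe.
  apply: (@le_trans _ _ 0); last first.
    by rewrite mulr_ge0 // divr_ge0 // exprn_ge0 // mulr_ge0 // divr_ge0 ?sqr_ge0 // mulr_ge0.
  rewrite (eq_lsum (G := fun=> 0)) ?lsum_cst ?mulr0 // => s _.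
  case: (boolP (_ < _ * m%:R)) => // h.
  have h1 : (p - eps) * m%:R <= 0 by rewrite mulr_le0_ge0 // subr_le0.
  by have := lt_le_trans h h1; rewrite ltrn0.
have km : (2 * k <= m)%N.
  have h : eps * m%:R <= m%:R by rewrite ler_piMl // ltW // (lt_le_trans pe).
  by rewrite -(ler_nat R) natrM; move: Hm; rewrite -/k; lra.
pose M := (m %/ k).-1.
have [kM Mk] : (k * M + k <= m)%N /\ (m <= k * M + 2 * k)%N := block_count c0 km.
have MkR : m%:R <= k%:R * M%:R + 2 * k%:R :> R by rewrite -natrM -natrM -natrD ler_nat.
apply: (@le_trans _ _ (\sum_(r < k) lsum ws q m (fun s =>
    ((block_occurrences c M (drop r s))%:R <= (p - eps / 2) * M%:R)%R%:R))).
  rewrite -lsum_sum; apply: le_lsum => // s sm _.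
  case: (boolP (_ < _ * m%:R)) => h /=; last by apply: sumr_ge0 => r _; rewrite ler0n.
  case: (boolP [exists r : 'I_k, (block_occurrences c M (drop r s))%:R <= (p - eps / 2) * M%:R]).
    move=> /existsP[r hr]; rewrite (bigD1 r) //= hr lerDl.
    by apply: sumr_ge0 => i _; rewrite ler0n.
  rewrite negb_exists => /forallP H; exfalso.
  have Mks : (M * size c <= size s)%N by rewrite sm mulnC (leq_trans _ kM) // leq_addr.
  have := occurrences_ge_blocks Mks; rewrite -(ler_nat R) natr_sum => h2.
  have : \sum_(r < k) (p - eps / 2) * M%:R <= \sum_(r < k) (block_occurrences c M (drop r s))%:R.
    by apply: ler_sum => r _; have := H r; rewrite -ltNge => /ltW.
  rewrite sumr_const card_ord -mulr_natl => h3.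
  have M0 : 0 <= M%:R :> R by []. nra.
apply: (@le_trans _ _ (\sum_(r < k) expR (- (M%:R * (eps / 2) ^+ 2 / 4)))).
  apply: ler_sum => r _.
  have rk := ltn_ord r.
  have -> : m = (r + (M * k + (m - r - M * k)))%N by rewrite -subnDA addnA subnKC // addnC (leq_trans _ kM) // mulnC leq_add2l ltnW.
  apply: le_trans (lsum_drop_le _ _ (F := fun s =>
    ((block_occurrences c M s)%:R <= (p - eps / 2) * M%:R)%R%:R) _) _.
    by move=> s; rewrite ler0n.
  have e20 : 0 <= eps / 2 by rewrite divr_ge0 // ltW.
  exact: (@lsum_block_occurrences _ _ _ _ q_ge0 q_le1 c (eps / 2) M _ uws cws e20).
rewrite sumr_const card_ord -[leLHS]mulr_natl; apply: ler_wpM2l => //.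
have m0 : 0 < m%:R :> R by rewrite ltr0n (leq_trans c0) // (leq_trans _ km) // leq_pmull.
apply: le_trans (expRN_le_inv4 _); last by rewrite mulr_gt0 // divr_gt0 ?exprn_gt0 ?mulr_gt0.
rewrite ler_expR lerN2.
(* At least half of the letters lie in blocks, which turns [M * (eps / 2) ^+ 2 / 4] into the
   exponent with 32. *)
have h1 : m%:R <= 2 * (k%:R * M%:R) :> R by nra.
rewrite mulrAC ler_pdivrMr ?mulr_gt0 //.
have := ler_wpM2l (sqr_ge0 eps) h1; nra.
Qed.

End occurrences_tail.

(** * Local lower bounds *)

(** The classical bound 'C(2k, k) >= 4^k / (2 sqrt k), squared so as to stay among integers. *)
Lemma central_binomial (k : nat) : (0 < k)%N -> (16 ^ k <= 4 * k * 'C(k.*2, k) ^ 2)%N.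
Proof.
elim: k => // -[|k] ih _ //; move: (ih isT) => {ih}.
set K := k.+1; set c := 'C(K.*2, K) => ih.
have e1 : (K.+1 * 'C(K.*2.+1, K.+1) = K.*2.+1 * c)%N by rewrite -mul_bin_diag.
have e2 : 'C(K.*2.+1, K) = 'C(K.*2.+1, K.+1).
  by rewrite -bin_sub; [congr binomial; lia|lia].
have e3 : (K.+1 * 'C(K.+1.*2, K.+1) = 2 * (K.*2.+1 * c))%N.
  by rewrite doubleS binS mulnDr e2 e1 mul2n addnn.
move: 'C(K.+1.*2, K.+1) e3 => c' e3.
rewrite -(leq_pmul2l (ltn0Sn K)).
have -> : (K.+1 * (4 * K.+1 * c' ^ 2) = 4 * (K.+1 * c') ^ 2)%N by lia.
rewrite e3 expnS.
apply: (@leq_trans (K.+1 * (16 * (4 * K * c ^ 2)))%N); first by rewrite !leq_mul2l ih !orbT.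
have -> : (K.+1 * (16 * (4 * K * c ^ 2)) = (64 * (K * K.+1)) * c ^ 2)%N by lia.
have -> : (4 * (2 * (K.*2.+1 * c)) ^ 2 = (16 * K.*2.+1 ^ 2) * c ^ 2)%N by lia.
by rewrite leq_mul2r; apply/orP; right; nia.
Qed.

(** Successive coefficients have ratio (k - i) / (k + i + 1), which is at least [1 - u] for i < l
    and u = 2l / k, and [1 - u] is at least [expR (- (2 * u))] as [u <= 1 / 2]. *)
Lemma binomial_off_center (R : realType) (k l : nat) : (4 * l <= k)%N -> (0 < k)%N ->
  'C(k.*2, k)%:R * expR (- (4 * l%:R ^+ 2 / k%:R)) <= 'C(k.*2, k + l)%:R :> R.
Proof.
move=> lk k0; have k0' : 0 < k%:R :> R by rewrite ltr0n.
have lkR : 4 * l%:R <= k%:R :> R by rewrite -natrM ler_nat.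
have l0 : 0 <= l%:R :> R by [].
set u : R := 2 * l%:R / k%:R.
have u2 : u <= 1 / 2 by rewrite /u ler_pdivrMr //; lra.
have u0 : 0 <= u by rewrite divr_ge0 ?mulr_ge0.
have step i : (i <= l)%N -> 'C(k.*2, k)%:R * (1 - u) ^+ i <= 'C(k.*2, k + i)%:R :> R.
  elim: i => [|i ih] il; first by rewrite mulr1 addn0.
  have {}ih := ih (ltnW il).
  have e : ((k + i).+1 * 'C(k.*2, (k + i).+1) = (k - i) * 'C(k.*2, k + i))%N.
    by rewrite mul_bin_left; congr muln; lia.
  have eR : (k%:R + i%:R + 1) * 'C(k.*2, k + i.+1)%:R = (k%:R - i%:R) * 'C(k.*2, k + i)%:R :> R.
    have ki : (i <= k)%N by lia.
    by rewrite -natrB // -natrM -e addnS natrM -addn1 !natrD.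
  have i0 : 0 <= i%:R :> R by [].
  have ilR : i%:R + 1 <= l%:R :> R by rewrite natr1 ler_nat.
  have h : (1 - u) * (k%:R + i%:R + 1) <= k%:R - i%:R.
    have uk : u * k%:R = 2 * l%:R by rewrite /u mulfVK // gt_eqF.
    nra.
  have C0 : 0 <= 'C(k.*2, k + i)%:R :> R by [].
  rewrite exprSr mulrA; apply: (@le_trans _ _ ('C(k.*2, k + i)%:R * (1 - u))).
    by rewrite ler_wpM2r // subr_ge0 (le_trans u2) //; lra.
  rewrite -(@ler_pM2r _ (k%:R + i%:R + 1)); last by lra.
  rewrite [leRHS]mulrC eR -mulrA [leRHS]mulrC; exact: ler_wpM2l.
rewrite (le_trans _ (step l (leqnn l))) // ler_wpM2l //.
have -> : - (4 * l%:R ^+ 2 / k%:R) = l%:R * (- (2 * u)) by rewrite /u; field; rewrite gt_eqF.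
have u1 : 0 < 1 - u by lra.
rewrite expRM_natl; apply: lerXn2r; rewrite ?nnegrE ?expR_ge0 ?(ltW u1) //.
rewrite expRN -[leRHS]invrK lef_pV2 ?posrE ?expR_gt0 ?invr_gt0 //.
apply: (@le_trans _ _ (1 + 2 * u)); last exact: expR_ge1Dx.
by rewrite -div1r ler_pdivrMr //; nra.
Qed.

Definition bin (R : realType) (B j : nat) : R := 'C(B, j)%:R / 2 ^+ B.

Lemma bin_ge0 (R : realType) B j : 0 <= bin R B j.
Proof. by rewrite divr_ge0 ?exprn_ge0. Qed.

(** In a window of width of order sqrt B around the centre, the binomial weights are at least of
    order 1 / sqrt B; the square avoids the root. *)
Lemma bin_lower (R : realType) (C : R) : 0 <= C -> exists2 c : R, 0 < c &
  exists B0 : nat, forall B j, (B0 <= B)%N ->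
    (2 * j%:R - B%:R) ^+ 2 <= C * B%:R -> c <= B%:R * bin R B j ^+ 2.
Proof.
move=> C0; exists (expR (- (12 * C + 12)) / 16); first by rewrite divr_gt0 ?expR_gt0.
exists (Num.truncn (200 * (C + 1))).+4 => B j HB Hj.
have B0 : 200 * (C + 1) < B%:R.
  rewrite (lt_le_trans (truncnS_gt _)) // ler_nat (leq_trans _ HB) //.
  exact: (leq_addl 3).
have {HB} B4 : (4 <= B)%N by rewrite (leq_trans _ HB).
set k := B./2; have BE := odd_double_half B; rewrite -/k in BE.
have k2 : (2 <= k)%N by lia.
have kB : k.*2%:R <= B%:R :> R by rewrite ler_nat; lia.
have Bk : B%:R <= k.*2%:R + 1 :> R by rewrite natr1 ler_nat; lia.
have kk : k.*2%:R = 2 * k%:R :> R by rewrite -mul2n natrM.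
have kR : 2 <= k%:R :> R by rewrite ler_nat.
pose l := (maxn j k - minn j k)%N.
have l2 : (2 * l%:R) ^+ 2 <= 2 * (C * B%:R) + 2.
  have e : l%:R = j%:R - k%:R :> R \/ l%:R = k%:R - j%:R :> R.
    case: (leqP j k) => h; [right|left].
      by rewrite /l (maxn_idPr h) (minn_idPl h) natrB.
    by rewrite /l (maxn_idPl (ltnW h)) (minn_idPr (ltnW h)) natrB // ltnW.
  have -> : (2 * l%:R) ^+ 2 = ((2 * j%:R - B%:R) + (B%:R - 2 * k%:R)) ^+ 2 :> R.
    by case: e => ->; ring.
  rewrite kk in kB Bk.
  have b1 : (B%:R - 2 * k%:R) ^+ 2 <= 1 :> R by nra.
  have := sqr_ge0 ((2 * j%:R - B%:R) - (B%:R - 2 * k%:R) : R); nra.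
have lk : (4 * l <= k)%N.
  rewrite -(ler_nat R) natrM leNgt; apply/negP => h.
  have : k%:R ^+ 2 < (4 * l%:R) ^+ 2 by nra.
  nra.
have k0 : (0 < k)%N by lia.
have Cl : 'C(k.*2, k + l) = 'C(k.*2, j).
  case: (leqP j k) => h; rewrite /l.
    rewrite (maxn_idPr h) (minn_idPl h) -bin_sub; [congr binomial; lia|lia].
  by rewrite (maxn_idPl (ltnW h)) (minn_idPr (ltnW h)) subnKC // ltnW.
(* An odd [B] is compared with [B - 1], which costs a factor 2 through the power of 2. *)
have CB : 'C(k.*2, j)%:R <= 'C(B, j)%:R :> R.
  by rewrite ler_nat -BE; apply: leq_bin2l; rewrite leq_addl.
have h1 := @binomial_off_center R k l lk k0; rewrite Cl in h1.
have h2 : expR (- (6 * C + 6)) <= expR (- (4 * l%:R ^+ 2 / k%:R)).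
  rewrite ler_expR lerN2 ler_pdivrMr; last by lra.
  nra.
have h3 : 16 ^+ k <= 4 * k%:R * 'C(k.*2, k)%:R ^+ 2 :> R.
  by rewrite -!natrX -!natrM ler_nat; exact: central_binomial.
have h4 : 2 ^+ B <= 2 * 4 ^+ k :> R.
  rewrite -BE exprD -mul2n exprM (_ : 2 ^+ 2 = 4); last by rewrite expr2 -natrM.
  rewrite ler_wpM2r ?exprn_ge0 //; case: (odd B) => //=; by rewrite ?expr1 ?expr0 ?ler1n.
set c := 'C(k.*2, k)%:R in h1 h3; set b := 'C(B, j)%:R in CB.
set e := expR (- (6 * C + 6)) in h2.
have e0 : 0 < e := expR_gt0 _.
have ee : expR (- (12 * C + 12)) = e ^+ 2.
  by rewrite /e -expRM_natl; congr expR; ring.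
have c0 : 0 <= c by [].
have cb : c * e <= b by rewrite (le_trans _ CB) // (le_trans _ h1) // ler_wpM2l.
have four : (4 ^+ k) ^+ 2 = 16 ^+ k :> R.
  by rewrite exprAC (_ : 4 ^+ 2 = 16) //; rewrite expr2 -natrM.
rewrite ee /bin -/b expr_div_n mulrA ler_pdivlMr ?exprn_gt0 // mulrAC ler_pdivrMr //.
have p1 : (2 ^+ B) ^+ 2 <= 4 * 16 ^+ k :> R.
  have -> : 4 * 16 ^+ k = (2 * 4 ^+ k) ^+ 2 :> R by rewrite -four; ring.
  by rewrite lerXn2r ?nnegrE ?mulr_ge0 ?exprn_ge0.
have p2 : (c * e) ^+ 2 <= b ^+ 2 by rewrite lerXn2r ?nnegrE ?mulr_ge0 // ltW.
apply: (@le_trans _ _ (e ^+ 2 * (4 * (4 * k%:R * c ^+ 2)))).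
  by rewrite ler_wpM2l ?sqr_ge0 // (le_trans p1) // ler_wpM2l.
have -> : e ^+ 2 * (4 * (4 * k%:R * c ^+ 2)) = 16 * k%:R * (c * e) ^+ 2 by ring.
have q1 : k%:R * (c * e) ^+ 2 <= B%:R * b ^+ 2.
  by apply: ler_pM => //; [exact: sqr_ge0|lra].
lra.
Qed.

(** * Two-stage sampling and a local lower bound for the planar walk *)

Definition step (w : word) : int * int := ((xi w)%:Z - 1, (zeta w).+1%:Z).
Definition displacement (s : seq word) : int * int := (drift s, (weight s)%:Z).

Lemma displacement_nil : displacement [::] = 0.
Proof. by rewrite /displacement drift_nil weight_nil. Qed.

Lemma displacement_cons w s : displacement (w :: s) = step w + displacement s.
Proof. by rewrite /displacement drift_cons weight_cons PoszD. Qed.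

Lemma displacement_cat s s' : displacement (s ++ s') = displacement s + displacement s'.
Proof. by rewrite /displacement drift_cat weight_cat PoszD. Qed.

Lemma binS0 (R : realType) B : bin R B.+1 0 = 2^-1 * bin R B 0.
Proof. by rewrite /bin !bin0 exprS invfM !mul1r. Qed.

Lemma binSS (R : realType) B j : bin R B.+1 j.+1 = 2^-1 * (bin R B j + bin R B j.+1).
Proof. by rewrite /bin binS natrD exprS invfM; ring. Qed.

(* A word is drawn in two stages: a shape, which is either a word or one of two
   pairs {w0, w1}, {w0, w2}, and then, in the latter case, a fair coin. *)
Section shapes.
Context {R : realType}.
Variables (q : word -> R) (w0 w1 w2 : word) (eps : R).

Definition protoword := (word + bool)%type.
Definition second (b : bool) : word := if b then w1 else w2.
(** Each pair has mass [2 * eps], of which its coin returns half to [w0] and half to the other word;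
    hence the removal of [2 * eps] from [w0] and of [eps] from [w1] and from [w2]. *)
Definition shape_weight (a : protoword) : R :=
  match a with
  | inl w => q w - eps * ((w == w1)%:R + (w == w2)%:R + 2 * (w == w0)%:R)
  | inr _ => 2 * eps
  end.
Definition shapes (ws : seq word) : seq protoword := map inl ws ++ [:: inr true; inr false].

Definition low_word (a : protoword) : word := if a is inl w then w else w0.
Definition low (z : seq protoword) : seq word := map low_word z.
Definition coins (b : bool) (z : seq protoword) : nat := count_mem (inr b) z.
Definition jump (b : bool) : int * int := step (second b) - step w0.

(** The conditional probability, given the shapes [z], that the coins bring the walk to [t]. *)
Fixpoint hit (z : seq protoword) (t : int * int) : R :=
  match z with
  | [::] => (t == 0)%:R
  | inl w :: z' => hit z' (t - step w)
  | inr b :: z' => 2^-1 * (hit z' (t - step w0) + hit z' (t - step (second b)))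
  end.

Lemma hit_ge0 z t : 0 <= hit z t.
Proof.
elim: z t => [|[w|b] z ih] t /=; first by rewrite ler0n.
  exact: ih.
by rewrite mulr_ge0 // addr_ge0.
Qed.

(** The coins of the two kinds are independent, and one way to reach the target is that exactly [j1]
    and [j2] of them choose the second word of their pair. *)
Lemma hit_ge_bin z j1 j2 :
  bin R (coins true z) j1 * bin R (coins false z) j2 <=
  hit z (displacement (low z) + jump true *+ j1 + jump false *+ j2).
Proof.
elim: z j1 j2 => [|[w|b] z ih] j1 j2.
- rewrite /= displacement_nil /coins /= /bin !bin0n add0r.
  case: j1 => [|j1]; last by rewrite !mul0r ler0n.
  case: j2 => [|j2]; last by rewrite !mul0r mulr0 ler0n.
  by rewrite !mulr0n addr0 eqxx expr0 divr1 mulr1.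
- rewrite [low _]/= displacement_cons [hit _ _]/=.
  have -> : step w + displacement (low z) + jump true *+ j1 + jump false *+ j2 - step w =
    displacement (low z) + jump true *+ j1 + jump false *+ j2 by ring.
  exact: ih.
- rewrite [low _]/= displacement_cons [hit _ _]/=.
  set t := (X in hit z (X - step w0)).
  have -> : t - step w0 = displacement (low z) + jump true *+ j1 + jump false *+ j2.
    by rewrite /t; ring.
  have -> : t - step (second b) =
    displacement (low z) + jump true *+ j1 + jump false *+ j2 - jump b.
    by rewrite /t (_ : jump b = step (second b) - step w0) //; ring.
  case: b {t}.
  + rewrite /coins /= add1n add0n -/(coins true z) -/(coins false z).
    case: j1 => [|j1].
      rewrite binS0 mulrDr -mulrA (le_trans (ler_wpM2l _ (ih 0%N j2))) //.
      by rewrite lerDl mulr_ge0 ?hit_ge0.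
    rewrite binSS -mulrA ler_wpM2l // mulrDl addrC lerD ?ih //.
    by have := ih j1 j2; rewrite mulrSr; congr (_ <= hit z _); ring.
  + rewrite /coins /= add1n add0n -/(coins true z) -/(coins false z).
    case: j2 => [|j2].
      rewrite binS0 mulrDr mulrCA (le_trans (ler_wpM2l _ (ih j1 0%N))) //.
      by rewrite lerDl mulr_ge0 ?hit_ge0.
    rewrite binSS mulrCA ler_wpM2l // mulrDr addrC lerD ?ih //.
    by have := ih j1 j2; rewrite mulrSr; congr (_ <= hit z _); ring.
Qed.

Variable (ws : seq word).
Hypotheses (uws : uniq ws) (ws0 : w0 \in ws) (ws1 : w1 \in ws) (ws2 : w2 \in ws).

Lemma sum_pick (V : nmodType) w (F : word -> V) : w \in ws ->
  \sum_(u <- ws) (if u == w then F u else 0) = F w.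
Proof.
by move=> wws; rewrite (bigD1_seq w) //= eqxx big1 ?addr0 // => u /negbTE ->.
Qed.

Lemma sum_shapes (F : word -> R) :
  \sum_(w <- ws) q w * F w = \sum_(a <- shapes ws) shape_weight a *
    (if a is inr b then 2^-1 * (F w0 + F (second b)) else F (low_word a)).
Proof.
rewrite big_cat big_map !big_cons big_nil /= addr0.
transitivity (\sum_(w <- ws) (q w - eps * ((w == w1)%:R + (w == w2)%:R + 2 * (w == w0)%:R)) * F w
  + eps * (\sum_(w <- ws) (if w == w1 then F w else 0) + \sum_(w <- ws) (if w == w2 then F w else 0)
  + 2 * \sum_(w <- ws) (if w == w0 then F w else 0))).
  rewrite mulr_sumr -!big_split mulr_sumr -big_split /=; apply: eq_bigr => w _.
  by case: (w == w1); case: (w == w2); case: (w == w0) => /=; ring.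
by rewrite !sum_pick // /second; field.
Qed.

Lemma lsum_hit m t :
  lsum ws q m (fun s => (displacement s == t)%:R) =
  lsum (shapes ws) shape_weight m (fun z => hit z t).
Proof.
elim: m t => [|m ih] t; first by rewrite !lsum0 displacement_nil eq_sym.
rewrite !lsumS (sum_shapes (fun w => lsum ws q m (fun s => (displacement (w :: s) == t)%:R))).
have E w : lsum ws q m (fun s => (displacement (w :: s) == t)%:R) =
    lsum (shapes ws) shape_weight m (fun z => hit z (t - step w)).
  rewrite -ih; apply: eq_lsum => s _; rewrite displacement_cons.
  by rewrite eq_sym addrC -subr_eq eq_sym.
apply: eq_bigr => -[w|b] _ /=; rewrite !E //.
by rewrite lsumZ lsumD.
Qed.

End shapes.

Section shape_means.
Context {R : realType}.
Variables (q : word -> R) (w0 w1 w2 : word) (eps : R) (ws : seq word).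
Hypotheses (uws : uniq ws) (ws0 : w0 \in ws) (ws1 : w1 \in ws) (ws2 : w2 \in ws).

Definition shape_mean (F : word -> R) (a : protoword) : R :=
  if a is inr b then 2^-1 * (F w0 + F (second w1 w2 b)) else F (low_word w0 a).

Lemma sum_shape_mean F : \sum_(a <- shapes ws) shape_weight q w0 w1 w2 eps a * shape_mean F a =
  \sum_(w <- ws) q w * F w.
Proof. by rewrite [RHS](sum_shapes q eps uws ws0 ws1 ws2). Qed.

Lemma sum_shape_weight : \sum_(a <- shapes ws) shape_weight q w0 w1 w2 eps a = \sum_(w <- ws) q w.
Proof.
have := sum_shape_mean (fun=> 1); under [RHS]eq_bigr do rewrite mulr1.
move=> <-; apply: eq_bigr => -[w|b] _ /=; rewrite ?mulr1 // -[1 + 1]/(2 : R).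
by rewrite mulVf ?mulr1.
Qed.

Hypothesis weight_ge0 : forall a, 0 <= shape_weight q w0 w1 w2 eps a.

(** Jensen's inequality: [shape_mean F] is the conditional expectation of [F] given the shape. *)
Lemma sum_shape_mean_sqr F :
  \sum_(a <- shapes ws) shape_weight q w0 w1 w2 eps a * shape_mean F a ^+ 2 <=
  \sum_(w <- ws) q w * F w ^+ 2.
Proof.
rewrite -sum_shape_mean; apply: ler_sum => a _; rewrite ler_wpM2l //.
case: a => [w|b] //=; have := sqr_ge0 (F w0 - F (second w1 w2 b)); nra.
Qed.

Lemma sum_shape_meanE F z : \sum_(a <- z) shape_mean F a =
  \sum_(w <- low w0 z) F w + (coins true z)%:R / 2 * (F w1 - F w0)
    + (coins false z)%:R / 2 * (F w2 - F w0).
Proof.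
elim: z => [|a z ih]; first by rewrite !big_nil !mul0r !addr0.
rewrite big_cons ih [low _ _]/= big_cons.
case: a => [w|[]] /=; rewrite /coins /= ?add1n ?add0n -?natr1; by field.
Qed.

End shape_means.

Lemma sum_step1 (R : realType) s :
  \sum_(w <- s) (step w).1%:~R = (displacement s).1%:~R :> R.
Proof.
elim: s => [|w s ih]; first by rewrite big_nil displacement_nil.
by rewrite big_cons ih displacement_cons -intrD.
Qed.

Lemma sum_step2 (R : realType) (mu : R) s :
  \sum_(w <- s) ((step w).2%:~R - mu) = (displacement s).2%:~R - (size s)%:R * mu :> R.
Proof.
elim: s => [|w s ih]; first by rewrite big_nil displacement_nil mul0r subr0.
have -> : (displacement (w :: s)).2%:~R = (step w).2%:~R + (displacement s).2%:~R :> R.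
  by rewrite displacement_cons -intrD.
by rewrite big_cons ih [size _]/= -natr1; ring.
Qed.

Lemma four_failures (R : realType) (b1 b2 b3 b4 : bool) :
  (1 - b1%:R - b2%:R - b3%:R - b4%:R <= 0 :> R) \/ [/\ ~~ b1, ~~ b2, ~~ b3 & ~~ b4].
Proof.
have [|n] := boolP [|| b1, b2, b3 | b4]; last first.
  by right; move: n; rewrite !negb_or => /and4P[].
move=> bb; left; rewrite -!addrA -!opprD subr_le0 -!natrD ler1n.
by move: bb; case: b1; case: b2; case: b3; case: b4.
Qed.

Lemma norm_det_le (R : realType) (P Q N a b c d : R) : `|P| <= N -> `|Q| <= N ->
  `|P * a| + `|Q * b| <= N * (`|b| + `|c| + `|a| + `|d|).
Proof.
move=> PN QN; rewrite !normrM.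
have N0 : 0 <= N by exact: le_trans PN.
have -> : N * (`|b| + `|c| + `|a| + `|d|) = N * `|a| + N * `|b| + N * (`|c| + `|d|) by ring.
by rewrite -[leLHS]addr0 lerD ?mulr_ge0 ?addr_ge0 // lerD // ler_wpM2r.
Qed.

(** A negative [j] would make the squared deviation larger than [B ^ 2], hence larger than [C * B];
    so the integer solution is a genuine number of successes. *)
Lemma coin_number (R : realType) (C c0 M : R) (B0 B : nat) (j : int) : 0 <= C ->
  (forall B j, (B0 <= B)%N -> (2 * j%:R - B%:R) ^+ 2 <= C * B%:R -> c0 <= B%:R * bin R B j ^+ 2) ->
  B0%:R < M -> C < M -> M < B%:R -> (2 * (j%:~R - B%:R / 2)) ^+ 2 <= C * M ->
  exists2 k : nat, j = k%:Z & c0 <= B%:R * bin R B k ^+ 2.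
Proof.
move=> C0 binP B0M CM MB hj.
have hjB : (2 * j%:~R - B%:R) ^+ 2 <= C * B%:R.
  have -> : 2 * j%:~R - B%:R = 2 * (j%:~R - B%:R / 2) :> R by field.
  by rewrite (le_trans hj) // ler_wpM2l // ltW.
case: j hj hjB => [k|k] hj hjB.
  by exists k => //; apply: binP => //; rewrite -(ler_nat R) ltW // (lt_trans B0M).
exfalso; move: hjB; rewrite NegzE mulrNz leNgt => /negP; apply.
have k0 : 0 < k.+1%:~R :> R by rewrite ltr0z.
have BC : C < B%:R by exact: lt_trans MB.
have B1 : 0 < B%:R :> R by exact: le_lt_trans BC.
apply: (@lt_trans _ _ (B%:R * B%:R)); first by rewrite ltr_pM2r.
have -> : (2 * - k.+1%:~R - B%:R) ^+ 2 = (2 * k.+1%:~R + B%:R) ^+ 2 :> R by ring.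
move: (k.+1%:~R) (B%:R) k0 B1 => u v u0 v0; nra.
Qed.

(** The target differs from the lowest endpoint by a multiple of the determinant, so Cramer's rule
    gives integral coin numbers. It also shows that these are within order [N] of half the numbers
    of coins, where each binomial weight is at least of order 1 / sqrt m. *)
Lemma hit_lower (R : realType) (w0 w1 w2 : word) (g m : nat) (C c0 M N : R) (B0 : nat)
    (z : seq protoword) (t : int * int) (a b : int) :
  let e1 := step w1 - step w0 in let e2 := step w2 - step w0 in
  e1.1 * e2.2 - e1.2 * e2.1 = g.+1%:Z -> 0 <= C -> 0 < c0 -> (0 < m)%N ->
  (forall B j, (B0 <= B)%N -> (2 * j%:R - B%:R) ^+ 2 <= C * B%:R -> c0 <= B%:R * bin R B j ^+ 2) ->
  B0%:R < M -> C < M -> size z = m ->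
  t = displacement (low w0 z) + (g.+1%:Z * a, g.+1%:Z * b) ->
  M < (coins true z)%:R -> M < (coins false z)%:R ->
  `|t.1%:~R - ((displacement (low w0 z)).1%:~R + (coins true z)%:R / 2 * e1.1%:~R +
    (coins false z)%:R / 2 * e2.1%:~R)| <= N ->
  `|t.2%:~R - ((displacement (low w0 z)).2%:~R + (coins true z)%:R / 2 * e1.2%:~R +
    (coins false z)%:R / 2 * e2.2%:~R)| <= N ->
  4 * (N * (`|e1.1%:~R| + `|e1.2%:~R| + `|e2.2%:~R| + `|e2.1%:~R|)) ^+ 2 <= C * M ->
  c0 / m%:R <= hit w0 w1 w2 z t.
Proof.
move=> e1 e2 det C0 c00 m0 binP B0M CM sz tab B1m B2m.
set s := low w0 z in tab *; set B1 := coins true z in B1m *; set B2 := coins false z in B2m *.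
set P := _ - _ => PN; set Q := _ - _ => QN NL.
(* Cramer's rule without division, the factor [g.+1] of the target being the determinant itself. *)
pose j1 : int := a * e2.2 - b * e2.1; pose j2 : int := b * e1.1 - a * e1.2.
have t1 : t.1 = (displacement s).1 + j1 * e1.1 + j2 * e2.1.
  have -> : t.1 = (displacement s).1 + g.+1%:Z * a by rewrite tab.
  by rewrite -det /j1 /j2; ring.
have t2 : t.2 = (displacement s).2 + j1 * e1.2 + j2 * e2.2.
  have -> : t.2 = (displacement s).2 + g.+1%:Z * b by rewrite tab.
  by rewrite -det /j1 /j2; ring.
clearbody j1 j2.
have detR : e1.1%:~R * e2.2%:~R - e1.2%:~R * e2.1%:~R = g.+1%:R :> R.
  by rewrite -!intrM -intrB det.
have PE : P = (j1%:~R - B1%:R / 2) * e1.1%:~R + (j2%:~R - B2%:R / 2) * e2.1%:~R.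
  by rewrite /P t1 2!intrD 2!intrM; ring.
have QE : Q = (j1%:~R - B1%:R / 2) * e1.2%:~R + (j2%:~R - B2%:R / 2) * e2.2%:~R.
  by rewrite /Q t2 2!intrD 2!intrM; ring.
have cramer1 : (j1%:~R - B1%:R / 2) * g.+1%:R = P * e2.2%:~R - Q * e2.1%:~R :> R.
  by rewrite -detR PE QE; ring.
have cramer2 : (j2%:~R - B2%:R / 2) * g.+1%:R = Q * e1.1%:~R - P * e1.2%:~R :> R.
  by rewrite -detR PE QE; ring.
set L := (X in N * X) in NL.
have N0 : 0 <= N by exact: le_trans PN.
have L0 : 0 <= L by rewrite !addr_ge0.
have bound (u A1 A2 : R) : u * g.+1%:R = A1 - A2 -> `|A1| + `|A2| <= N * L ->
    (2 * u) ^+ 2 <= C * M.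
  move=> ue AL.
  have ug : `|u| <= N * L.
    apply: le_trans AL; apply: le_trans (ler_normB _ _); rewrite -ue normrM.
    by rewrite ler_peMr // ger0_norm // ler1n.
  apply: le_trans NL; rewrite exprMn (_ : 2 ^+ 2 = 4); last by rewrite expr2 -natrM.
  by rewrite ler_wpM2l // -(real_normK (num_real u)) lerXn2r ?nnegrE // mulr_ge0.
have b1 : (2 * (j1%:~R - B1%:R / 2)) ^+ 2 <= C * M.
  apply: (bound _ _ _ cramer1); apply: le_trans (norm_det_le _ _ `|e1.1%:~R| `|e1.2%:~R| PN QN) _.
  by rewrite !normr_id le_eqVlt; apply/orP; left; apply/eqP; rewrite /L; ring.
have b2 : (2 * (j2%:~R - B2%:R / 2)) ^+ 2 <= C * M.
  apply: (bound _ _ _ cramer2); apply: le_trans (norm_det_le _ _ `|e2.1%:~R| `|e2.2%:~R| QN PN) _.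
  by rewrite !normr_id le_eqVlt; apply/orP; left; apply/eqP; rewrite /L; ring.
have [k1 ek1 p1] := coin_number C0 binP B0M CM B1m b1.
have [k2 ek2 p2] := coin_number C0 binP B0M CM B2m b2.
have -> : t = displacement s + jump w0 w1 w2 true *+ k1 + jump w0 w1 w2 false *+ k2.
  have mulE (e : int * int) k : e *+ k = (k%:Z * e.1, k%:Z * e.2).
    by elim: k => [|k ih]; [rewrite mulr0n !mul0r|rewrite mulrS ih -addn1 PoszD !mulrDl !mul1r addrC].
  by rewrite [LHS]surjective_pairing t1 t2 ek1 ek2 !mulE -!addrA.
apply: le_trans (hit_ge_bin _ _ _ _ _ _).
have mR : 0 < m%:R :> R by rewrite ltr0n.
have cm (B : nat) k : (B <= m)%N -> c0 <= B%:R * bin R B k ^+ 2 -> c0 / m%:R <= bin R B k ^+ 2.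
  move=> Bm cB; rewrite ler_pdivrMr // mulrC (le_trans cB) // ler_wpM2r ?sqr_ge0 //.
  by rewrite ler_nat.
have Bm b' : (coins b' z <= m)%N by rewrite -sz count_size.
have cm0 : 0 <= c0 / m%:R by rewrite divr_ge0 // ltW.
rewrite -ler_sqr ?nnegrE //; last by rewrite mulr_ge0 ?bin_ge0.
rewrite [leRHS]exprMn [leLHS]expr2.
by apply: ler_pM => //; [exact: cm (Bm true) p1|exact: cm (Bm false) p2].
Qed.

Lemma pair_mean_bound (R : realType) (h eps : R) (b : bool) : 0 < eps -> 2 * eps <= 1 ->
  h = b%:R - 2 * eps -> h ^+ 2 <= 1.
Proof. by move=> e0 e1 ->; case: b => /=; nra. Qed.

Lemma spread_bound (R : realType) (K t0 V m : R) : 1 <= m -> 0 <= V ->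
  t0 ^+ 2 = 16 * (m * V + K ^+ 2 + 1) ->
  (K + t0) ^+ 2 <= 2 * m * (17 * K ^+ 2 + 16 * V + 16).
Proof.
move=> m1 V0 t02.
have h1 : (K + t0) ^+ 2 <= 2 * K ^+ 2 + 2 * t0 ^+ 2 by have := sqr_ge0 (K - t0); nra.
have := sqr_ge0 K; rewrite t02 in h1; nra.
Qed.

Lemma chebyshev_window (R : realType) (m S d V K : R) : 0 <= m -> S <= V ->
  m * `|d| <= K -> m * S + m ^+ 2 * d ^+ 2 <= m * V + K ^+ 2 + 1.
Proof.
move=> m0 SV dK.
have h1 := ler_wpM2l m0 SV.
have h2 : m ^+ 2 * d ^+ 2 <= K ^+ 2.
  rewrite -exprMn -(real_normK (num_real (m * d))) normrM (ger0_norm m0).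
  by rewrite lerXn2r ?nnegrE ?mulr_ge0 // (le_trans _ dK) // mulr_ge0.
lra.
Qed.

Lemma chebyshev_coins (R : realType) (m S d eps : R) : 1 <= m -> S <= 1 -> `|m * d| <= 1 ->
  32 < m * eps ^+ 2 -> m * S + m ^+ 2 * d ^+ 2 <= 16^-1 * (eps * m) ^+ 2.
Proof.
move=> m1 S1 d1 m32.
have h : m ^+ 2 * d ^+ 2 <= 1 by rewrite -exprMn -(real_normK (num_real _)) exprn_ile1.
have -> : (eps * m) ^+ 2 = m * (m * eps ^+ 2) by ring.
nra.
Qed.

Lemma far_from_mean (R : realType) (a b eps : R) : - (eps * b) < a - b * (2 * eps) -> eps * b < a.
Proof. lra. Qed.

Lemma mass_left (R : realType) (u : R) : u <= 8^-1 -> 7 / 8 <= 1 - u.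
Proof. lra. Qed.

Lemma four_failures_left (R : realType) (t b1 b2 b3 b4 : R) : 7 / 8 <= t ->
  b1 <= 16^-1 -> b2 <= 16^-1 -> b3 <= 16^-1 -> b4 <= 16^-1 ->
  2^-1 <= t + (-1 * b1 + (-1 * b2 + (-1 * b3 + -1 * b4))).
Proof. lra. Qed.

(** Chebyshev's inequality bounds by 1/16 each of four failures: either coordinate of the
    conditional mean is far off, or there are too few pairs of either kind. The mass 7/8 thus leaves
    at least one half, on which [hit_lower] applies. The target varies with the residue of the walk,
    since the coins only move inside a sublattice. *)
Lemma lsum_local_lower (R : realType) (q : word -> R) (w0 w1 w2 : word) (g : nat) (eps K V : R) :
  0 < eps -> (forall w, 0 <= q w) ->
  (forall a, 0 <= shape_weight q w0 w1 w2 eps a) ->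
  (step w1 - step w0).1 * (step w2 - step w0).2 -
    (step w1 - step w0).2 * (step w2 - step w0).1 = g.+1%:Z ->
  0 <= K -> 0 <= V ->
  exists2 c : R, 0 < c & exists m0 : nat, forall m ws mu, (m0 <= m)%N ->
    uniq ws -> w0 \in ws -> w1 \in ws -> w2 \in ws ->
    \sum_(w <- ws) q w <= 1 -> m%:R * (1 - \sum_(w <- ws) q w) <= 8^-1 ->
    m%:R * `|\sum_(w <- ws) q w * (step w).1%:~R| <= K ->
    m%:R * `|\sum_(w <- ws) q w * ((step w).2%:~R - mu)| <= K ->
    \sum_(w <- ws) q w * (step w).1%:~R ^+ 2 <= V ->
    \sum_(w <- ws) q w * ((step w).2%:~R - mu) ^+ 2 <= V ->
  forall (I : finType) (res : int * int -> I) (T : I -> int * int),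
    (forall i, `|(T i).1%:~R : R| <= K /\ `|(T i).2%:~R - m%:R * mu| <= K) ->
    (forall s, all (mem ws) s -> size s = m -> exists a b : int,
       T (res (displacement s)) = displacement s + (g.+1%:Z * a, g.+1%:Z * b)) ->
    c / m%:R <= \sum_i lsum ws q m (fun s => (displacement s == T i)%:R).
Proof.
move=> eps0 q0 weight0 det K0 V0.
set e1 := step w1 - step w0 in det; set e2 := step w2 - step w0 in det.
pose L : R := `|e1.1%:~R| + `|e1.2%:~R| + `|e2.2%:~R| + `|e2.1%:~R|.
have L0 : 0 <= L by rewrite !addr_ge0.
(* Chosen so that the squared window [4 * ((K + t0) * L) ^+ 2] is at most [C * (eps * m)], where
   [eps * m] bounds the numbers of coins from below. *)
pose C : R := 8 * L ^+ 2 * (17 * K ^+ 2 + 16 * V + 16) / eps.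
have Q0 : 0 <= 17 * K ^+ 2 + 16 * V + 16 by rewrite !addr_ge0 ?mulr_ge0 ?sqr_ge0.
have C0 : 0 <= C by rewrite divr_ge0 ?mulr_ge0 ?sqr_ge0 // ltW.
have [c0 c00 [B0 binP]] := bin_lower C0.
exists (c0 / 2); first by rewrite divr_gt0.
exists (Num.truncn (B0%:R / eps + C / eps + 32 / eps ^+ 2)).+1.
move=> m ws mu Hm uws ws0 ws1 ws2 q1 qm qy qx qy2 qx2 I res T TK Tres.
have mb : B0%:R / eps + C / eps + 32 / eps ^+ 2 < m%:R.
  by rewrite (lt_le_trans (truncnS_gt _)) // ler_nat.
have p1 : 0 <= B0%:R / eps by rewrite divr_ge0 // ltW.
have p2 : 0 <= C / eps by rewrite divr_ge0 // ltW.
have p3 : 0 <= 32 / eps ^+ 2 by rewrite divr_ge0 // exprn_ge0 // ltW.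
have mB0 : B0%:R < eps * m%:R.
  by rewrite mulrC -ltr_pdivrMr // (le_lt_trans _ mb) // -addrA lerDl addr_ge0.
have mC : C < eps * m%:R.
  by rewrite mulrC -ltr_pdivrMr // (le_lt_trans _ mb) // [X in _ <= X + _]addrC -addrA lerDl addr_ge0.
have m32 : 32 < m%:R * eps ^+ 2.
  by rewrite -ltr_pdivrMr ?exprn_gt0 // (le_lt_trans _ mb) // lerDr addr_ge0.
have m_gt0 : (0 < m)%N by exact: leq_trans Hm.
have m1 : 1 <= m%:R :> R by rewrite ler1n.
have m0 : 0 < m%:R :> R by rewrite ltr0n.
set sw := shape_weight q w0 w1 w2 eps in weight0.
have sw1 : \sum_(a <- shapes ws) sw a <= 1 by rewrite sum_shape_weight.
(* Four times the bound on the standard deviation, for a failure probability of 1/16. *)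
pose t0 : R := 4 * Num.sqrt (m%:R * V + K ^+ 2 + 1).
have tp : 0 < m%:R * V + K ^+ 2 + 1 by rewrite ltr_wpDl // addr_ge0 ?mulr_ge0 ?sqr_ge0.
have t00 : 0 < t0 by rewrite mulr_gt0 // sqrtr_gt0.
have t02 : t0 ^+ 2 = 16 * (m%:R * V + K ^+ 2 + 1).
  by rewrite exprMn sqr_sqrtr ?ltW // (_ : 4 ^+ 2 = 16) // expr2 -natrM.
pose y (w : word) : R := (step w).1%:~R.
pose x (w : word) : R := (step w).2%:~R - mu.
(* The expected number of pairs of each kind is [2 * eps * m]; a deviation below [eps * m] leaves
   more than [eps * m] of them. *)
pose h b (a : protoword) : R := (a == inr b)%:R - 2 * eps.
pose bad1 z : R := (t0 <= `|\sum_(a <- z) shape_mean w0 w1 w2 y a|)%R%:R.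
pose bad2 z : R := (t0 <= `|\sum_(a <- z) shape_mean w0 w1 w2 x a|)%R%:R.
pose bad b z : R := (eps * m%:R <= `|\sum_(a <- z) h b a|)%R%:R.
have bad12 F : m%:R * `|\sum_(w <- ws) q w * F w| <= K -> \sum_(w <- ws) q w * F w ^+ 2 <= V ->
    lsum (shapes ws) sw m (fun z => (t0 <= `|\sum_(a <- z) shape_mean w0 w1 w2 F a|)%R%:R) <= 16^-1.
  move=> F1 F2; rewrite (le_trans (lsum_chebyshev weight0 sw1 _ _ t00)) //.
  rewrite ler_pdivrMr ?exprn_gt0 // t02 [leRHS]mulrA mulVf ?mul1r //.
  rewrite (sum_shape_mean q eps uws ws0 ws1 ws2); apply: chebyshev_window => //.
  exact: le_trans (sum_shape_mean_sqr uws ws0 ws1 ws2 weight0 F) F2.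
have sumh z b : size z = m -> \sum_(a <- z) h b a = (coins b z)%:R - m%:R * (2 * eps).
  move=> <-; rewrite sumrB; congr (_ - _); first by rewrite /coins count_sum natr_sum.
  by rewrite big_const_seq count_predT iter_addr_0 -[LHS]mulr_natl.
have eps12 : 2 * eps <= 1.
  have h0 := weight0 (inl w0); rewrite /sw /= eqxx mulr1 in h0.
  have h1 : q w0 <= 1.
    by rewrite (le_trans _ q1) // (bigD1_seq w0) //= lerDl sumr_ge0.
  rewrite (le_trans _ h1) //; move: h0; rewrite subr_ge0; apply: le_trans.
  by rewrite mulrC ler_wpM2l ?(ltW eps0) // lerDr addr_ge0.
have bad3 b : lsum (shapes ws) sw m (bad b) <= 16^-1.
  rewrite (le_trans (lsum_chebyshev weight0 sw1 _ _ _)) ?mulr_gt0 //.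
  rewrite ler_pdivrMr ?exprn_gt0 ?mulr_gt0 //.
  have h2 : \sum_(w <- shapes ws) sw w * h b w ^+ 2 <= 1.
    apply: le_trans sw1; apply: ler_sum => a _; rewrite ler_piMr // /h.
    exact: pair_mean_bound erefl.
  have -> : \sum_(w <- shapes ws) sw w * h b w = 2 * eps * (1 - \sum_(w <- ws) q w).
    rewrite -(sum_shape_weight q eps uws ws0 ws1 ws2) -/sw /h.
    under eq_bigr do rewrite mulrBr; rewrite sumrB -mulr_suml.
    have -> : \sum_(a <- shapes ws) sw a * (a == inr b)%:R = 2 * eps.
      rewrite (bigD1_seq (inr b)) /=; last first.
      - rewrite /shapes cat_uniq map_inj_uniq ?uws //=; last by move=> ? ? [].
        by rewrite orbF; apply/andP; split=> //; apply/norP; split; apply/mapP => -[].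
      - by rewrite mem_cat; case: (b); rewrite !inE ?eqxx ?orbT.
      by rewrite eqxx mulr1 big1 ?addr0 // => a /negbTE ->; rewrite mulr0.
    ring.
  apply: chebyshev_coins => //; set d := 1 - _ in qm *.
  have a0 : 0 <= m%:R * d by rewrite mulr_ge0 ?subr_ge0 // ltW.
  have a1 : m%:R * d <= 1 by rewrite (le_trans qm) // invf_le1 // ler1n.
  have a2 : 0 <= 2 * eps by rewrite mulr_ge0 // ltW.
  by rewrite mulrCA ger0_norm; [exact: mulr_ile1|exact: mulr_ge0].
have good z : size z = m -> all (mem (shapes ws)) z ->
    c0 / m%:R * (1 - bad1 z - bad2 z - bad true z - bad false z) <=
    hit w0 w1 w2 z (T (res (displacement (low w0 z)))).
  move=> sz zws.
  have k0 : 0 <= c0 / m%:R by rewrite divr_ge0 // ltW.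
  have hit0 := hit_ge0 w0 w1 w2 z (T (res (displacement (low w0 z)))) : (0 : R) <= _.
  rewrite /bad1 /bad2 /bad; set n1 := (t0 <= _); set n2 := (t0 <= `|\sum_(a <- z) shape_mean _ _ _ x _|).
  set n3 := (eps * m%:R <= _); set n4 := (eps * m%:R <= `|\sum_(a <- z) h false _|).
  case: (four_failures R n1 n2 n3 n4) => [neg|[]].
    by rewrite (le_trans _ hit0) // mulr_ge0_le0.
  move=> /negbTE e1n /negbTE e2n /negbTE e3n /negbTE e4n.
  rewrite e1n e2n e3n e4n !subr0 mulr1.
  move/negbT: e1n; rewrite -ltNge => g1; move/negbT: e2n; rewrite -ltNge => g2.
  move/negbT: e3n; rewrite -ltNge sumh // => g3; move/negbT: e4n; rewrite -ltNge sumh // => g4.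
  set s := low w0 z; set i := res _.
  have ss : size s = m by rewrite size_map.
  have sws : all (mem ws) s.
    apply/allP => w /mapP[a /(allP zws)]; rewrite /= mem_cat => /orP[/mapP[u uws' ->] -> //|].
    by rewrite !inE => /orP[/eqP->|/eqP->] ->.
  have [a [b Tab]] := Tres s sws ss; rewrite -/i in Tab.
  have [TK1 TK2] := TK i.
  have g1' : `|(displacement s).1%:~R + (coins true z)%:R / 2 * e1.1%:~R +
      (coins false z)%:R / 2 * e2.1%:~R| < t0 :> R.
    by move: g1; rewrite sum_shape_meanE sum_step1 /y -!intrB.
  have g2' : `|(displacement s).2%:~R - m%:R * mu + (coins true z)%:R / 2 * e1.2%:~R +
      (coins false z)%:R / 2 * e2.2%:~R| < t0 :> R.
    move: g2; rewrite sum_shape_meanE sum_step2 /x ss.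
    have cancel (u v : R) : u - mu - (v - mu) = u - v by ring.
    by rewrite !cancel -!intrB.
  apply: (hit_lower (N := K + t0) det C0 c00 m_gt0 binP mB0 mC sz Tab).
  - by move: g3; rewrite ltr_norml => /andP[+ _]; apply: far_from_mean.
  - by move: g4; rewrite ltr_norml => /andP[+ _]; apply: far_from_mean.
  - by rewrite (le_trans (ler_normB _ _)) // lerD // ltW.
  - rewrite -/s -/e1 -/e2; set B := (X in `|_ - X|).
    have -> : (T i).2%:~R - B = ((T i).2%:~R - m%:R * mu) - ((displacement s).2%:~R - m%:R * mu +
       (coins true z)%:R / 2 * e1.2%:~R + (coins false z)%:R / 2 * e2.2%:~R).
      by rewrite /B; ring.
    by rewrite (le_trans (ler_normB _ _)) // lerD // ltW.
  - rewrite -/e1 -/e2 -/L; have -> : C * (eps * m%:R) = 4 * (2 * m%:R * (17 * K ^+ 2 + 16 * V + 16) * L ^+ 2).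
      by rewrite /C; field; rewrite gt_eqF.
    by rewrite ler_wpM2l // exprMn ler_wpM2r ?sqr_ge0 // spread_bound.
have total : 7 / 8 <= lsum (shapes ws) sw m (fun=> 1).
  rewrite (le_trans _ (lsum_ge_mass weight0 sw1 m)) // sum_shape_weight //; exact: mass_left.
apply: (@le_trans _ _ (lsum (shapes ws) sw m (fun z =>
    hit w0 w1 w2 z (T (res (displacement (low w0 z))))))); last first.
  under eq_bigr do rewrite (lsum_hit q eps uws ws0 ws1 ws2).
  rewrite -lsum_sum; apply: le_lsum => // z _ _.
  by rewrite (bigD1 (res (displacement (low w0 z)))) //= lerDl sumr_ge0 // => i _; exact: hit_ge0.
apply: (@le_trans _ _ (lsum (shapes ws) sw m (fun z => c0 / m%:R * (1 +
    ((-1) * bad1 z + ((-1) * bad2 z + ((-1) * bad true z + (-1) * bad false z))))))); last first.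
  apply: le_lsum => // z sz zws; rewrite (le_trans _ (good z sz zws)) //.
  by rewrite !mulN1r !addrA.
rewrite lsumZ !lsumD !lsumZ.
have b1 := bad12 y qy qy2; have b2 := bad12 x qx qx2.
have b3 := bad3 true; have b4 := bad3 false.
rewrite -/bad1 -/bad2 in b1 b2.
rewrite mulrAC ler_wpM2l ?divr_ge0 ?(ltW c00) //; exact: four_failures_left.
Qed.

(** * Moments of the offspring law *)

Section offspring.
Context {R : realType} (p : probability word R).

Definition pmf (w : word) : R := fine (p [set w]).

Lemma pmf_ge0 w : 0 <= pmf w. Proof. exact: fine_ge0. Qed.

Lemma pmfE w : p [set w] = (pmf w)%:E.
Proof. by rewrite fineK // fin_num_measure. Qed.

Definition short_words (n : nat) : seq word := lists_upto [:: type1; type2] n.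

Lemma mem_short_words n w : (w \in short_words n) = (size w <= n)%N.
Proof.
rewrite mem_lists_upto andbC; case: (boolP (all _ _)) => // /allPn[[] _]; by rewrite !inE.
Qed.

Lemma uniq_short_words n : uniq (short_words n).
Proof. exact: uniq_lists_upto. Qed.

(** The offspring words of a tree of size [n] are shorter than [n], so on the event that the size is
    [n] this truncation changes no probability. *)
Definition words (n : nat) : seq word := [seq w <- short_words n | 0 < pmf w].

Lemma mem_words n w : (w \in words n) = (size w <= n)%N && (0 < pmf w).
Proof. by rewrite mem_filter mem_short_words andbC. Qed.

Lemma uniq_words n : uniq (words n).
Proof. exact: filter_uniq (uniq_short_words n). Qed.

Lemma integral_word (f : word -> R) w : (forall w, 0 <= f w) ->
  (\int[p]_(u in [set w]) (f u)%:E = (pmf w * f w)%:E)%E.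
Proof.
move=> f0; rewrite (eq_integral (cst (f w)%:E)) => [|u]; last by rewrite inE => ->.
transitivity ((f w)%:E * p [set w])%E; first exact: integral_cst.
by rewrite pmfE -EFinM mulrC.
Qed.

Lemma integral_seq (s : seq word) (f : word -> R) : uniq s -> (forall w, 0 <= f w) ->
  (\int[p]_(w in [set` s]) (f w)%:E = (\sum_(w <- s) pmf w * f w)%:E)%E.
Proof.
move=> us f0; have -> : [set` s] = \big[setU/set0]_(w <- s) [set w].
  by rewrite -bigcup_seq; apply/seteqP; split=> [x xs|x [y ys ->]] //; exists x.
rewrite ge0_integral_bigsetU //.
- by rewrite -sumEFin; apply: eq_bigr => w _; rewrite integral_word.
- by move=> i j _ _ [x [-> ->]].
- by move=> w _; rewrite lee_fin.
Qed.

Lemma integral_seq_le (s : seq word) (f : word -> R) e : uniq s -> (forall w, 0 <= f w) ->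
  (\int[p]_w (f w)%:E = e%:E)%E -> \sum_(w <- s) pmf w * f w <= e.
Proof.
move=> us f0 fe; rewrite -lee_fin -integral_seq // -fe.
by apply: ge0_subset_integral => // w _; rewrite lee_fin.
Qed.

(** What the truncation loses is an integral over long words, where [f] is dominated by [d * g]. *)
Lemma sum_words_ge n (f g : word -> R) e c d : (forall w, 0 <= f w) -> (forall w, 0 <= g w) ->
  0 <= d -> (forall w, (n < size w)%N -> f w <= d * g w) ->
  (\int[p]_w (f w)%:E = e%:E)%E -> (\int[p]_w (g w)%:E = c%:E)%E ->
  e - d * c <= \sum_(w <- words n) pmf w * f w.
Proof.
move=> f0 g0 d0 fg fe gc.
set s := short_words n; have us : uniq s := uniq_short_words n.
have -> : \sum_(w <- words n) pmf w * f w = \sum_(w <- s) pmf w * f w.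
  rewrite big_filter big_mkcond; apply: eq_bigr => w _.
  by case: ltgtP (pmf_ge0 w) => // <- _; rewrite mul0r.
rewrite lerBlDr -lee_fin EFinD -integral_seq // -fe -[setT in leLHS](setvU [set` s]).
rewrite ge0_integral_setU //; last 2 first.
- by move=> w _; rewrite lee_fin.
- by rewrite disj_set2E setICl.
rewrite addeC leeD2l // EFinM -gc -ge0_integralZl // ; last first.
  by move=> w _; rewrite lee_fin.
apply: (@le_trans _ _ (\int[p]_(w in ~` [set` s]) (d%:E * (g w)%:E))%E).
  apply: ge0_le_integral => // w; rewrite ?lee_fin //.
  by move=> /= ws; apply: fg; rewrite ltnNge -mem_short_words; exact/negP.
by apply: ge0_subset_integral => // w _; rewrite -EFinM lee_fin mulr_ge0.
Qed.

Hypothesis hcrit : 'E_p[fun w => (xi w)%:R]%E = 1%E.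
Hypothesis hvar_xi : (fun w : word => (xi w)%:R : R) \in Lfun p 2%:E.
Hypothesis hvar_zeta : (fun w : word => (zeta w)%:R : R) \in Lfun p 2%:E.

Definition mean_weight : R := 1 + mean_zeta p.

Lemma integral_xi : (\int[p]_w ((xi w)%:R)%:E = 1%:E)%E.
Proof. by rewrite -hcrit unlock. Qed.

Lemma integral_zeta : (\int[p]_w ((zeta w)%:R)%:E = (mean_zeta p)%:E)%E.
Proof.
have Pfin : p setT \is a fin_num by rewrite fin_num_measure.
by rewrite /mean_zeta fineK; [rewrite unlock|exact: expectation_fin_num (Lfun_subset12 Pfin hvar_zeta)].
Qed.

Lemma mean_zeta_ge0 : 0 <= mean_zeta p.
Proof. by apply: fine_ge0; apply: expectation_ge0. Qed.

Lemma mean_weight_ge1 : 1 <= mean_weight.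
Proof. by rewrite lerDl mean_zeta_ge0. Qed.

Lemma integral_weight : (\int[p]_w ((zeta w).+1%:R)%:E = mean_weight%:E)%E.
Proof.
transitivity (\int[p]_w (cst 1%:E w + ((zeta w)%:R)%:E))%E.
  by apply: eq_integral => w _; rewrite -natr1 EFinD addeC.
rewrite ge0_integralD //.
have := expectation_cst p 1; rewrite unlock /= => ->.
by rewrite integral_zeta -EFinD.
Qed.

Definition size_sqr (w : word) : R := (size w).+1%:R ^+ 2.

(** From (1 + x + z)^2 <= 3 (1 + x^2 + z^2). This one function dominates all the moments used
    later. *)
Lemma second_moment : exists2 C : R, 0 <= C & (\int[p]_w (size_sqr w)%:E = C%:E)%E.
Proof.
have i1 := Lfun2_integrable_sqr hvar_xi; have i2 := Lfun2_integrable_sqr hvar_zeta.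
have i0 : p.-integrable setT (fun=> 1%:E) by exact: finite_measure_integrable_cst.
have i : p.-integrable setT (fun w : word =>
   3%:E * (1%:E + (((xi w)%:R ^+ 2)%:E + ((zeta w)%:R ^+ 2)%:E)))%E.
  by apply: integrableZl => //; apply: integrableD => //; apply: integrableD.
have j : p.-integrable setT (fun w : word => (size_sqr w)%:E).
  apply: le_integrable i => // w _.
  rewrite -!EFinD -EFinM lee_fin !ger0_norm ?sqr_ge0 ?mulr_ge0 ?addr_ge0 ?sqr_ge0 //.
  rewrite /size_sqr size_word -natr1 natrD.
  have := sqr_ge0 ((xi w)%:R - (zeta w)%:R : R).
  have := sqr_ge0 ((xi w)%:R - 1 : R); have := sqr_ge0 ((zeta w)%:R - 1 : R).
  nra.
exists (fine (\int[p]_w (size_sqr w)%:E)).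
  by apply: fine_ge0; apply: integral_ge0 => w _; rewrite lee_fin sqr_ge0.
by rewrite fineK // integrable_fin_num.
Qed.

Lemma integral_one : (\int[p]_w (1 : R)%:E = 1%:E)%E.
Proof. by have := expectation_cst p 1; rewrite unlock. Qed.

Lemma sum_pmf_le1 s : uniq s -> \sum_(w <- s) pmf w <= 1.
Proof.
move=> us; have := @integral_seq_le s (fun=> 1) 1 us _ integral_one.
by under eq_bigr do rewrite mulr1; apply.
Qed.

(** Truncation at [n] costs O(1 / n^2) of mass and O(1 / n) of mean; over at most [n] steps the lost
    mass is O(1 / n) and the accumulated bias stays bounded. *)
Lemma words_moments : exists2 C : R, 0 <= C & forall n, (0 < n)%N ->
  [/\ [/\ 1 - \sum_(w <- words n) pmf w <= C / n%:R ^+ 2,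
        n%:R * `|\sum_(w <- words n) pmf w * (step w).1%:~R| <= C &
        n%:R * `|\sum_(w <- words n) pmf w * ((step w).2%:~R - mean_weight)| <= C],
      \sum_(w <- words n) pmf w * (step w).1%:~R ^+ 2 <= C /\
      \sum_(w <- words n) pmf w * ((step w).2%:~R - mean_weight) ^+ 2 <= C &
      [/\ \sum_(w <- words n) pmf w * (zeta w).+1%:R <= mean_weight,
        \sum_(w <- words n) pmf w * (zeta w).+1%:R ^+ 2 <= C,
        1 - C / n%:R <= \sum_(w <- words n) pmf w * (xi w)%:R &
        mean_weight - C / n%:R <= \sum_(w <- words n) pmf w * (zeta w).+1%:R]].
Proof.
have [C C0 intC] := second_moment.
have mu1 := mean_weight_ge1; set mu := mean_weight in mu1 *.
exists (C * mu + C + mu ^+ 2); first by rewrite !addr_ge0 ?mulr_ge0 ?sqr_ge0 // (le_trans _ mu1).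
move=> n n0; have nR : 0 < n%:R :> R by rewrite ltr0n.
have n1 : 1 <= n%:R :> R by rewrite ler1n.
have uw := uniq_words n.
have g0 w : 0 <= size_sqr w by exact: sqr_ge0.
have Cmu : C <= C * mu by rewrite ler_peMr.
have mu2 := sqr_ge0 mu.
have big w : (n < size w)%N -> n%:R <= (size w).+1%:R :> R.
  by move=> nw; rewrite ler_nat ltnW // ltnW.
have CC u : 0 <= u -> C * u <= (C * mu + C + mu ^+ 2) * u.
  by move=> u0; rewrite ler_wpM2r //; lra.
have A1 : 1 - C / n%:R ^+ 2 <= \sum_(w <- words n) pmf w.
  have d0 : 0 <= (n%:R ^+ 2)^-1 :> R by rewrite invr_ge0 exprn_ge0.
  rewrite [C / _]mulrC; under [leRHS]eq_bigr do rewrite -[pmf _]mulr1.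
  apply: (sum_words_ge _ g0 d0 _ integral_one intC) => // w /big h.
   rewrite mulrC ler_pdivlMr ?exprn_gt0 // mul1r.
  by rewrite lerXn2r ?nnegrE.
have xi_le w : (n < size w)%N -> (xi w)%:R <= n%:R^-1 * size_sqr w.
  move=> /big h; rewrite mulrC ler_pdivlMr // /size_sqr expr2 ler_pM // ler_nat.
  by rewrite size_word ltnW // ltnS leq_addr.
have zeta_le w : (n < size w)%N -> (zeta w).+1%:R <= n%:R^-1 * size_sqr w.
  move=> /big h; rewrite mulrC ler_pdivlMr // /size_sqr expr2 ler_pM // ler_nat.
  by rewrite size_word ltnS leq_addl.
have ni : 0 <= n%:R^-1 :> R by rewrite invr_ge0.
have A2 : 1 - n%:R^-1 * C <= \sum_(w <- words n) pmf w * (xi w)%:R.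
  by apply: (sum_words_ge _ g0 ni xi_le integral_xi intC).
have A3 : mu - n%:R^-1 * C <= \sum_(w <- words n) pmf w * (zeta w).+1%:R.
  by apply: (sum_words_ge _ g0 ni zeta_le integral_weight intC).
have B1 : \sum_(w <- words n) pmf w <= 1 by exact: sum_pmf_le1.
have B2 : \sum_(w <- words n) pmf w * (xi w)%:R <= 1.
  exact: (integral_seq_le uw _ integral_xi).
have B3 : \sum_(w <- words n) pmf w * (zeta w).+1%:R <= mu.
  exact: (integral_seq_le uw _ integral_weight).
have B4 : \sum_(w <- words n) pmf w * size_sqr w <= C by exact: (integral_seq_le uw _ intC).
have S1 : \sum_(w <- words n) pmf w * (step w).1%:~R =
    \sum_(w <- words n) pmf w * (xi w)%:R - \sum_(w <- words n) pmf w.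
  by rewrite -sumrB; apply: eq_bigr => w _; rewrite /step intrB mulrBr mulr1.
have S2 : \sum_(w <- words n) pmf w * ((step w).2%:~R - mu) =
    \sum_(w <- words n) pmf w * (zeta w).+1%:R - mu * \sum_(w <- words n) pmf w.
  rewrite mulr_sumr -sumrB; apply: eq_bigr => w _.
  by rewrite mulrBr [mu * _]mulrC.
have nn : n%:R^-1 * C / n%:R <= n%:R^-1 * C by rewrite ler_pdivrMr // ler_peMr // mulr_ge0.
have nnE : C / n%:R ^+ 2 = n%:R^-1 * C / n%:R by field; rewrite gt_eqF.
rewrite nnE in A1.
have nC : n%:R * (n%:R^-1 * C) = C by rewrite mulrA mulfV ?mul1r // gt_eqF.
have le_n x : `|x| <= n%:R^-1 * (C * mu) -> n%:R * `|x| <= C * mu + C + mu ^+ 2.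
  move=> h; apply: (@le_trans _ _ (C * mu)); last by lra.
  by rewrite -ler_pdivlMl.
have P1 : n%:R^-1 * C <= n%:R^-1 * (C * mu) by exact: ler_wpM2l.
have P0 : 0 <= n%:R^-1 * C by exact: mulr_ge0.
split; first split.
- rewrite (le_trans _ (CC _ _)) ?invr_ge0 ?exprn_ge0 // nnE; lra.
- apply: le_n; rewrite S1 ler_norml; apply/andP; split; lra.
- have e : n%:R^-1 * (C * mu) = mu * (n%:R^-1 * C) by ring.
  apply: le_n; rewrite S2 ler_norml e; set u := n%:R^-1 * C in P0 nn A1 A3 *.
  set S := \sum_(w <- words n) pmf w in A1 B1 *.
  have : mu * S <= mu by rewrite ler_piMr // (le_trans _ mu1).
  have : mu * (1 - u / n%:R) <= mu * S by rewrite ler_wpM2l // (le_trans _ mu1).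
  have : mu * (u / n%:R) <= mu * u by rewrite ler_wpM2l // (le_trans _ mu1).
  have : u <= mu * u by rewrite ler_peMl.
  rewrite mulrBr mulr1.
  by move=> *; apply/andP; split; lra.
- split.
  + apply: (@le_trans _ _ C); last by lra.
    apply: le_trans B4; apply: ler_sum => w _; rewrite ler_wpM2l ?pmf_ge0 //.
    rewrite /size_sqr /step size_word intrB /= -natr1 natrD.
    have : 0 <= (xi w)%:R :> R by []. have : 0 <= (zeta w)%:R :> R by [].
    rewrite -pmulrn; nra.
  + apply: (@le_trans _ _ (C + mu ^+ 2)); last by lra.
    apply: (@le_trans _ _ (\sum_(w <- words n) (pmf w * size_sqr w + mu ^+ 2 * pmf w))).
      apply: ler_sum => w _; rewrite [_ ^+ 2 * pmf w]mulrC -mulrDr ler_wpM2l ?pmf_ge0 //.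
      rewrite /size_sqr /step /= size_word -pmulrn -!natr1 natrD.
      have : 0 <= (xi w)%:R :> R by []. have : 0 <= (zeta w)%:R :> R by [].
      nra.
    by rewrite big_split -mulr_sumr /= lerD // ler_piMr.
split => //.
- apply: (@le_trans _ _ C); last by lra.
  apply: le_trans B4; apply: ler_sum => w _; rewrite ler_wpM2l ?pmf_ge0 //.
  by rewrite lerXn2r ?nnegrE // ler_nat size_word ltnS leq_addl.
- by rewrite (le_trans _ A2) // lerD2l lerN2 mulrC CC.
- by rewrite (le_trans _ A3) // lerD2l lerN2 mulrC CC.
Qed.

(** The bound is o(1 / n^2) and not just O(1 / n^2): words with [zeta] of order n are eventually
    longer than any fixed [M], and beyond a suitable [M] only a small part of the second moment is
    left. *)
Lemma words_tail (delta eta : R) : 0 < delta -> 0 < eta -> exists N : nat, forall n, (N <= n)%N ->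
  n%:R ^+ 2 * \sum_(w <- words n | delta * n%:R < (zeta w).+1%:R) pmf w <= eta.
Proof.
move=> d0 eta0; have [C C0 intC] := second_moment.
have g0 w : 0 <= size_sqr w by exact: sqr_ge0.
pose s n := \sum_(w <- words n) pmf w * size_sqr w.
have sC n : s n <= C by exact: (integral_seq_le (uniq_words n) _ intC).
have eta' : 0 < eta * delta ^+ 2 by rewrite mulr_gt0 ?exprn_gt0.
have hs : has_sup (range s) by split; [exists (s 0%N); exists 0%N|exists C => _ [n _ <-]].
have [_ [M _ <-] HM] := sup_adherent eta' hs.
exists (maxn M (Num.truncn (M.+1%:R / delta)).+1) => n; rewrite geq_max => /andP[Mn dn].
have n0 : (0 < n)%N by exact: leq_trans dn.
have nR : 0 < n%:R :> R by rewrite ltr0n.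
have dM : M.+1%:R < delta * n%:R.
  by rewrite mulrC -ltr_pdivrMr // (lt_le_trans (truncnS_gt _)) // ler_nat.
have sn : s n <= sup (range s) by apply: ub_le_sup; [exact: hs.2|exists n].
rewrite -ler_pdivlMl ?exprn_gt0 //.
rewrite -(ler_pM2l (mulr_gt0 (exprn_gt0 2 d0) (exprn_gt0 2 nR))).
have -> : delta ^+ 2 * n%:R ^+ 2 * ((n%:R ^+ 2)^-1 * eta) = eta * delta ^+ 2.
  by field; rewrite gt_eqF.
apply: (@le_trans _ _ (s n - s M)); last by lra.
rewrite lerBrDr [s n](bigID (fun w => delta * n%:R < (zeta w).+1%:R)) /=.
apply: lerD; last rewrite /s.
  rewrite mulr_sumr; apply: ler_sum => w h; rewrite mulrC ler_wpM2l ?pmf_ge0 //.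
  rewrite -exprMn lerXn2r ?nnegrE ?mulr_ge0 ?(ltW d0) //.
  by rewrite (le_trans (ltW h)) // ler_nat size_word ltnS leq_addl.
have -> : \sum_(w <- words M) pmf w * size_sqr w =
    \sum_(w <- words n | (size w <= M)%N) pmf w * size_sqr w.
  rewrite -[RHS]big_filter; apply: perm_big; apply: uniq_perm.
  - exact: uniq_words.
  - exact: filter_uniq (uniq_words n).
  move=> w; rewrite mem_words mem_filter mem_words; case: (leqP (size w) M) => //= h.
  by rewrite (leq_trans h Mn).
rewrite [leLHS]big_mkcond [leRHS]big_mkcond; apply: ler_sum => w _.
case: leqP => h; last by case: ifP => // _; rewrite mulr_ge0 ?pmf_ge0.
rewrite ifT // -leNgt ltW // (le_lt_trans _ dM) // ler_nat ltnS.
by rewrite (leq_trans _ h) // size_word leq_addl.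
Qed.

End offspring.

(** * The law of the branching tree *)

Lemma sigma_of_preimage d d' (Om : measurableType d) (T : measurableType d') (X : Om -> T)
  (B : set T) : measurable B -> sigma_of X (X @^-1` B).
Proof. by move=> mB; exists B => //; rewrite setTI. Qed.

Lemma measurable_preimage d d' (Om : measurableType d) (T : measurableType d') (X : {mfun Om >-> T})
  (B : set T) : measurable B -> measurable (X @^-1` B).
Proof. by move=> mB; rewrite -[X in measurable X]setTI; exact: measurable_funP. Qed.

Lemma independent_seq d (Om : measurableType d) (R : realType) (P : probability Om R)
    (I : eqType) (F : I -> set_system Om) (E : I -> set Om) (js : seq I) :
  mutually_independent P F -> uniq js -> {in js, forall j, F j (E j)} ->
  fine (P (\bigcap_(j in [set` js]) E j)) = \prod_(j <- js) fine (P (E j)).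
Proof.
move=> ind ujs FE; pose i := tnth (in_tuple js).
rewrite big_tnth -(ind (size js) i (E \o i)).
- congr (fine (P _)); apply/seteqP; split=> w H.
    by move=> k _; apply: H; exact: mem_tnth.
  by move=> j jjs; have /tnthP[k ->] : j \in in_tuple js by []; exact: H.
- by apply/tuple_uniqP.
- by move=> k; apply: FE; exact: mem_tnth.
Qed.

(** The drift -1 makes the total of [xi] one less than the number of words, whereas the weight is
    this number plus the total of [zeta]. *)
Lemma size_word_lt_weight s w : lukasiewicz s -> w \in s -> (size w < weight s)%N.
Proof.
move=> /andP[/eqP ds _] ws.
have e1 : drift s = (\sum_(u <- s) xi u)%N%:Z - (size s)%:Z.
  elim: (s) => [|u r ih]; first by rewrite drift_nil big_nil.
  by rewrite drift_cons ih big_cons /=; move: (\sum_(_ <- r) _)%N => S; lia.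
have e2 : weight s = (size s + \sum_(u <- s) zeta u)%N.
  elim: (s) => [|u r ih]; first by rewrite weight_nil big_nil.
  by rewrite weight_cons ih big_cons /=; move: (\sum_(_ <- r) _)%N => S; lia.
have h1 : (xi w <= \sum_(u <- s) xi u)%N by rewrite (big_rem w) //= leq_addr.
have h2 : (zeta w <= \sum_(u <- s) zeta u)%N by rewrite (big_rem w) //= leq_addr.
move: e1 e2 h1 h2; rewrite size_word ds.
move: (\sum_(_ <- s) xi _)%N (\sum_(_ <- s) zeta _)%N => S T; lia.
Qed.

Definition tree_weight (R : realType) (p : probability word R) (t : tree) : R :=
  \prod_(w <- code t) pmf p w.

Lemma tree_weight_ge0 (R : realType) (p : probability word R) t : 0 <= tree_weight p t.
Proof. by apply: prod_weight_ge0; exact: pmf_ge0. Qed.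

Lemma tree_weight_le1 (R : realType) (p : probability word R) t : tree_weight p t <= 1.
Proof.
rewrite /tree_weight; elim: (code t) => [|w s ih]; first by rewrite big_nil.
have w1 : pmf p w <= 1.
  by have h := sum_pmf_le1 p (s := [:: w]) isT; rewrite big_seq1 in h.
rewrite big_cons; apply: mulr_ile1 => //; first exact: pmf_ge0.
by apply: prod_weight_ge0; exact: pmf_ge0.
Qed.

Section tree_event.
Context d (Om : measurableType d) (R : realType) (P : probability Om R).
Context (p : probability word R) (sigma : seq nat -> {RV P >-> word}).

Lemma tree_eventE t : valid_tree t -> root_type t = type1 ->
  [set omega | branching_tree (fun v => sigma v omega) = Some t] =
  \bigcap_(v in [set` internal t]) (sigma v @^-1` [set word_at t v]).
Proof.
move=> vt t1; apply/seteqP; split=> omega /=.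
  by move=> /branching_treeE /(grownP _ vt t1) H v vt'; exact: H.
by move=> H; apply/branching_treeE/(grownP _ vt t1) => v vt'; exact: H.
Qed.

Lemma measurable_tree_event t :
  measurable [set omega | branching_tree (fun v => sigma v omega) = Some t].
Proof.
have [[vt t1]|n] := pselect (valid_tree t /\ root_type t = type1).
  rewrite tree_eventE //; apply: fin_bigcap_measurable; first exact: finite_seq.
  by move=> v _; exact: measurable_preimage.
rewrite (_ : mkset _ = set0) //; apply/seteqP; split=> // omega /=.
by move=> /branching_treeE H; case: n; split; [exact: grown_valid H|exact: H.1].
Qed.

Hypothesis iid : iid_copies p sigma.

Lemma tree_event_prob t : valid_tree t -> root_type t = type1 ->
  P [set omega | branching_tree (fun v => sigma v omega) = Some t] =
  (tree_weight p t)%:E.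
Proof.
move=> vt t1; rewrite -[LHS]fineK; last first.
  by rewrite fin_num_measure //; exact: measurable_tree_event.
congr EFin; rewrite /tree_weight tree_eventE // -(prod_internal (pmf p) vt).
rewrite (independent_seq iid.2).
- by apply: eq_bigr => v _; rewrite iid.1.
- exact: filter_uniq (uniq_vertices t).
- by move=> v _; exact: sigma_of_preimage.
Qed.

End tree_event.

(** Inverse of [code] on first passage paths, with a leaf as junk value elsewhere. *)
Definition decode (s : seq word) : tree :=
  xget (leaf type1) [set t | [/\ valid_tree t, root_type t = type1 & code t = s]].

Lemma decodeP s : lukasiewicz s ->
  [/\ valid_tree (decode s), root_type (decode s) = type1 & code (decode s) = s].
Proof.
move=> /tree_of_lukasiewicz[t H]; rewrite /decode.
by case: xgetP => [u _ //|/(_ t)].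
Qed.

Lemma decode_code t : valid_tree t -> root_type t = type1 -> decode (code t) = t.
Proof.
move=> vt t1; have [vd d1 e] := decodeP (lukasiewicz_code vt t1).
by apply: code_inj0 => //; rewrite d1 t1.
Qed.

Lemma tree_size_weight t : valid_tree t -> root_type t = type1 -> tree_size t = weight (code t).
Proof. by move=> vt t1; rewrite tree_size_code // t1. Qed.

Lemma lsum_words (R : realType) (p : probability word R) n m (F : seq word -> R) :
  lsum (short_words n) (pmf p) m F = lsum (words p n) (pmf p) m F.
Proof.
elim: m F => [|m ih] F; first by rewrite !lsum0.
rewrite !lsumS [RHS]big_filter [RHS]big_mkcond; apply: eq_bigr => w _; rewrite ih.
by case: ltgtP (pmf_ge0 p w) => // <- _; rewrite mul0r.
Qed.

(** The probability that the tree has size [n] and satisfies [Q], as a finite sum: the length [m] of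
    the code is the number of type 1 vertices, at most [n]. *)
Definition tree_prob (R : realType) (p : probability word R) (n : nat) (Q : tree -> bool) : R :=
  \sum_(m < n.+1) lsum (words p n) (pmf p) m
    (fun s => [&& lukasiewicz s, weight s == n & Q (decode s)]%:R).

Lemma random_tree_prob d (Om : measurableType d) (R : realType) (P : probability Om R)
    (p : probability word R) (sigma : seq nat -> {RV P >-> word}) n (Q : tree -> bool) :
  iid_copies p sigma ->
  P ([set omega | exists2 t, random_tree sigma omega = Some t & Q t] `&`
     size_event (random_tree sigma) n) = (tree_prob p n Q)%:E.
Proof.
move=> iid.
pose S := [seq s <- lists_upto (short_words n) n |
  [&& lukasiewicz s, weight s == n & Q (decode s)]].
pose E s := [set omega | random_tree sigma omega = Some (decode s)].
have -> : [set omega | exists2 t, random_tree sigma omega = Some t & Q t] `&`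
    size_event (random_tree sigma) n = \bigcup_(s in [set` S]) E s.
  apply/seteqP; split=> omega /=.
    move=> [[t tT Qt]]; rewrite /size_event /= tT /= => -[sn].
    have g := (branching_treeE _ _).1 tT.
    have vt := grown_valid g; have t1 := g.1.
    have wn : weight (code t) = n by rewrite -tree_size_weight.
    exists (code t); last by rewrite /E /= decode_code.
    rewrite /= mem_filter lukasiewicz_code // wn eqxx decode_code //= Qt.
    rewrite mem_lists_upto -{1}wn size_le_weight; apply/allP => w wt.
    rewrite /= mem_short_words -wn.
    exact: ltnW (size_word_lt_weight (lukasiewicz_code vt t1) wt).
  move=> [s]; rewrite /= mem_filter => /andP[/and3P[ls /eqP ws Qs] _] Es.
  have [vs s1 cs] := decodeP ls.
  split; first by exists (decode s).
  by rewrite /size_event /= Es /= tree_size_weight // cs ws.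
have mE s : measurable (E s) by exact: measurable_tree_event.
have uS : uniq S by apply: filter_uniq; apply: uniq_lists_upto; exact: uniq_short_words.
rewrite measure_fin_bigcup //.
- rewrite -fsbig_seq // big_filter big_mkcond /= /tree_prob.
  under [in RHS]eq_bigr do rewrite -lsum_words.
  rewrite -sum_lists_upto -sumEFin; apply: eq_bigr => s _.
  case: ifPn => [/and3P[ls _ _]|_]; last by rewrite mulr0.
  by have [vs s1 cs] := decodeP ls; rewrite mulr1 -[in RHS]cs; exact: tree_event_prob.
- exact: finite_seq.
- move=> s s'; rewrite /= !mem_filter => /andP[/and3P[ls _ _] _] /andP[/and3P[ls' _ _] _].
  move=> [omega [/= e]]; rewrite /E /= e => -[e'].
  by have [_ _ <-] := decodeP ls; have [_ _ <-] := decodeP ls'; rewrite e'.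
Qed.

(** * Trees with few copies of a given fringe subtree *)

(** Average over the [m] rotations, which preserve the weight of a list, and apply the cycle
    lemma. *)
Lemma cycle_lsum (R : realType) ws (q : word -> R) m (G : seq word -> R) :
  (forall s i, G (rot i s) = G s) ->
  m%:R * lsum ws q m (fun s => (lukasiewicz s)%:R * G s) =
  lsum ws q m (fun s => (drift s == -1)%:R * G s).
Proof.
move=> Grot.
rewrite (eq_lsum (G := fun s => \sum_(i < m) (lukasiewicz (rot i s))%:R * G (rot i s)) (m := m)
   (F := fun s => (drift s == -1)%:R * G s)) => [|s sm].
  rewrite lsum_sum (eq_bigr (fun=> lsum ws q m (fun s => (lukasiewicz s)%:R * G s))).
    by rewrite sumr_const card_ord mulr_natl.
  by move=> i _; rewrite (lsum_rot ws q (fun s => (lukasiewicz s)%:R * G s)) // ltnW.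
under eq_bigr do rewrite Grot; rewrite -mulr_suml; congr *%R; rewrite -natr_sum -sm.
case: eqP => [/cycle_lemma -> //|d]; rewrite big1 // => i _.
by rewrite /lukasiewicz drift_rot; case: eqP.
Qed.

(** Some rotation brings a big word to the front. The [m] rotations available for this are
    compensated by the factor [m] of the cycle lemma, so no factor depending on [n] is lost. Once
    the front word is removed, the remaining weight is prescribed, and [lsum_renewal] sums over all
    lengths. *)
Lemma lsum_big_jump (R : realType) ws (q : word -> R) (big : pred word) n N :
  (forall w, 0 <= q w) -> \sum_(w <- ws) q w <= 1 ->
  \sum_(m < N.+1) lsum ws q m (fun s => [&& lukasiewicz s, weight s == n & has big s]%:R) <=
  \sum_(w <- ws | big w) q w.
Proof.
move=> q0 q1; rewrite big_ord_recl /= lsum0 [lukasiewicz [::]]/lukasiewicz drift_nil /= add0r.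
(* The condition on the drift is dropped: only the weight and a big first word are kept. *)
pose F s : R := if s is w :: _ then (big w && (weight s == n))%:R else 0.
have F0 s : 0 <= F s by case: s => [|w s] /=.
have step m : lsum ws q m.+1 (fun s => [&& lukasiewicz s, weight s == n & has big s]%:R) <=
    lsum ws q m.+1 F.
  rewrite -(ler_pM2l (ltr0Sn R m)).
  rewrite (eq_lsum (G := fun s => (lukasiewicz s)%:R * ((weight s == n) && has big s)%:R)); last first.
    by move=> s _; case: lukasiewicz; rewrite ?mul1r ?mul0r.
  rewrite cycle_lsum => [|s i]; last by rewrite weight_rot has_rot.
  have -> : m.+1%:R * lsum ws q m.+1 F = lsum ws q m.+1 (fun s => \sum_(i < m.+1) F (rot i s)).
    rewrite lsum_sum (eq_bigr (fun=> lsum ws q m.+1 F)).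
      by rewrite sumr_const card_ord mulr_natl.
    by move=> i _; rewrite lsum_rot // ltnW.
  apply: le_lsum => // s sm _.
  case: (boolP (_ && _)) => [/andP[/eqP wn /(has_nthP [::])[i im bi]]|_]; last first.
    by rewrite mulr0 sumr_ge0.
  rewrite sm in im; rewrite (bigD1 (Ordinal im)) //= mulr1.
  have -> : F (rot i s) = 1.
    have e : rot i s = nth [::] s i :: (drop i.+1 s ++ take i s).
      by rewrite /rot (drop_nth [::]) ?sm.
    by rewrite e /F bi -e weight_rot wn eqxx.
  apply: (@le_trans _ _ 1); first by case: (_ == _).
  by rewrite lerDl sumr_ge0.
apply: (@le_trans _ _ (\sum_(m < N) lsum ws q m.+1 F)).
  by apply: ler_sum => m _; rewrite /bump add1n; exact: step.
rewrite (eq_bigr (fun m : 'I_N => \sum_(w <- ws) q w * lsum ws q m (fun s => F (w :: s))))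
  => [|m _]; last exact: lsumS.
rewrite exchange_big /= [leRHS]big_mkcond.
apply: ler_sum => w _; rewrite -mulr_sumr.
case bw : (big w); last first.
  by rewrite big1 ?mulr0 // => m _; rewrite (eq_lsum (G := fun=> 0)) ?lsum_cst ?mulr0.
rewrite ler_piMr //; case: (leqP (zeta w).+1 n) => h.
  have := lsum_renewal q0 q1 N (n - (zeta w).+1)%N (fun w : word => ltn0Sn (zeta w)).
  apply: le_trans; apply: ler_sum => m _; apply: le_lsum => // s _ _; rewrite andTb weight_cons ler_nat.
  by case: eqP => // <-; rewrite addKn eqxx.
rewrite (le_trans _ ler01) // big1 // => m _.
rewrite (eq_lsum (G := fun=> 0)) ?lsum_cst ?mulr0 // => s _.
by rewrite andTb weight_cons; case: eqP => // e; move: h; rewrite -e ltnNge leq_addr.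
Qed.

(** Passes from proportions among the [n] vertices to proportions among the [m] words. One [eps] is
    spent on [m * mu] being only larger than [(1 - eps) * n]. *)
Lemma count_threshold (R : realType) (o pi mu eps n m : R) : 0 <= pi -> pi <= 1 -> 0 < eps ->
  eps <= 2^-1 -> 0 <= o -> 0 <= n -> 1 <= mu -> o < (pi / mu - 2 * eps) * n ->
  (1 - eps) * n < m * mu -> o < (pi - eps) * m.
Proof.
move=> pi0 pi1 e0 e1 o0 n0 mu1 h5 h3.
have mu0 : 0 < mu by exact: lt_le_trans mu1.
have n1 : 0 < n.
  by rewrite lt_neqAle n0 andbT; apply/eqP => e; move: h5; rewrite -e mulr0 ltNge o0.
have pie : eps < pi.
  have h : 2 * eps < pi / mu by rewrite -subr_gt0 -(pmulr_lgt0 _ n1) (le_lt_trans o0).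
  have h' : pi / mu <= pi by rewrite ler_pdivrMr // ler_peMr.
  lra.
apply: (lt_le_trans h5); rewrite -(ler_pM2r mu0).
apply: (@le_trans _ _ ((pi - eps) * ((1 - eps) * n))); last first.
  by rewrite -mulrA ler_wpM2l ?subr_ge0 ?ltW.
have -> : (pi / mu - 2 * eps) * n * mu = (pi - 2 * eps * mu) * n by field; rewrite gt_eqF.
rewrite mulrA ler_wpM2r //; nra.
Qed.

Section rare_events.
Context {R : realType} (p : probability word R).
Hypothesis hcrit : 'E_p[fun w => (xi w)%:R]%E = 1%E.
Hypothesis hvar_xi : (fun w : word => (xi w)%:R : R) \in Lfun p 2%:E.
Hypothesis hvar_zeta : (fun w : word => (zeta w)%:R : R) \in Lfun p 2%:E.

Let mu := mean_weight p.

(** For a given length [m] only one of the last two terms is present, since the conditions comparing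
    [m * mu] with [(1 - eps) * n] are complementary. *)
Lemma lsum_bad (T : tree) (eps : R) n m : valid_tree T -> root_type T = type1 ->
  0 < eps -> eps <= 2^-1 ->
  lsum (words p n) (pmf p) m (fun s => [&& lukasiewicz s, weight s == n &
    (count_mem T (fringes (decode s)))%:R < (tree_weight p T / mu - 2 * eps) * n%:R]%:R) <=
  lsum (words p n) (pmf p) m (fun s => [&& lukasiewicz s, weight s == n &
    has (fun w => eps / 8 * n%:R < (zeta w).+1%:R) s]%:R) +
  ((m%:R * mu <= (1 - eps) * n%:R)%R%:R * lsum (words p n) (pmf p) m (fun s =>
     (all (fun w => (zeta w).+1%:R <= eps / 8 * n%:R) s && (weight s == n))%:R) +
   ((1 - eps) * n%:R < m%:R * mu)%R%:R * lsum (words p n) (pmf p) m (fun s =>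
    ((occurrences (code T) s)%:R < (tree_weight p T - eps) * m%:R)%R%:R)).
Proof.
move=> vT T1 e0 e1; have mu1 : 1 <= mu := mean_weight_ge1 p.
have [pi0 pi1] := (tree_weight_ge0 p T, tree_weight_le1 p T).
set pi := tree_weight p T in pi0 pi1 *.
set A := (X in lsum _ _ _ X + _); set B := (X in _ + (_ * lsum _ _ _ X + _)).
set C := (X in _ + (_ + _ * lsum _ _ _ X)).
rewrite -(lsumZ _ _ _ _ B) -(lsumZ _ _ _ _ C) -!lsumD /A /B /C {A B C}.
apply: le_lsum; first exact: pmf_ge0.
move=> s sm sw; have n0 : 0 <= n%:R :> R by [].
set b1 := has _ s; set b2 := m%:R * mu <= _; set b3 := _ < m%:R * mu.
have b23 : b3 = ~~ b2 by rewrite /b3 /b2 ltNge.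
have -> : all (fun w => (zeta w).+1%:R <= eps / 8 * n%:R) s = ~~ b1.
  by rewrite -all_predC; apply: eq_all => w /=; rewrite -leNgt.
set b4 := _ < (tree_weight p T - eps) * _; set b5 := _ < (tree_weight p T / mu - _) * _.
have key : lukasiewicz s -> b5 -> b3 -> b4.
  move=> ls; have [vd d1 cd] := decodeP ls.
  rewrite /b5 -(occurrences_code vT T1 vd) cd /b3 /b4 => h5 h3.
  exact: (count_threshold pi0 pi1 e0 e1 (ler0n _ _) n0 mu1 h5 h3).
move: key; case: (lukasiewicz s) => [|_]; last by rewrite ?addr_ge0 ?mulr_ge0.
case: (weight s == n) => [|_]; last by rewrite ?addr_ge0 ?mulr_ge0.
rewrite b23 !andbT !andTb => /(_ isT).
case: b5 => [/(_ isT)|_]; last by rewrite ?addr_ge0 ?mulr_ge0.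
case: b1; first by move=> _; rewrite lerDl addr_ge0 ?mulr_ge0.
case: (b2) => [_|/(_ isT) ->] /=; lra.
Qed.

Lemma bad_trees_negligible (T : tree) (delta eta : R) :
  valid_tree T -> root_type T = type1 -> 0 < delta -> 0 < eta ->
  exists N : nat, forall n, (N <= n)%N ->
    n%:R ^+ 2 * tree_prob p n (fun t => (count_mem T (fringes t))%:R <
      (tree_weight p T / mu - delta) * n%:R) <= eta.
Proof.
move=> vT T1 d0 eta0; have mu1 : 1 <= mu := mean_weight_ge1 p.
have mu0 : 0 < mu by exact: lt_le_trans mu1.
pose eps := Num.min (delta / 2) 2^-1.
have e0 : 0 < eps by rewrite /eps lt_min divr_gt0 //= invr_gt0 ltr0n.
have e1 : eps <= 2^-1 by rewrite /eps ge_min lexx orbT.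
have e2 : 2 * eps <= delta.
  by rewrite mulrC -ler_pdivlMr // /eps ge_min lexx.
have [C C0 HC] := words_moments hcrit hvar_xi hvar_zeta.
have e8 : 0 < eps / 8 by rewrite divr_gt0.
have eta2 : 0 < eta / 2 by rewrite divr_gt0.
have [N1 HN1] := words_tail hvar_xi hvar_zeta e8 eta2.
set c := code T.
have c0 : (0 < size c)%N by rewrite /c; case: (T) T1 => -[].
have k0 : 0 < (size c)%:R :> R by rewrite ltr0n.
pose K1 := expR (256 * C / eps ^+ 2).
(* The tail bound of [lsum_occurrences_small] at [n / (2 * mu)], which is a lower bound for [m] in
   the case concerned. *)
pose K2 := (size c)%:R * (256 / (eps ^+ 2 / (64 * (size c)%:R * mu)) ^+ 4).
have K10 : 0 <= K1 := expR_ge0 _.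
have b0 : 0 < eps ^+ 2 / (64 * (size c)%:R * mu) by rewrite divr_gt0 ?exprn_gt0 ?mulr_gt0.
have K20 : 0 <= K2 by rewrite mulr_ge0 ?divr_ge0 ?exprn_ge0 // ltW.
pose B := 8 * (size c)%:R * mu / eps + 4 * (K1 + K2) / eta + 1.
have q1 : 0 <= 8 * (size c)%:R * mu / eps by rewrite divr_ge0 ?mulr_ge0 // ltW.
have q2 : 0 <= 4 * (K1 + K2) / eta by rewrite divr_ge0 ?mulr_ge0 ?addr_ge0 // ltW.
exists (maxn N1 (maxn (weight c) (Num.truncn B).+1)) => n.
rewrite !geq_max => /and3P[n1 nw nB].
have BnR : B < n%:R by rewrite (lt_le_trans (truncnS_gt _)) // ler_nat.
have nR : 0 < n%:R :> R by apply: lt_trans BnR; rewrite /B -addrA ltr_wpDl // ltr_wpDl.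
have n0 : (0 < n)%N by rewrite -(ltr0n R).
have n1R : 1 <= n%:R :> R by rewrite ler1n.
have [_ _ [S1 S2 _ _]] := HC n n0.
have q0 := pmf_ge0 p; have qs := sum_pmf_le1 p (uniq_words p n).
have term1 m : (m <= n)%N -> (m%:R * mu <= (1 - eps) * n%:R)%R%:R *
    lsum (words p n) (pmf p) m (fun s =>
     (all (fun w => (zeta w).+1%:R <= eps / 8 * n%:R) s && (weight s == n))%:R) <= K1 / n%:R ^+ 4.
  move=> mn; case: (boolP (_ <= (1 - eps) * _)) => [h|_]; last first.
    by rewrite mul0r divr_ge0 // exprn_ge0.
  by rewrite mul1r; exact: (lsum_no_big_jump q0 qs C0 e0 S1 S2 n0 mn h).
have term2 m : (m <= n)%N -> ((1 - eps) * n%:R < m%:R * mu)%R%:R *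
    lsum (words p n) (pmf p) m (fun s =>
     ((occurrences c s)%:R < (tree_weight p T - eps) * m%:R)%R%:R) <= K2 / n%:R ^+ 4.
  move=> mn; case: (boolP (_ < m%:R * mu)) => [h|_]; last first.
    by rewrite mul0r divr_ge0 // exprn_ge0.
  have hm : n%:R / (2 * mu) <= m%:R :> R.
    rewrite ler_pdivrMr ?mulr_gt0 //.
    have : 2^-1 * n%:R <= (1 - eps) * n%:R by rewrite ler_wpM2r //; lra.
    lra.
  rewrite mul1r.
  (* As [n] is at least the weight of [c], a letter of [c] outside [words p n] has probability zero;
     then the weight of [T] vanishes and the threshold is not positive. *)
  have [cw|ncw] := boolP (all (mem (words p n)) c); last first.
    have t0 : tree_weight p T = 0.
      have /allPn[w wc] := ncw; rewrite /= mem_words negb_and -ltnNge => /orP[h'|w0].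
        have h2 := size_word_lt_weight (lukasiewicz_code vT T1) wc.
        by move: (leq_trans (ltn_trans h' h2) nw); rewrite ltnn.
       rewrite /tree_weight (big_rem w) //=.
      by case: ltgtP (pmf_ge0 p w) w0 => // <-; rewrite mul0r.
    rewrite t0 sub0r (eq_lsum (G := fun=> 0)) ?lsum_cst ?mulr0 ?divr_ge0 ?exprn_ge0 // => s _.
    case: (boolP (_ < _ * m%:R)) => // h1; have : (occurrences c s)%:R < 0 :> R.
      by apply: lt_le_trans h1 _; rewrite mulNr oppr_le0 mulr_ge0 // ltW.
    by rewrite ltrn0.
  have h4 : 4 * (size c)%:R <= eps * m%:R.
    apply: le_trans (ler_wpM2l (ltW e0) hm).
    rewrite mulrA ler_pdivlMr ?mulr_gt0 //.
    have h5 : 8 * (size c)%:R * mu / eps < n%:R.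
      by apply: le_lt_trans BnR; rewrite /B -addrA lerDl addr_ge0.
    by rewrite ltr_pdivrMr // in h5; lra.
  apply: le_trans (lsum_occurrences_small q0 qs (uniq_words p n) cw e0 c0 h4) _.
  have -> : K2 / n%:R ^+ 4 = (size c)%:R *
      (256 / (eps ^+ 2 / (32 * (size c)%:R) * (n%:R / (2 * mu))) ^+ 4).
    by rewrite /K2; field; rewrite !gt_eqF.
  have p1 : 0 < eps ^+ 2 / (32 * (size c)%:R) by rewrite divr_gt0 ?exprn_gt0 ?mulr_gt0.
  have p2 : 0 < n%:R / (2 * mu) by rewrite divr_gt0 ?mulr_gt0.
  have p3 : 0 < m%:R :> R by exact: lt_le_trans hm.
  have s1 := exprn_gt0 4 (mulr_gt0 p1 p2); have s2 := exprn_gt0 4 (mulr_gt0 p1 p3).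
  rewrite ler_wpM2l // ler_wpM2l // lef_pV2 ?posrE //.
  have le12 := ler_wpM2l (ltW p1) hm.
  have p12 := ltW (mulr_gt0 p1 p2).
  by apply: lerXn2r => //; rewrite nnegrE // (le_trans p12).
have bound : tree_prob p n (fun t => (count_mem T (fringes t))%:R <
      (tree_weight p T / mu - delta) * n%:R) <=
    \sum_(w <- words p n | eps / 8 * n%:R < (zeta w).+1%:R) pmf p w +
    n.+1%:R * ((K1 + K2) / n%:R ^+ 4).
  apply: (@le_trans _ _ (\sum_(m < n.+1) (lsum (words p n) (pmf p) m
      (fun s => [&& lukasiewicz s, weight s == n &
        has (fun w => eps / 8 * n%:R < (zeta w).+1%:R) s]%:R) + (K1 + K2) / n%:R ^+ 4))).
    apply: ler_sum => m _; have mn : (m <= n)%N by rewrite -ltnS.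
    apply: (@le_trans _ _ (lsum (words p n) (pmf p) m (fun s => [&& lukasiewicz s, weight s == n &
      (count_mem T (fringes (decode s)))%:R < (tree_weight p T / mu - 2 * eps) * n%:R]%:R))).
      apply: le_lsum => // s _ _; case: lukasiewicz => //=; case: (weight s == n) => //=.
      rewrite ler_nat; case: (boolP (_ < (_ - delta) * _)) => // h1.
      by rewrite (lt_le_trans h1) // ler_wpM2r // lerD2l lerN2.
    apply: le_trans (lsum_bad n m vT T1 e0 e1) _; rewrite lerD2l.
    have -> : (K1 + K2) / n%:R ^+ 4 = K1 / n%:R ^+ 4 + K2 / n%:R ^+ 4 by rewrite mulrDl.
    by apply: lerD; [exact: term1|exact: term2].
  rewrite big_split /= lerD ?lsum_big_jump // sumr_const card_ord -[leLHS]mulr_natl.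
  exact: lexx.
apply: (@le_trans _ _ (eta / 2 + eta / 2)); last by lra.
rewrite (le_trans (ler_wpM2l (sqr_ge0 _) bound)) // mulrDr lerD ?HN1 //.
have nn : n.+1%:R <= 2 * n%:R :> R by rewrite -natr1; lra.
have -> : n%:R ^+ 2 * (n.+1%:R * ((K1 + K2) / n%:R ^+ 4)) = n.+1%:R * ((K1 + K2) / n%:R ^+ 2).
  by field; rewrite gt_eqF.
have KK : 0 <= (K1 + K2) / n%:R ^+ 2 by rewrite divr_ge0 ?addr_ge0 ?exprn_ge0.
apply: (le_trans (ler_wpM2r KK nn)).
have -> : 2 * n%:R * ((K1 + K2) / n%:R ^+ 2) = 2 * (K1 + K2) / n%:R by field; rewrite gt_eqF.
have h5 : 4 * (K1 + K2) / eta < n%:R by apply: le_lt_trans BnR; rewrite /B; lra.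
by rewrite ler_pdivrMr //; rewrite ltr_pdivrMr // in h5; lra.
Qed.

End rare_events.

(** * Lower bound for the law of the size *)

Section residues.
Variable g : nat.

Definition residue (i : int) : 'I_g.+1 := inord `|(i %% g.+1%:Z)%Z|.

Lemma residueP i j : residue i = residue j -> exists x : int, i = j + g.+1%:Z * x.
Proof.
have lt k : (`|(k %% g.+1%:Z)%Z| < g.+1)%N.
  by rewrite -ltz_nat gez0_abs ?modz_ge0 // ltz_pmod.
move=> e0; have := congr1 val e0; rewrite /residue /= !inordK // => e.
have : (i %% g.+1%:Z)%Z = (j %% g.+1%:Z)%Z.
  by rewrite -[LHS]gez0_abs ?modz_ge0 // e gez0_abs ?modz_ge0.
move/eqP; rewrite eqz_mod_dvd => /dvdzP[x e2]; exists x.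
by rewrite mulrC -e2 addrC subrK.
Qed.

End residues.

Section lower_bound.
Context {R : realType} (p : probability word R).

Definition supported (s : seq word) : bool := all (fun w => 0 < pmf p w) s.

Lemma supported_words n s : all (mem (words p n)) s -> supported s.
Proof. by move=> /allP sw; apply/allP => w /sw /=; rewrite mem_words => /andP[]. Qed.

Lemma supported_weight_gt0 s : supported s -> 0 < \prod_(w <- s) pmf p w.
Proof.
elim: s => [|w s ih] /=; first by rewrite big_nil.
by move=> /andP[w0 /ih s0]; rewrite big_cons mulr_gt0.
Qed.

Lemma supported_size n : 0 < tree_prob p n xpredT ->
  exists2 s, supported s & displacement s = (-1, n%:Z).
Proof.
move=> pos; apply: contrapT => H; move: pos; rewrite ltNge => /negP; apply.
apply: sumr_le0 => m _; apply: (@le_trans _ _ (lsum (words p n) (pmf p) m (fun=> 0))).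
  apply: le_lsum; first exact: pmf_ge0.
  move=> s _ sw; case: (boolP (_ && _)) => // /and3P[/andP[/eqP ds _] /eqP ws _].
  by case: H; exists s; [exact: supported_words sw|rewrite /displacement ds ws].
by rewrite lsum_cst mulr0.
Qed.

Lemma supported_copies k s : supported s -> supported (flatten (nseq k s)).
Proof. by move=> hs; elim: k => //= k ih; rewrite /supported all_cat; apply/andP. Qed.

Lemma displacement_copies k s : displacement (flatten (nseq k s)) = displacement s *+ k.
Proof.
elim: k => [|k ih] /=; first by rewrite displacement_nil.
by rewrite displacement_cat ih mulrS.
Qed.

Lemma pair_mulrn (v : int * int) k : v *+ k = (v.1 *+ k, v.2 *+ k).
Proof. by elim: k => [|k ih]; rewrite ?mulr0n // !mulrS ih. Qed.

Lemma pair_addE (u v : int * int) : u + v = (u.1 + v.1, u.2 + v.2).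
Proof. by []. Qed.

Section lattice.
Variables (g a D : nat).
Hypothesis ha : is_minimum [set n | 0 < tree_prob p n xpredT] a.
Hypothesis hD : is_span [set n | 0 < tree_prob p n xpredT] a D.

(** Up to multiples of [g.+1], the point (0, z) is a sum of steps of positive probability. Such [z]
    form a group modulo [g.+1], because [g] copies of a list have the opposite residue. *)
Definition reachable (z : nat) : Prop := exists2 s, supported s &
  exists x y : int, displacement s = (g.+1%:Z * x, z%:Z + g.+1%:Z * y).

Lemma modulusE : g.+1%:Z = g%:Z + 1. Proof. by rewrite -addn1 PoszD. Qed.

Lemma mulrn_intE (x : int) : x *+ g = x * g%:Z. Proof. by rewrite -mulr_natr natz. Qed.

Lemma reachable0 : reachable 0.
Proof. by exists [::] => //; exists 0, 0; rewrite displacement_nil !mulr0. Qed.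

Lemma reachable_modulus : reachable g.+1.
Proof. by exists [::] => //; exists 0, (-1); rewrite displacement_nil mulr0 mulrN1 addrN. Qed.

Lemma reachableD z z' : reachable z -> reachable z' -> reachable (z + z').
Proof.
move=> [s ss [x [y e]]] [s' ss' [x' [y' e']]].
exists (s ++ s'); first by rewrite /supported all_cat; apply/andP.
exists (x + x'), (y + y'); rewrite displacement_cat e e' pair_addE /= PoszD.
by congr pair; ring.
Qed.

Lemma reachableB z z' : (z <= z')%N -> reachable z -> reachable z' -> reachable (z' - z).
Proof.
move=> zz' [s ss [x [y e]]] [s' ss' [x' [y' e']]].
exists (s' ++ flatten (nseq g s)).
  by rewrite /supported all_cat; apply/andP; split => //; exact: supported_copies.
exists (x' + x *+ g), (y' + z%:Z + y *+ g).
rewrite displacement_cat displacement_copies e e' pair_mulrn pair_addE -subzn // modulusE.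
by rewrite !mulrn_intE; congr pair; rewrite /=; ring.
Qed.

Lemma reachableM z k : reachable z -> reachable (k * z).
Proof. by move=> hz; elim: k => [|k ih]; [exact: reachable0|rewrite mulSn; exact: reachableD]. Qed.

(** Codes of trees of sizes n and a show that n - a is reachable. The least positive reachable
    number divides all reachable ones, hence all these differences, hence their gcd [D]. *)
Lemma reachable_period k : reachable (D * k).
Proof.
have ex : exists z, (0 < z)%N && `[< reachable z >].
  by exists g.+1; apply/andP; split=> //; apply/asboolP; exact: reachable_modulus.
have [e /andP[e0 /asboolP he] emin] := ex_minnP ex.
have div z : reachable z -> (e %| z)%N.
  move=> hz; rewrite /dvdn -leqn0 leqNgt; apply/negP => r0.
  have : reachable (z %% e).
    have -> : (z %% e = z - z %/ e * e)%N by rewrite {2}(divn_eq z e) addKn.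
    by apply: reachableB => //; [exact: leq_trunc_div|exact: reachableM].
  move=> hr; have := emin (z %% e)%N; rewrite r0 /=.
  have rr : `[< reachable (z %% e) >] by apply/asboolP.
  by move=> /(_ rr); rewrite leqNgt ltn_pmod.
have [sa ssa ea] := supported_size ha.1.
have eD : (e %| D)%N.
  apply: hD.2 => n hn; apply: div.
  have an := ha.2 _ hn.
  have [s ss es] := supported_size hn.
  exists (s ++ flatten (nseq g sa)).
    by rewrite /supported all_cat; apply/andP; split => //; exact: supported_copies.
  exists (-1), (a%:Z); rewrite displacement_cat displacement_copies es ea pair_mulrn pair_addE.
  by rewrite -subzn // modulusE !mulrn_intE; congr pair; rewrite /=; ring.
by have /dvdnP[j ->] := dvdn_mulr k eD; exact: reachableM.
Qed.

(** Modulo [g.+1], the [g] copies of [s] cancel [s], a code of size [a] provides (-1, a), and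
    [reachable_period] provides the multiple of [D]. *)
Lemma fixer s k : supported s -> exists2 f, supported f & exists x y : int,
  displacement s + displacement f = (-1 + g.+1%:Z * x, (a + D * k)%N%:Z + g.+1%:Z * y).
Proof.
move=> ss; have [sa ssa ea] := supported_size ha.1.
have [f sf [x [y ef]]] := reachable_period k.
exists (flatten (nseq g s) ++ sa ++ f).
  by rewrite /supported !all_cat; apply/and3P; split => //; exact: supported_copies.
exists ((displacement s).1 + x), ((displacement s).2 + y).
rewrite !displacement_cat displacement_copies ea ef pair_mulrn !pair_addE PoszD modulusE.
by rewrite !mulrn_intE; congr pair; rewrite /=; ring.
Qed.

Definition residue2 (v : int * int) : 'I_g.+1 * 'I_g.+1 := (residue g v.1, residue g v.2).

(** A fixer works for all lists and sizes with the same residues, so finitely many suffice; their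
    displacements are then bounded and their probabilities bounded away from zero. *)
Lemma fixers : exists f : 'I_g.+1 * 'I_g.+1 -> 'I_g.+1 -> seq word,
  (forall i r, supported (f i r)) /\
  forall s k, supported s -> exists x y : int,
    displacement s + displacement (f (residue2 (displacement s)) (residue g (a + D * k)%N%:Z)) =
    (-1 + g.+1%:Z * x, (a + D * k)%N%:Z + g.+1%:Z * y).
Proof.
have H (ir : ('I_g.+1 * 'I_g.+1) * 'I_g.+1) : exists f, supported f /\
    forall s k, supported s -> residue2 (displacement s) = ir.1 ->
    residue g (a + D * k)%N%:Z = ir.2 -> exists x y : int,
    displacement s + displacement f = (-1 + g.+1%:Z * x, (a + D * k)%N%:Z + g.+1%:Z * y).
  have [[s0 [k0 [ss0 es0 ek0]]]|none] := pselect (exists s k, [/\ supported s,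
     residue2 (displacement s) = ir.1 & residue g (a + D * k)%N%:Z = ir.2]); last first.
    by exists [::]; split=> // s k h1 h2 h3; case: none; exists s, k.
  have [f sf [x [y e]]] := fixer k0 ss0.
  exists f; split=> // s k ss es ek.
  move: es; rewrite -es0 => -[/residueP[u eu] /residueP[v ev]].
  move: ek; rewrite -ek0 => /residueP[t et].
  exists (x + u), (y + v - t); rewrite et.
  move: e; rewrite !pair_addE => -[e1 e2]; congr pair; rewrite /=.
    by rewrite eu addrAC e1; ring.
  by rewrite ev addrAC e2; ring.
have [f Hf] := choice H.
exists (fun i r => f (i, r)); split=> [i r|s k ss]; first by case: (Hf (i, r)).
by case: (Hf (residue2 (displacement s), residue g (a + D * k)%N%:Z)) => _; apply.
Qed.

End lattice.
End lower_bound.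

(** * Affinely independent points in the support of the offspring law *)

Section spanning_words.
Context {R : realType} (p : probability word R).
Hypothesis hcrit : 'E_p[fun w => (xi w)%:R]%E = 1%E.
Hypothesis hvar_xi : (fun w : word => (xi w)%:R : R) \in Lfun p 2%:E.
Hypothesis hvar_zeta : (fun w : word => (zeta w)%:R : R) \in Lfun p 2%:E.

(** If no word of [A] had positive mass, the sums over [words p n] would see nothing of [A], while
    the second moment makes the part of [A] outside them arbitrarily small. *)
Lemma measure_gt0_word (A : set word) : (0 < p A)%E -> exists2 w, A w & 0 < pmf p w.
Proof.
move=> A0; apply: contrapT => H.
have [C C0 intC] := second_moment hvar_xi hvar_zeta.
have fA : p A = (fine (p A))%:E by rewrite fineK // fin_num_measure.
have e0 : 0 < fine (p A) by rewrite -lte_fin -fA.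
set e := fine (p A) in fA e0.
pose n := (Num.truncn (C / e)).+1.
have Cn : C / e < n%:R by exact: truncnS_gt.
have n0 : 0 < n%:R :> R by rewrite ltr0n.
have intA : (\int[p]_w (\1_A w : R)%:E = e%:E)%E by rewrite integral_indic // setIT.
have h : e - n%:R^-1 * C <= \sum_(w <- words p n) pmf p w * \1_A w.
  apply: (@sum_words_ge _ p n _ (@size_sqr R) _ _ _ _ _ _ _ intA intC) => //.
  - by move=> w; exact: sqr_ge0.
  - move=> w nw; apply: (@le_trans _ _ 1); first by rewrite indicE; case: (_ \in _).
    rewrite mulrC ler_pdivlMr // mul1r /size_sqr expr2.
    apply: (@le_trans _ _ (size w).+1%:R); first by rewrite ler_nat ltnW // ltnW.
    by rewrite ler_peMr // ler1n.
have : \sum_(w <- words p n) pmf p w * \1_A w = 0 :> R.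
  rewrite big_seq big1 // => w; rewrite mem_words => /andP[_ w0].
  rewrite indicE; case: (boolP (w \in A)) => [|_]; last by rewrite mulr0.
  by rewrite inE => Aw; case: H; exists w.
move=> e1; rewrite e1 subr_le0 mulrC ler_pdivlMr // in h.
by rewrite ltr_pdivrMr // mulrC in Cn; have := lt_le_trans Cn h; rewrite ltxx.
Qed.

Hypothesis hline : ~ support_on_line p.

Definition det (w0 w1 w2 : word) : int :=
  (step w1 - step w0).1 * (step w2 - step w0).2 - (step w1 - step w0).2 * (step w2 - step w0).1.

Lemma detE w0 w1 w2 : det w0 w1 w2 =
  ((xi w1)%:Z - (xi w0)%:Z) * ((zeta w2)%:Z - (zeta w0)%:Z) -
  ((zeta w1)%:Z - (zeta w0)%:Z) * ((xi w2)%:Z - (xi w0)%:Z).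
Proof.
have S k : k.+1%:Z = k%:Z + 1 by rewrite -addn1 PoszD.
by rewrite /det /step /= (S (zeta w0)) (S (zeta w1)) (S (zeta w2)); ring.
Qed.

Lemma support_not_on_line (al be c : R) : (al, be) != (0, 0) ->
  exists2 w, 0 < pmf p w & al * (xi w)%:R + be * (zeta w)%:R != c.
Proof.
move=> ab; apply: contrapT => H; apply: hline; exists al, be, c; split=> // x y.
move=> /measure_gt0_word[w [<- <-] w0]; apply: contrapT => /eqP ne; apply: H.
by exists w.
Qed.

(** The support contains a point other than that of [w0], and then a point off the line through
    these two. Exchanging [w1] and [w2] makes the determinant positive. *)
Lemma spanning_words : exists w0 w1 w2, exists g : nat,
  [/\ 0 < pmf p w0, 0 < pmf p w1, 0 < pmf p w2 & det w0 w1 w2 = g.+1%:Z].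
Proof.
(* As [xi] is never -1, this merely yields a word of positive probability. *)
have [|w0 p0 _] := @support_not_on_line 1 0 (- 1).
  by rewrite xpair_eqE oner_eq0.
suff [w1 [w2 [p1 p2 d]]] : exists w1 w2, [/\ 0 < pmf p w1, 0 < pmf p w2 & det w0 w1 w2 != 0].
  case: (ltgtP (det w0 w1 w2) 0) d => // h _; last first.
    by exists w0, w1, w2; case: (det w0 w1 w2) h => // -[|g] // _; exists g.
  exists w0, w2, w1; have : 0 < det w0 w2 w1 by move: h; rewrite !detE; lia.
  by case: (det w0 w2 w1) => // -[|g] // _; exists g.
have [w1 p1 e1] : exists2 w1, 0 < pmf p w1 & (xi w1, zeta w1) != (xi w0, zeta w0).
  have [|w1 p1 n1] := @support_not_on_line 1 0 (xi w0)%:R; first by rewrite xpair_eqE oner_eq0.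
  exists w1 => //; apply: contra n1; rewrite xpair_eqE => /andP[/eqP-> _].
  by rewrite mul1r mul0r addr0.
pose al : R := (zeta w1)%:R - (zeta w0)%:R; pose be : R := (xi w0)%:R - (xi w1)%:R.
have [|w2 p2 n2] := @support_not_on_line al be (al * (xi w0)%:R + be * (zeta w0)%:R).
  move: e1; apply: contra; rewrite !xpair_eqE !subr_eq0 !eqr_nat andbC => /andP[/eqP-> /eqP->].
  by rewrite !eqxx.
exists w1, w2; split=> //; apply: contra n2 => /eqP; rewrite detE => d.
rewrite -subr_eq0 /al /be.
have : (((xi w1)%:Z - (xi w0)%:Z) * ((zeta w2)%:Z - (zeta w0)%:Z) -
  ((zeta w1)%:Z - (zeta w0)%:Z) * ((xi w2)%:Z - (xi w0)%:Z))%:~R = 0 :> R by rewrite d.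
rewrite intrB !intrM !intrB => dR; apply/eqP; rewrite -[RHS]oppr0 -dR.
by rewrite -!pmulrn; ring.
Qed.

End spanning_words.

Section tree_prob_lower.
Context {R : realType} (p : probability word R).
Hypothesis hcrit : 'E_p[fun w => (xi w)%:R]%E = 1%E.
Hypothesis hvar_xi : (fun w : word => (xi w)%:R : R) \in Lfun p 2%:E.
Hypothesis hvar_zeta : (fun w : word => (zeta w)%:R : R) \in Lfun p 2%:E.
Hypothesis hline : ~ support_on_line p.
Variables (a D : nat).
Hypothesis ha : is_minimum [set n | 0 < tree_prob p n xpredT] a.
Hypothesis hD : is_span [set n | 0 < tree_prob p n xpredT] a D.

Let mu := mean_weight p.

(** The cycle lemma turns first passage paths of length [m] into paths ending at -1, with a factor
    [m]. The latter is at most [n], since each word has weight at least 1. *)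
Lemma lsum_hit_le_tree_prob n m : lsum (words p n) (pmf p) m (fun s =>
    (displacement s == (-1, n%:Z))%:R) <= n%:R * tree_prob p n xpredT.
Proof.
have q0 := pmf_ge0 p.
have tp0 k : 0 <= lsum (words p n) (pmf p) k
    (fun s => [&& lukasiewicz s, weight s == n & true]%:R) by exact: lsum_ge0.
have tp : 0 <= tree_prob p n xpredT by exact: sumr_ge0.
rewrite (eq_lsum (G := fun s => (drift s == -1)%:R * (weight s == n)%:R)); last first.
  by move=> s _; rewrite xpair_eqE eqz_nat; do 2 case: (_ == _); rewrite ?mulr1 ?mulr0.
rewrite -cycle_lsum => [|s i]; last by rewrite weight_rot.
case: (leqP m n) => mn; last first.
  rewrite (eq_lsum (G := fun=> 0)) ?lsum_cst ?mulr0 ?mulr_ge0 // => s sm.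
  case: eqP => [e|_]; last by rewrite mulr0.
  by have := size_le_weight s; rewrite e sm leqNgt mn.
apply: (@le_trans _ _ (m%:R * tree_prob p n xpredT)); last by rewrite ler_wpM2r // ler_nat.
rewrite ler_wpM2l // /tree_prob (bigD1 (Ordinal (mn : (m < n.+1)%N))) //=.
rewrite (eq_lsum (G := fun s => [&& lukasiewicz s, weight s == n & true]%:R)).
  by rewrite lerDl sumr_ge0.
by move=> s _; rewrite andbT; case: lukasiewicz; rewrite ?mul1r ?mul0r.
Qed.

Lemma tree_prob_lower : exists2 c : R, 0 < c & exists N : nat, forall k,
  (N <= a + D * k)%N -> c / (a + D * k)%:R ^+ 2 <= tree_prob p (a + D * k) xpredT.
Proof.
have [w0 [w1 [w2 [g [p0 p1 p2 dt]]]]] := spanning_words hvar_xi hvar_zeta hline.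
have [f [fs ff]] := fixers g ha hD.
have [C C0 HC] := words_moments hcrit hvar_xi hvar_zeta.
have mu1 : 1 <= mu := mean_weight_ge1 p.
have mu0 : 0 < mu by exact: lt_le_trans mu1.
have q0 := pmf_ge0 p.
(* The divisor 4 is the largest possible coefficient 1 + 1 + 2 of [eps] in [shape_weight]. *)
pose eps := Num.min (pmf p w0) (Num.min (pmf p w1) (pmf p w2)) / 4.
have eps0 : 0 < eps by rewrite divr_gt0 // !lt_min p0 p1 p2.
have eps4 w : w \in [:: w0; w1; w2] -> 4 * eps <= pmf p w.
  rewrite /eps mulrC mulfVK // !inE => /or3P[] /eqP ->; by rewrite !ge_min lexx ?orbT.
have weight0 b : 0 <= shape_weight (pmf p) w0 w1 w2 eps b.
  case: b => [w|b] /=; last by rewrite mulr_ge0 // ltW.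
  rewrite subr_ge0; case: (boolP (w \in [:: w0; w1; w2])) => [/eps4|].
    apply: le_trans; rewrite mulrC ler_wpM2r ?(ltW eps0) //.
    by case: (w == w1); case: (w == w2); case: (w == w0); rewrite /= ?mulr1 ?mulr0; lra.
  rewrite !inE !negb_or => /and3P[/negbTE-> /negbTE-> /negbTE->].
  by rewrite mulr0 !addr0 mulr0.
pose J : finType := ('I_g.+1 * 'I_g.+1)%type.
pose vmax : R := \sum_(i : J) \sum_(r : 'I_g.+1)
   (`|(displacement (f i r)).1%:~R| + `|(displacement (f i r)).2%:~R|).
have vmax_ge i r : `|(displacement (f i r)).1%:~R| + `|(displacement (f i r)).2%:~R| <= vmax.
  rewrite /vmax (bigD1 i) //= (bigD1 r) //= -addrA lerDl.
  by apply: addr_ge0; do ?apply: sumr_ge0 => ? _; exact: addr_ge0.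
(* [C] stands for the truncated means, [mu] for the rounding in [m], 1 for the final level -1 of the
   walk, and [vmax] for the fixers. *)
pose K := C + mu + 1 + vmax.
have vmax0 : 0 <= vmax by apply: sumr_ge0 => i _; apply: sumr_ge0 => r _; rewrite addr_ge0.
have K0 : 0 <= K by rewrite /K; lra.
have [c c0 [M0 HM]] := lsum_local_lower eps0 q0 weight0 dt K0 C0.
pose cmin : R := \prod_(i : J) \prod_(r : 'I_g.+1) \prod_(w <- f i r) pmf p w.
have cmin0 : 0 < cmin.
  by apply: prodr_gt0 => i _; apply: prodr_gt0 => r _; exact: supported_weight_gt0.
have wle1 s : \prod_(w <- s) pmf p w <= 1.
  elim: s => [|w s ih]; first by rewrite big_nil.
  have w1' : pmf p w <= 1.
    by have h := sum_pmf_le1 p (s := [:: w]) isT; rewrite big_seq1 in h.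
  by rewrite big_cons mulr_ile1 // prod_weight_ge0.
have wge0 s : 0 <= \prod_(w <- s) pmf p w by exact: prod_weight_ge0.
have cmin_le i r : cmin <= \prod_(w <- f i r) pmf p w.
  rewrite /cmin (bigD1 i) //= (bigD1 r) //= -mulrA ler_piMr //.
  have P0 (j : J) (P : pred 'I_g.+1) : 0 <= \prod_(r | P r) \prod_(w <- f j r) pmf p w <= 1.
    rewrite prodr_ge0 ?prodr_ile1 // => u _; rewrite wge0 wle1 //.
  have [/andP[a1 b1] P1] := (P0 i (predC1 r), P0 ^~ xpredT).
  apply: mulr_ile1 => //; first by apply: prodr_ge0 => j _; case/andP: (P1 j).
  by apply: prodr_ile1 => j _; exact: P1.
pose smax := (\sum_(i : J) \sum_(r : 'I_g.+1) \sum_(w <- f i r) size w)%N.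
have fw n i r : (smax <= n)%N -> all (mem (words p n)) (f i r).
  move=> sn; apply/allP => w wf; rewrite /= mem_words (allP (fs i r) _ wf) andbT.
  apply: leq_trans sn; rewrite /smax (bigD1 i) //= (bigD1 r) //= (big_rem w) //=.
  by rewrite -!addnA leq_addr.
have nJ : 0 < (#|J|)%:R :> R by rewrite ltr0n; apply/card_gt0P; exists (ord0, ord0).
exists (c * cmin / #|J|%:R); first by rewrite divr_gt0 // mulr_gt0.
pose B := mu * M0.+1%:R + 8 * C + 1.
exists (maxn smax (maxn (size w0 + size w1 + size w2) (Num.truncn B).+1)) => k.
set n := (a + D * k)%N; rewrite !geq_max => /and3P[ns nw nB].
have BnR : B < n%:R by rewrite (lt_le_trans (truncnS_gt _)) // ler_nat.
have M1 : 0 <= mu * M0.+1%:R by rewrite mulr_ge0 // ltW.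
have nR1 : 1 < n%:R :> R by apply: le_lt_trans BnR; rewrite /B; lra.
have nR : 0 < n%:R :> R by exact: lt_trans nR1.
have n0 : (0 < n)%N by rewrite -(ltr0n R).
have [[S0 S1 S2] [S3 S4] _] := HC n n0.
have qs := sum_pmf_le1 p (uniq_words p n).
(* The single length used: the mean weight [m * mu] is within [mu] of [n]. *)
pose m := Num.truncn (n%:R / mu).
have nmu : 0 <= n%:R / mu by rewrite divr_ge0 // ltW.
have /andP[m1 m2] := truncn_itv nmu; rewrite -/m in m1 m2.
rewrite ler_pdivlMr // in m1; rewrite ltr_pdivrMr // -natr1 mulrDl mul1r in m2.
have mn : m%:R <= n%:R :> R by apply: le_trans m1; rewrite ler_peMr.
have Mm : (M0 <= m)%N.
  rewrite -ltnS -(ltr_nat R) -(ltr_pM2l mu0); apply: (@lt_trans _ _ n%:R).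
    by apply: le_lt_trans BnR; rewrite /B -natr1; nra.
  by rewrite -natr1; lra.
have m0 : (0 < m)%N.
  rewrite lt0n; apply/eqP => m0; move: m2; rewrite m0 mul0r add0r => m2.
  by move: (lt_trans BnR m2); rewrite /B -natr1; have := ler0n R M0; nra.
have m0R : 0 < m%:R :> R by rewrite ltr0n.
have ww w : 0 < pmf p w -> (size w <= size w0 + size w1 + size w2)%N -> w \in words p n.
  by move=> pw sw; rewrite mem_words pw (leq_trans sw).
have mle (u : R) : 0 <= u -> n%:R * u <= C -> m%:R * u <= K.
  move=> u0 nu; apply: (@le_trans _ _ C); first exact: le_trans (ler_wpM2r u0 mn) nu.
  by rewrite /K; lra.
have mass : m%:R * (1 - \sum_(w <- words p n) pmf p w) <= 8^-1.
  have u0 : 0 <= 1 - \sum_(w <- words p n) pmf p w by rewrite subr_ge0.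
  apply: le_trans (ler_wpM2r u0 mn) _; apply: (le_trans (ler_wpM2l (ltW nR) S0)).
  have -> : n%:R * (C / n%:R ^+ 2) = C / n%:R by field; rewrite gt_eqF.
  by rewrite ler_pdivrMr // mulrC -ler_pdivrMr ?invr_gt0 // invrK mulrC ltW // (le_lt_trans _ BnR) // /B; lra.
(* The endpoint needed after a fixer, chosen by the residue of the list, has been put in front. *)
pose T (i : J) : int * int := (-1, n%:Z) - displacement (f i (residue g n%:Z)).
have TK i : `|(T i).1%:~R : R| <= K /\ `|(T i).2%:~R - m%:R * mu| <= K.
  have vi := vmax_ge i (residue g n%:Z).
  set v1 := (displacement _).1 in vi; set v2 := (displacement _).2 in vi.
  have -> : (T i).1%:~R = - 1 - v1%:~R :> R by rewrite (_ : (T i).1 = - 1 - v1) // intrB mulrNz.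
  have -> : (T i).2%:~R = n%:R - v2%:~R :> R by rewrite (_ : (T i).2 = n%:Z - v2) // intrB.
  have := normr_ge0 (v1%:~R : R); have := normr_ge0 (v2%:~R : R) => a2 a1.
  split.
    apply: le_trans (ler_normB _ _) _; rewrite normrN normr1 /K; lra.
  rewrite addrAC; apply: le_trans (ler_normB _ _) _.
  have -> : `|n%:R - m%:R * mu| = n%:R - m%:R * mu by rewrite ger0_norm // subr_ge0.
  rewrite /K; lra.
have Tres s : all (mem (words p n)) s -> size s = m -> exists x y : int,
    T (residue2 g (displacement s)) = displacement s + (g.+1%:Z * x, g.+1%:Z * y).
  move=> /supported_words /(ff s k)[x [y e]] _.
  exists (- x), (- y); rewrite /T -/n in e *; rewrite !mulrN.
  have -> : (-1, n%:Z) = (-1 + g.+1%:Z * x, n%:Z + g.+1%:Z * y) + (- (g.+1%:Z * x), - (g.+1%:Z * y)).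
    by rewrite pair_addE /= !addrK.
  by rewrite -e addrAC addrK.
have H : c / m%:R <= \sum_i lsum (words p n) (pmf p) m (fun s => (displacement s == T i)%:R).
  have ww0 : w0 \in words p n by apply: ww; rewrite // -addnA leq_addr.
  have ww1 : w1 \in words p n by apply: ww; rewrite // -addnA addnCA leq_addr.
  have ww2 : w2 \in words p n by apply: ww; rewrite // leq_addl.
  exact: (HM m (words p n) mu Mm (uniq_words p n) ww0 ww1 ww2 qs mass
    (mle _ (normr_ge0 _) S1) (mle _ (normr_ge0 _) S2) S3 S4 J (residue2 g) T TK Tres).
have tp : 0 <= tree_prob p n xpredT.
  by apply: sumr_ge0 => j _; exact: lsum_ge0.
have each i : lsum (words p n) (pmf p) m (fun s => (displacement s == T i)%:R) <=
    n%:R * tree_prob p n xpredT / cmin.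
  rewrite ler_pdivlMr // mulrC; set fi := f i (residue g n%:Z).
  apply: le_trans (lsum_hit_le_tree_prob n (size fi + m)).
  apply: le_trans (lsum_prefix_le q0 m _ (fw n i (residue g n%:Z) ns) (uniq_words p n)); last first.
    by move=> s.
  rewrite -/fi; apply: ler_pM; rewrite ?lsum_ge0 ?(ltW cmin0) ?cmin_le //.
  apply: le_lsum => // s _ _; rewrite ler_nat displacement_cat /T.
  by case: (displacement s =P _) => [->|//]; rewrite -/fi addrC subrK eqxx.
have {}H : c / m%:R <= #|J|%:R * (n%:R * tree_prob p n xpredT / cmin).
  apply: le_trans H _; apply: (@le_trans _ _ (\sum_(i : J) (n%:R * tree_prob p n xpredT / cmin))).
    by apply: ler_sum => i _; exact: each.
  by rewrite sumr_const -[leLHS]mulr_natl.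
rewrite ler_pdivrMr ?exprn_gt0 //.
have h1 : c / n%:R <= c / m%:R by rewrite ler_wpM2l ?(ltW c0) // lef_pV2 ?posrE.
have h2 := le_trans h1 H.
rewrite ler_pdivrMr // in h2.
have h3 : c * cmin <= #|J|%:R * (n%:R * tree_prob p n xpredT) * n%:R.
  rewrite -ler_pdivlMr //; apply: (le_trans h2).
  by rewrite le_eqVlt; apply/orP; left; apply/eqP; field; rewrite gt_eqF.
rewrite ler_pdivrMr // (le_trans h3) // le_eqVlt; apply/orP; left; apply/eqP; ring.
Qed.

End tree_prob_lower.

(** * The limit tree *)

Section extinction.
Context {R : realType} (p : probability word R).
Hypothesis hcrit : 'E_p[fun w => (xi w)%:R]%E = 1%E.
Hypothesis hvar_xi : (fun w : word => (xi w)%:R : R) \in Lfun p 2%:E.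
Hypothesis hvar_zeta : (fun w : word => (zeta w)%:R : R) \in Lfun p 2%:E.
Hypothesis hxi2 : (0 < p [set w | (2 <= xi w)%N])%E.

Definition grown_type (t : tree) : bool := valid_tree t && (root_type t == type1).

Fixpoint forests (TL : seq tree) (w : word) : seq (seq tree) :=
  if w is g :: w' then
    [seq t :: ts | t <- if g is type1 then TL else [:: leaf type2], ts <- forests TL w']
  else [:: [::]].

(** One generation more: the total weight of these trees is the truncated generating function of
    [xi] at the total weight of [TL]. *)
Definition trees_above (N : nat) (TL : seq tree) : seq tree :=
  flatten [seq map (Node type1) (forests TL w) | w <- words p N].

Lemma mem_forests TL w ts : all grown_type TL -> ts \in forests TL w ->
  all valid_tree ts /\ map root_type ts = w.
Proof.
move=> gTL; elim: w ts => [|g w ih] ts /=; first by rewrite inE => /eqP->.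
move=> /allpairsP[[t us] /= [tg /ih[vus rus] ->]] /=; rewrite vus rus andbT.
case: g tg => [/(allP gTL)/andP[-> /eqP->] //|]; by rewrite inE => /eqP->.
Qed.

Lemma uniq_forests TL w : uniq TL -> uniq (forests TL w).
Proof.
move=> uTL; elim: w => //= g w ih; apply: allpairs_uniq => //; first by case: g.
by move=> [t us] [t' us'] _ _ /= [-> ->].
Qed.

Lemma sum_forests TL w :
  \sum_(ts <- forests TL w) \prod_(t <- ts) tree_weight p t = (\sum_(t <- TL) tree_weight p t) ^+ xi w.
Proof.
elim: w => [|g w ih]; first by rewrite big_seq1 big_nil expr0.
rewrite [forests _ _]/= big_allpairs_dep.
rewrite (eq_bigr (fun t => tree_weight p t * (\sum_(t <- TL) tree_weight p t) ^+ xi w)); last first.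
  by move=> t _; rewrite -ih mulr_sumr; apply: eq_bigr => ts _; rewrite big_cons.
rewrite -mulr_suml; case: g; first by rewrite -exprS.
by rewrite big_seq1 /tree_weight /= big_nil mul1r.
Qed.

Lemma tree_weight_Node ts : tree_weight p (Node type1 ts) =
  pmf p (map root_type ts) * \prod_(t <- ts) tree_weight p t.
Proof. by rewrite /tree_weight /= big_cons big_flatten big_map. Qed.

Lemma trees_above_grown N TL : all grown_type TL -> all grown_type (trees_above N TL).
Proof.
move=> gTL; apply/allP => t /flatten_mapP[w _] /mapP[ts /(mem_forests gTL)[vts _] ->].
by rewrite /grown_type /= vts.
Qed.

Lemma trees_above_uniq N TL : all grown_type TL -> uniq TL -> uniq (trees_above N TL).
Proof.
move=> gTL uTL; rewrite /trees_above; elim: (words p N) (uniq_words p N) => //= w ws ih /andP[nw uws].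
rewrite cat_uniq ih // andbT map_inj_uniq ?uniq_forests //=; last by move=> ? ? [].
apply/hasPn => t /flatten_mapP[w' w'ws] /mapP[ts /(mem_forests gTL)[_ e] ->].
apply/mapP => -[ts' /(mem_forests gTL)[_ e'] [ee]].
by move: nw; rewrite -e' -ee e w'ws.
Qed.

Lemma sum_trees_above N TL : all grown_type TL ->
  \sum_(t <- trees_above N TL) tree_weight p t =
  \sum_(w <- words p N) pmf p w * (\sum_(t <- TL) tree_weight p t) ^+ xi w.
Proof.
move=> gTL; rewrite big_flatten big_map; apply: eq_bigr => w _.
rewrite big_map -sum_forests mulr_sumr big_seq [RHS]big_seq; apply: eq_bigr => ts tsw.
by rewrite tree_weight_Node (mem_forests gTL tsw).2.
Qed.

(** Strict convexity in quantitative form: exponents at least 2 gain [u ^+ 2] over the tangent line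
    at 1. *)
Lemma pow_convex (u : R) k : 0 <= u <= 1 ->
  1 - k%:R * u + (2 <= k)%N%:R * u ^+ 2 <= (1 - u) ^+ k.
Proof.
move=> /andP[u0 u1]; case: k => [|[|k]]; rewrite ?mul0r ?mul1r ?subr0 ?addr0 ?expr0 ?expr1 //=.
elim: k => [|k ih]; first by rewrite expr2; nra.
rewrite exprS; have h1 : 0 <= 1 - u by lra.
have h2 := ler_wpM2l h1 ih.
have h3 : 0 <= u ^+ 2 * (k.+1%:R + (1 - u)).
  by apply: mulr_ge0; [exact: sqr_ge0|exact: addr_ge0 (ler0n _ _) h1].
apply: le_trans h2; rewrite -subr_ge0; apply: le_trans h3 _.
rewrite le_eqVlt; apply/orP; left; apply/eqP.
by rewrite -[k.+3%:R]natr1 -[k.+2%:R]natr1; ring.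
Qed.

(** A critical tree with P(xi >= 2) > 0 is almost surely finite. While the total weight is below
    [1 - eta], one more generation increases it by at least [c]: convexity gains [2 * c] and
    truncation loses at most [c]. Hence finitely many generations suffice. *)
Lemma extinction (eta : R) : 0 < eta -> exists TL : seq tree,
  [/\ all grown_type TL, uniq TL & 1 - eta <= \sum_(t <- TL) tree_weight p t].
Proof.
move=> eta0; have [C C0 HC] := words_moments hcrit hvar_xi hvar_zeta.
have [w2 w2xi w20] := measure_gt0_word hvar_xi hvar_zeta hxi2.
pose c := pmf p w2 * eta ^+ 2 / 2.
have c0 : 0 < c by rewrite divr_gt0 // mulr_gt0 // exprn_gt0.
pose N := maxn (size w2) (Num.truncn (C / c)).+1.
have N0 : (0 < N)%N by rewrite leq_max orbT.
have NC : C / c < N%:R by rewrite (lt_le_trans (truncnS_gt _)) // ler_nat leq_maxr.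
have NR : 1 <= N%:R :> R by rewrite ler1n.
have CN : C / N%:R ^+ 2 <= c.
  rewrite ler_pdivrMr ?exprn_gt0 ?ltr0n //.
  rewrite ltr_pdivrMr // in NC; apply: (le_trans (ltW NC)).
  by rewrite mulrC ler_wpM2l ?(ltW c0) // expr2 ler_peMl.
have [[S0 _ _] _ [_ _ _ _]] := HC N N0.
have qs := sum_pmf_le1 p (uniq_words p N).
have Sxi : \sum_(w <- words p N) pmf p w * (xi w)%:R <= 1.
  exact: (integral_seq_le (uniq_words p N) _ (integral_xi hcrit)).
have S2 : pmf p w2 <= \sum_(w <- words p N) pmf p w * (2 <= xi w)%N%:R.
  rewrite (bigD1_seq w2) ?uniq_words ?mem_words ?w20 ?leq_maxl //= w2xi mulr1 lerDl.
  by rewrite sumr_ge0 // => w _; rewrite mulr_ge0 ?pmf_ge0.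
have grow k : (exists TL, [/\ all grown_type TL, uniq TL & 1 - eta <= \sum_(t <- TL) tree_weight p t])
    \/ (exists TL, [/\ all grown_type TL, uniq TL & k%:R * c <= \sum_(t <- TL) tree_weight p t]).
  elim: k => [|k [?|[TL [gTL uTL kTL]]]]; [|by left|].
    by right; exists [::]; rewrite big_nil mul0r.
  set rho := \sum_(t <- TL) _ in kTL; case: (leP (1 - eta) rho) => h; first by left; exists TL.
  right; exists (trees_above N TL); split; [exact: trees_above_grown|exact: trees_above_uniq|].
  rewrite sum_trees_above // -/rho.
  have rho0 : 0 <= rho by apply: sumr_ge0 => t _; exact: tree_weight_ge0.
  pose u := 1 - rho; have u01 : 0 <= u <= 1 by rewrite /u; apply/andP; split; lra.
  have ueta : eta < u by rewrite /u; lra.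
  apply: (@le_trans _ _ (\sum_(w <- words p N) (pmf p w - u * (pmf p w * (xi w)%:R) +
     u ^+ 2 * (pmf p w * (2 <= xi w)%N%:R)))); last first.
    apply: ler_sum => w _; have := ler_wpM2l (pmf_ge0 p w) (pow_convex (xi w) u01).
    rewrite (_ : 1 - u = rho); last by rewrite /u; lra.
    by apply: le_trans; rewrite le_eqVlt; apply/orP; left; apply/eqP; ring.
  rewrite big_split sumrB /= -!mulr_sumr -natr1 mulrDl mul1r.
  have h1 : u * \sum_(w <- words p N) pmf p w * (xi w)%:R <= u.
    by case/andP: u01 => u0 _; rewrite ler_piMr.
  have h2 : 2 * c <= u ^+ 2 * \sum_(w <- words p N) pmf p w * (2 <= xi w)%N%:R.
    apply: (@le_trans _ _ (eta ^+ 2 * pmf p w2)).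
      by rewrite /c le_eqVlt; apply/orP; left; apply/eqP; field.
    case/andP: u01 => u0 _.
    apply: ler_pM => //; [exact: sqr_ge0|exact: pmf_ge0|].
    by rewrite lerXn2r ?nnegrE ?(ltW eta0) ?(ltW ueta).
  have uE : u = 1 - rho by []. clearbody u. lra.
pose k := (Num.truncn (c^-1)).+1.
case: (grow k) => // -[TL [gTL uTL kTL]]; exists TL; split=> //.
apply: le_trans kTL; apply: (@le_trans _ _ 1); first by lra.
by rewrite -ler_pdivrMr // mul1r ltW // truncnS_gt.
Qed.

End extinction.

(** * Almost sure properties and finite patterns of the limit tree *)

(** Handles properties not known to be measurable: outcomes failing [A] lie outside all the events
    [E n], and the intersection of their complements is null. *)
Lemma ae_of_lower d (T : measurableType d) (R : realType) (P : probability T R) (A : T -> Prop) :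
  (forall e : R, 0 < e -> exists E, [/\ measurable E, E `<=` A & ((1 - e)%:E <= P E)%E]) ->
  \forall x \ae P, A x.
Proof.
move=> H.
have e0 n : 0 < n.+1%:R^-1 :> R by rewrite invr_gt0.
have [E HE] := choice (fun n : nat => H _ (e0 n)).
have mE n : measurable (E n) by have [] := HE n.
have mB : measurable (\bigcap_n ~` E n) by apply: bigcapT_measurable => n; exact: measurableC.
exists (\bigcap_n ~` E n); split=> //.
  apply/eqP; rewrite eq_le measure_ge0 andbT; apply/lee_addgt0Pr => e ep; rewrite add0e.
  have [n _ ne] := (near_infty_natSinv_lt (PosNum ep)).
  have {}ne := ne n (leqnn n); rewrite /= in ne.
  apply: (@le_trans _ _ (P (~` E n))).
    by apply: le_measure; rewrite ?inE //; [exact: measurableC|exact: bigcap_inf].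
  rewrite probability_setC // leeBlDr ?fin_num_measure //.
  have [_ _ h] := HE n; apply: (@le_trans _ _ (e%:E + (1 - n.+1%:R^-1)%:E)%E); last exact: leeD2l.
  have ne' : n.+1%:R^-1 < e := ne.
  by rewrite -EFinD lee_fin addrCA lerDl subr_ge0 ltW.
by move=> x nA n _ En; apply: nA; have [_ + _] := HE n; apply.
Qed.

Lemma independent_sub d (Om : measurableType d) (R : realType) (P : probability Om R)
    (I J : Type) (F : I -> set_system Om) (phi : J -> I) :
  injective phi -> mutually_independent P F -> mutually_independent P (F \o phi).
Proof.
by move=> inj ind n i E injE FE; apply: (ind n (phi \o i)) => //; exact: inj_comp.
Qed.

Lemma measurable_pair1 (wk : word * nat) : measurable [set wk].
Proof.
case: wk => w k; rewrite (_ : [set (w, k)] = [set w] `*` [set k]); first exact: measurableX.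
by apply/seteqP; split=> [[a b] [-> ->]|[a b] [/= -> ->]].
Qed.

(** The default value of [nth] in the laws of the marked pieces; it differs from the type of the
    mark. *)
Definition other (g : gtype) : gtype := if g is type1 then type2 else type1.

Section limit_law.
Context {R : realType} (p : probability word R).
Hypothesis hcrit : 'E_p[fun w => (xi w)%:R]%E = 1%E.
Hypothesis hvar_xi : (fun w : word => (xi w)%:R : R) \in Lfun p 2%:E.
Hypothesis hvar_zeta : (fun w : word => (zeta w)%:R : R) \in Lfun p 2%:E.
Hypothesis hxi2 : (0 < p [set w | (2 <= xi w)%N])%E.
Hypothesis hline : ~ support_on_line p.
Context d (Om : measurableType d) (P : probability Om R).

Lemma finite_tree_ae (sigma : seq nat -> {RV P >-> word}) : iid_copies p sigma ->
  \forall omega \ae P, exists t, branching_tree (fun v => sigma v omega) = Some t.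
Proof.
move=> iid; apply: ae_of_lower => e e0.
have [TL [gTL uTL sTL]] := extinction hcrit hvar_xi hvar_zeta hxi2 e0.
pose E t := [set omega | branching_tree (fun v => sigma v omega) = Some t].
exists (\bigcup_(t in [set` TL]) E t); split.
- apply: fin_bigcup_measurable; first exact: finite_seq.
  by move=> t _; exact: measurable_tree_event.
- by move=> omega [t _ Et]; exists t.
rewrite measure_fin_bigcup //.
- rewrite -fsbig_seq //; apply: (@le_trans _ _ (\sum_(t <- TL) (tree_weight p t)%:E)%E).
    by rewrite sumEFin lee_fin.
  rewrite big_seq [leRHS]big_seq; apply: lee_sum => t /(allP gTL)/andP[vt /eqP t1].
  by rewrite -(tree_event_prob iid vt t1).
- exact: finite_seq.
- by move=> t t' _ _ [omega []]; rewrite /E /= => -> [].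
- by move=> t _; exact: measurable_tree_event.
Qed.

(** The law is prescribed only at admissible marks. Since [z] is the mean number of letters [g],
    these already carry mass 1, so nothing else has positive probability. *)
Lemma marked_ae (g : gtype) (z : R) (X : {RV P >-> (word * nat)%type}) : 0 < z ->
  (forall w k, (k < size w)%N -> nth (other g) w k = g ->
    P (X @^-1` [set (w, k)]) = (pmf p w / z)%:E) ->
  (forall e : R, 0 < e -> exists n,
    z * (1 - e) <= \sum_(w <- words p n) pmf p w * (count_mem g w)%:R) ->
  \forall omega \ae P, ((X omega).2 < size (X omega).1)%N /\
    nth (other g) (X omega).1 (X omega).2 = g.
Proof.
move=> z0 Xlaw sums; apply: ae_of_lower => e e0; have [n hn] := sums e e0.
pose S := [seq (w, k) | w <- words p n, k <- [seq k <- iota 0 (size w) | nth (other g) w k == g]].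
have memS w k : (w, k) \in S -> (k < size w)%N /\ nth (other g) w k = g.
  move=> /allpairsPdep[w' [k' [_ + [-> ->]]]].
  by rewrite mem_filter mem_iota add0n => /andP[/eqP-> /andP[_ ->]].
have uS : uniq S.
  apply: allpairs_uniq_dep; first exact: uniq_words.
    by move=> w _; apply: filter_uniq; exact: iota_uniq.
  by move=> [w k] [w' k'] _ _ /= [-> ->].
have mX wk : measurable (X @^-1` [set wk]).
  by apply: measurable_preimage; exact: measurable_pair1.
exists (\bigcup_(wk in [set` S]) X @^-1` [set wk]); split.
- by apply: fin_bigcup_measurable => //; exact: finite_seq.
- by move=> omega [[w k] /= /memS[h1 h2] ->].
rewrite measure_fin_bigcup //.
- rewrite -fsbig_seq // (eq_big_seq (fun wk => (pmf p wk.1 / z)%:E)) => [|[w k] /memS[h1 h2]]; last first.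
    exact: Xlaw.
  rewrite sumEFin lee_fin -mulr_suml ler_pdivlMr // mulrC (le_trans hn) //.
  rewrite big_allpairs_dep le_eqVlt; apply/orP; left; apply/eqP.
  apply: eq_bigr => w _; rewrite /= big_const_seq iter_addr_0 -[RHS]mulr_natr; congr (_ * _%:R).
  rewrite count_predT size_filter -{1}(mkseq_nth (other g) w) /mkseq count_map.
  by apply: eq_count => k.
- exact: finite_seq.
- by move=> wk wk' _ _ [omega [/= <- <-]].
Qed.

(** Otherwise the support would lie on the line where [zeta] vanishes. *)
Lemma mean_zeta_gt0 : 0 < mean_zeta p.
Proof.
have [|w w0 wz] := support_not_on_line hvar_xi hvar_zeta hline (al := 0) (be := 1) 0.
  by rewrite xpair_eqE oner_eq0 andbF.
have h := @integral_seq_le _ p [:: w] (fun w => (zeta w)%:R) _ isT _ (integral_zeta hvar_zeta).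
rewrite big_seq1 in h; apply: lt_le_trans (h _) => //.
by rewrite mulr_gt0 // lt_neqAle ler0n andbT eq_sym; move: wz; rewrite mul0r add0r mul1r.
Qed.

Lemma sum_types (g : gtype) (e : R) : 0 < e -> exists n,
  (if g is type1 then 1 else mean_zeta p) * (1 - e) <=
    \sum_(w <- words p n) pmf p w * (count_mem g w)%:R.
Proof.
move=> e0; have [C C0 HC] := words_moments hcrit hvar_xi hvar_zeta.
have z0 := mean_zeta_gt0; set z := mean_zeta p in z0 *.
pose n := (Num.truncn (C / e + C / (z * e))).+1; exists n.
have h1 : 0 <= C / e by rewrite divr_ge0 // ltW.
have h2 : 0 <= C / (z * e) by rewrite divr_ge0 // ltW // mulr_gt0.
have hn : C / e + C / (z * e) < n%:R by exact: truncnS_gt.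
have n0 : 0 < n%:R :> R by rewrite ltr0n.
have [_ _ [_ _ S1 S2]] := HC n (ltn0Sn _).
have sq : \sum_(w <- words p n) pmf p w <= 1 by exact: sum_pmf_le1 (uniq_words p n).
case: g.
  rewrite mul1r; apply: le_trans S1; rewrite lerD2l lerN2 ler_pdivrMr // mulrC -ler_pdivrMr //.
  by rewrite ltW // (le_lt_trans _ hn) // lerDl.
have -> : \sum_(w <- words p n) pmf p w * (count_mem type2 w)%:R =
    \sum_(w <- words p n) pmf p w * (zeta w).+1%:R - \sum_(w <- words p n) pmf p w.
  by rewrite -sumrB; apply: eq_bigr => w _; rewrite -natr1 mulrDr mulr1 addrK.
have : C / n%:R <= z * e.
  by rewrite ler_pdivrMr // mulrC -ler_pdivrMr ?mulr_gt0 // ltW // (le_lt_trans _ hn) // lerDr.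
by move: S2; rewrite /mean_weight -/z; lra.
Qed.

End limit_law.

HB.instance Definition _ := gen_eqMixin part.

Section limit_ball.
Context {R : realType} (p : probability word R).
Hypothesis hcrit : 'E_p[fun w => (xi w)%:R]%E = 1%E.
Hypothesis hvar_xi : (fun w : word => (xi w)%:R : R) \in Lfun p 2%:E.
Hypothesis hvar_zeta : (fun w : word => (zeta w)%:R : R) \in Lfun p 2%:E.
Hypothesis hxi2 : (0 < p [set w | (2 <= xi w)%N])%E.
Hypothesis hline : ~ support_on_line p.
Context d (Om : measurableType d) (P : probability Om R) (L : limit_parts P p).

(** On these outcomes, which have probability one by [regular_ae], the default values in [hanging]
    for infinite copies and marks out of range do not intervene. *)
Definition regular (omega : Om) : Prop :=
  (forall i j, exists t, branching_tree (fun v => copy L i (j :: v) omega) = Some t) /\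
  (forall i, let: (w, k) := piece L i omega in (k < size w)%N /\
     nth type2 w k = if i is 0 then Defs.eta L omega else type1).

Lemma copies_iid i j : iid_copies p (fun v => copy L i (j :: v)).
Proof.
split=> [v A|]; first exact: copy_law.
have inj : injective (fun v => Copy i (j :: v)) by move=> v v' [].
exact: (independent_sub inj (@parts_indep _ _ _ _ _ L)).
Qed.

Lemma regular_ae : \forall omega \ae P, regular omega.
Proof.
have z0 := mean_zeta_gt0 hvar_xi hvar_zeta hline.
have sums g := sum_types hcrit hvar_xi hvar_zeta hline g.
have b1 := marked_ae ltr01 (X := base L type1) (g := type1)
  (fun w k h1 h2 => etrans (base_law1 L h1 h2) (etrans (pmfE p w) (congr1 EFin (esym (divr1 _)))))
  (sums type1).
have b2 := marked_ae z0 (X := base L type2) (g := type2) (fun w k h1 h2 => base_law2 L h1 h2)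
  (sums type2).
have sp i := marked_ae ltr01 (X := spine L i) (g := type1)
  (fun w k h1 h2 => etrans (spine_law L i h1 h2) (etrans (pmfE p w) (congr1 EFin (esym (divr1 _)))))
  (sums type1).
have fin i j := finite_tree_ae hcrit hvar_xi hvar_zeta hxi2 (copies_iid i j).
have {}sp := ae_foralln sp.
have {}fin : \forall omega \ae P, forall i j,
    exists t, branching_tree (fun v => copy L i (j :: v) omega) = Some t.
  by apply: ae_foralln => i; exact: ae_foralln.
near=> omega.
have B1 : (((base L type1) omega).2 < size ((base L type1) omega).1)%N /\
    nth type2 ((base L type1) omega).1 ((base L type1) omega).2 = type1 by near: omega.
have B2 : (((base L type2) omega).2 < size ((base L type2) omega).1)%N /\
    nth type1 ((base L type2) omega).1 ((base L type2) omega).2 = type2 by near: omega.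
have SP : forall i, (((spine L i) omega).2 < size ((spine L i) omega).1)%N /\
    nth type2 ((spine L i) omega).1 ((spine L i) omega).2 = type1 by near: omega.
split; first by near: omega.
case=> [|i] /=; last by have := SP i; case: (spine L i omega).
case: (Defs.eta L omega); first by move: B1; case: (base L type1 omega).
move: B2; case: (base L type2 omega) => w k /= [h1 h2]; split => //.
by rewrite (set_nth_default type1).
Unshelve. all: by end_near. Qed.

Section one_outcome.
Variable omega : Om.
Hypothesis reg : regular omega.
Let w i := (piece L i omega).1.
Let k i := (piece L i omega).2.

Lemma regular_lt i : (k i < size (w i))%N.
Proof. by have := reg.2 i; rewrite /k /w; case: (piece L i omega) => ? ? []. Qed.

Lemma regular_type i : nth type2 (w i) (k i) = if i is 0 then Defs.eta L omega else type1.
Proof. by have := reg.2 i; rewrite /k /w; case: (piece L i omega) => ? ? []. Qed.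

Lemma hanging_grown i j : valid_tree (hanging L i omega j) /\
  root_type (hanging L i omega j) = nth type2 (w i) j.
Proof.
rewrite /hanging -/(w i); case: (nth type2 (w i) j) => //.
have [t e] := reg.1 i j; rewrite e /=.
by have /branching_treeE g := e; split; [exact: grown_valid g|exact: g.1].
Qed.

Lemma hanging_branching i j : nth type2 (w i) j = type1 ->
  branching_tree (fun v => copy L i (j :: v) omega) = Some (hanging L i omega j).
Proof. by rewrite /hanging -/(w i) => ->; have [t ->] := reg.1 i j. Qed.

Lemma spine_contextE i : spine_context L omega i =
  Context type1 (map (hanging L i omega) (iota 0 (k i)))
    (map (hanging L i omega) (iota (k i).+1 (size (w i) - (k i).+1))).
Proof. by rewrite /spine_context /k /w; case: (piece L i omega). Qed.

Let s := hanging L 0 omega (k 0).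

Lemma iota_split m n : (m < n)%N -> iota 0 n = iota 0 m ++ m :: iota m.+1 (n - m.+1).
Proof. by move=> mn; rewrite -{1}(subnKC mn) iotaD add0n -[in iota 0 m.+1]addn1 iotaD -catA. Qed.

Lemma plug_spine h : let T := plug s (mkseq (spine_context L omega) h) in
  [/\ valid_tree T, root_type T = (if h is 0 then nth type2 (w 0) (k 0) else type1) &
  tree_weight p T = (\prod_(i < h) (pmf p (w i) *
    \prod_(j <- iota 0 (size (w i)) | j != k i) tree_weight p (hanging L i omega j)))
    * tree_weight p s].
Proof.
elim: h => [|h [vT rT wT]]; first by rewrite big_ord0 mul1r /=; have [] := hanging_grown 0 (k 0).
rewrite /mkseq -addn1 iotaD map_cat /= cats1 -/(mkseq _ h) add0n.
set T := plug s (mkseq _ h) in vT rT wT *.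
rewrite spine_contextE plug_rcons -/T.
have rT' : root_type T = nth type2 (w h) (k h) by rewrite rT; case: (h) => [//|h']; rewrite (regular_type h'.+1).
have types : map root_type (map (hanging L h omega) (iota 0 (k h)) ++
    T :: map (hanging L h omega) (iota (k h).+1 (size (w h) - (k h).+1))) = w h.
  rewrite map_cat /= -!map_comp rT' -[RHS](mkseq_nth type2) /mkseq (iota_split (regular_lt h)).
  by rewrite map_cat /=; congr (_ ++ _ :: _); apply: eq_map => j /=; have [] := hanging_grown h j.
split.
- rewrite /= all_cat /= vT; apply/andP; split; first by apply/allP => _ /mapP[j _ ->]; have [] := hanging_grown h j.
  by apply/allP => _ /mapP[j _ ->]; have [] := hanging_grown h j.
- by [].
- rewrite tree_weight_Node types big_cat big_cons /= !big_map addn1 big_ord_recr /= wT.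
  rewrite (iota_split (regular_lt h)) big_cat big_cons eqxx /=.
  have E1 : \prod_(j <- iota 0 (k h) | j != k h) tree_weight p (hanging L h omega j) =
      \prod_(j <- iota 0 (k h)) tree_weight p (hanging L h omega j).
    rewrite big_seq_cond [RHS]big_seq; apply: eq_bigl => j; rewrite mem_iota add0n.
    by move: (k h) (size (w h)) => x y; lia.
  have E2 : \prod_(j <- iota (k h).+1 (size (w h) - (k h).+1) | j != k h)
        tree_weight p (hanging L h omega j) =
      \prod_(j <- iota (k h).+1 (size (w h) - (k h).+1)) tree_weight p (hanging L h omega j).
    rewrite big_seq_cond [RHS]big_seq; apply: eq_bigl => j; rewrite mem_iota.
    by move: (k h) (size (w h)) => x y; lia.
  by rewrite E1 E2; ring.
Qed.

End one_outcome.

(** The number of left siblings gives the marked position, and the root types of the siblings give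
    the other letters. The marked letter is type 1 for i > 0 by regularity; at u_0 it is the type of
    the marked vertex, which also gives [eta]. *)
Lemma same_parts omega omega' h : regular omega -> regular omega' -> (0 < h)%N ->
  fringe_at h (limit_tree L omega) = fringe_at h (limit_tree L omega') ->
  Defs.eta L omega = Defs.eta L omega' /\
  forall i, (i < h)%N -> piece L i omega = piece L i omega' /\
    forall j, (j < size (piece L i omega').1)%N -> (j != (piece L i omega').2) || (i == 0%N) ->
      hanging L i omega j = hanging L i omega' j.
Proof.
move=> reg reg' h0 [es ec].
have ctx i : (i < h)%N -> spine_context L omega i = spine_context L omega' i.
  by move=> ih; have := congr1 (fun c => nth (Context type1 [::] [::]) c i) ec; rewrite !nth_mkseq.
have key i : (i < h)%N -> piece L i omega = piece L i omega' /\
    forall j, (j < size (piece L i omega').1)%N -> (j != (piece L i omega').2) || (i == 0%N) ->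
      hanging L i omega j = hanging L i omega' j.
  move=> ih; have := ctx i ih; rewrite !spine_contextE => -[e1 e2].
  have lt : ((piece L i omega).2 < size (piece L i omega).1)%N := regular_lt reg i.
  have lt' : ((piece L i omega').2 < size (piece L i omega').1)%N := regular_lt reg' i.
  have ek : (piece L i omega).2 = (piece L i omega').2.
    by have := congr1 size e1; rewrite !size_map !size_iota.
  have ew : size (piece L i omega).1 = size (piece L i omega').1.
    have := congr1 size e2; rewrite !size_map !size_iota -ek => e.
    by rewrite -(subnKC lt) e subnKC // ek.
  have hang j : (j < size (piece L i omega').1)%N -> (j != (piece L i omega').2) || (i == 0%N) ->
      hanging L i omega j = hanging L i omega' j.
    move=> jw; case: (ltngtP j (piece L i omega').2) => [jk|jk|jk].
    - move=> _; have := congr1 (fun l => nth (leaf type1) l j) e1.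
      by rewrite ek !(nth_map 0%N) ?size_iota // !nth_iota.
    - move=> _; have jj : (j - (piece L i omega').2.+1 < size (piece L i omega').1 - (piece L i omega').2.+1)%N.
        by rewrite ltn_sub2r // (leq_ltn_trans jk).
      have := congr1 (fun l => nth (leaf type1) l (j - (piece L i omega').2.+1)) e2.
      by rewrite ek ew !(nth_map 0%N) ?size_iota // !nth_iota // subnKC.
    - by move=> /= /eqP i0; rewrite jk -{1}ek i0; exact: es.
  split=> //.
  rewrite [LHS]surjective_pairing [RHS]surjective_pairing ek; congr pair.
  apply: (eq_from_nth (x0 := type2)) => // j jw; rewrite ew in jw.
  have [/hang H|] := boolP ((j != (piece L i omega').2) || (i == 0%N)).
    have [_ <-] := hanging_grown reg i j; rewrite H //.
    by have [] := hanging_grown reg' i j.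
  rewrite negb_or negbK => /andP[/eqP -> i0]; rewrite -{1}ek (regular_type reg) (regular_type reg').
  by case: (i) i0.
split=> //.
have [e0 _] := key 0%N h0.
by have := regular_type reg 0; rewrite e0 (regular_type reg' 0) => ->.
Qed.

Lemma ae_le_measure (E D : set Om) : measurable E -> measurable D ->
  (\forall omega \ae P, E omega -> D omega) -> (P E <= P D)%E.
Proof.
move=> mE mD [N [mN PN0 sub]].
have ED : E `<=` D `|` N.
  move=> omega Eo; have [Do|nD] := pselect (D omega); [by left|right].
  by apply: sub => /= H; exact: nD (H Eo).
apply: (le_trans (le_measure _ _ _ ED)); rewrite ?inE //; first exact: measurableU.
by have := measureU2 P mD mN; rewrite [X in (_ + X)%E]PN0 adde0.
Qed.

Section pattern_event.
Variables (om : Om) (h : nat).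
Hypothesis reg : regular om.
Let w i := (piece L i om).1.
Let k i := (piece L i om).2.
Let s := hanging L 0 om (k 0).

(** The children carrying a copy of T(1) that the pattern sees: those of type 1 off the spine,
    together with, at u_0 only, the marked child. *)
Definition free_children i := [seq j <- iota 0 (size (w i)) |
  (nth type2 (w i) j == type1) && ((j != k i) || (i == 0%N))].

(** The finitely many independent parts that a pattern of height [h.+1] fixes. [Spine i] belongs to
    u_{i+1}, so [h] of them are needed next to the base. *)
Definition pattern_parts : seq part :=
  Eta :: Base (Defs.eta L om) :: [seq Spine i | i <- iota 0 h] ++
  [seq Copy iv.1 iv.2 | iv <- [seq (i, v) | i <- iota 0 h.+1,
     v <- [seq j :: v | j <- free_children i, v <- internal (hanging L i om j)]]].

Definition part_event (c : part) : set Om :=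
  match c with
  | Eta => Defs.eta L @^-1` [set Defs.eta L om]
  | Base g => base L g @^-1` [set piece L 0 om]
  | Spine i => spine L i @^-1` [set piece L i.+1 om]
  | Copy i v => copy L i v @^-1` [set if v is j :: v' then word_at (hanging L i om j) v' else [::]]
  end.

Definition pattern_event : set Om := \bigcap_(c in [set` pattern_parts]) part_event c.

Lemma part_event_sigma c : match c with
    | Eta => sigma_of (Defs.eta L)
    | Base g => sigma_of (base L g)
    | Spine i => sigma_of (spine L i)
    | Copy i v => sigma_of (copy L i v)
    end (part_event c).
Proof.
by case: c => [|g|i|i v]; apply: sigma_of_preimage => //; exact: measurable_pair1.
Qed.

Lemma measurable_part_event c : measurable (part_event c).
Proof.
by case: c => [|g|i|i v]; apply: measurable_preimage => //; exact: measurable_pair1.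
Qed.

Lemma uniq_pattern_parts : uniq pattern_parts.
Proof.
rewrite /pattern_parts !cons_uniq in_cons negb_or !(mem_cat _ [seq Spine i | i <- iota 0 h]) !negb_or.
apply/and3P; split.
- apply/and3P; split; first by case: pselect.
    by apply/mapP => -[].
  by apply/mapP => -[].
- by apply/andP; split; apply/mapP => -[].
rewrite cat_uniq map_inj_uniq ?iota_uniq; last by move=> ? ? [].
rewrite map_inj_uniq; last by move=> [? ?] [? ?] /= [-> ->].
apply/and3P; split=> //.
  by apply/hasPn => _ /mapP[iv _ ->]; apply/mapP => -[].
apply: allpairs_uniq_dep; first exact: iota_uniq.
  move=> i _; apply: allpairs_uniq_dep; first by apply: filter_uniq; exact: iota_uniq.
    by move=> j _; apply: filter_uniq; exact: uniq_vertices.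
  by move=> [? ?] [? ?] _ _ /= [-> ->].
by move=> [? ?] [? ?] _ _ /= [-> ->].
Qed.

(** The two types give the same value: the factor E zeta in P(eta = 2) cancels the normalization of
    the marked tree of type 2. The mixture [eta] thus marks each child of the root with equal
    weight. *)
Lemma eta_base_prob :
  fine (P (part_event Eta)) * fine (P (part_event (Base (Defs.eta L om)))) = pmf p (w 0) / mean_weight p.
Proof.
have z0 := mean_zeta_gt0 hvar_xi hvar_zeta hline.
have lt : (k 0 < size (w 0))%N := regular_lt reg 0.
have ty : nth type2 (w 0) (k 0) = Defs.eta L om := regular_type reg 0.
have e : piece L 0 om = (w 0, k 0) by rewrite /w /k; case: (piece L 0 om).
rewrite /part_event e; case: (Defs.eta L om) ty => ty.
  rewrite eta_law1 (base_law1 L lt ty) /mean_weight /pmf /=.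
  by field; rewrite gt_eqF // addr_gt0.
rewrite eta_law2 (base_law2 L lt) ?(set_nth_default type2) // /mean_weight /pmf /=.
by field; rewrite !gt_eqF // addr_gt0.
Qed.

Lemma spine_prob i : fine (P (part_event (Spine i))) = pmf p (w i.+1).
Proof.
have e : piece L i.+1 om = (w i.+1, k i.+1) by rewrite /w /k; case: (piece L i.+1 om).
rewrite /= in e; rewrite /= e.
by rewrite (spine_law L i (regular_lt reg i.+1) (regular_type reg i.+1)).
Qed.

(** Each word in the code of the plugged tree is contributed by exactly one part, and the factor 1 /
    (1 + E zeta) comes from [eta]. The result is the limiting proportion of fringe copies of this
    tree. *)
Lemma pattern_event_prob :
  fine (P pattern_event) = tree_weight p (plug s (mkseq (spine_context L om) h.+1)) / mean_weight p.
Proof.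
rewrite /pattern_event (independent_seq (@parts_indep _ _ _ _ _ L) uniq_pattern_parts); last first.
  by move=> c _; exact: part_event_sigma.
rewrite !big_cons mulrA eta_base_prob big_cat !big_map big_allpairs_dep.
have [_ _ ->] := plug_spine reg h.+1.
have tw i j : tree_weight p (hanging L i om j) = if nth type2 (w i) j == type1 then
    \prod_(v <- internal (hanging L i om j)) pmf p (word_at (hanging L i om j) v) else 1.
  have [vt _] := hanging_grown reg i j; case: eqP => [_|]; first exact/esym/prod_internal.
  rewrite /hanging -/(w i); case: (nth type2 (w i) j) => // _.
  by rewrite /tree_weight /= big_nil.
have copies i : \prod_(v <- [seq j :: v | j <- free_children i, v <- internal (hanging L i om j)])
    fine (P (part_event (Copy i v))) =
    \prod_(j <- iota 0 (size (w i)) | (j != k i) || (i == 0%N)) tree_weight p (hanging L i om j).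
  rewrite big_allpairs_dep big_filter big_mkcondl; apply: eq_bigr => j _; rewrite tw.
  by case: ifP => // _; apply: eq_bigr => v _; rewrite /= copy_law.
rewrite (eq_bigr _ (fun i _ => copies i)) (eq_bigr _ (fun i _ => spine_prob i)).
rewrite -(big_mkord xpredT (fun i => pmf p (w i) *
  \prod_(j <- iota 0 (size (w i)) | j != k i) tree_weight p (hanging L i om j))).
rewrite /index_iota subn0 /= !big_cons -(addn0 1%N) iotaDl !big_map big_split /= eqxx.
have -> : \prod_(j <- iota 0 (size (w 0)) | (j != k 0) || true) tree_weight p (hanging L 0 om j) =
    tree_weight p s * \prod_(j <- iota 0 (size (w 0)) | j != k 0) tree_weight p (hanging L 0 om j).
  rewrite (eq_bigl xpredT) => [|j]; last by rewrite orbT.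
  by rewrite (bigD1_seq (k 0)) ?iota_uniq ?mem_iota ?add0n //; exact: regular_lt.
have free i : \prod_(j <- iota 0 (size (w (1 + i))) | (j != k (1 + i)) || ((1 + i)%N == 0%N))
      tree_weight p (hanging L (1 + i) om j) =
    \prod_(j <- iota 0 (size (w (1 + i))) | j != k (1 + i)) tree_weight p (hanging L (1 + i) om j).
  by apply: eq_bigl => j; rewrite orbF.
rewrite (eq_bigr _ (fun i _ => free i)) -/s.
by ring.
Qed.

Lemma in_pattern_event omega : regular omega ->
  fringe_at h.+1 (limit_tree L omega) = fringe_at h.+1 (limit_tree L om) ->
  pattern_event omega.
Proof.
move=> reg' e; have [eeta H] := same_parts reg' reg (ltn0Sn h) e.
move=> c; rewrite /= /pattern_parts !in_cons mem_cat => /or3P[/eqP->|/eqP->|/orP[]].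
- exact: eeta.
- by have [+ _] := H 0%N (ltn0Sn h); rewrite /= eeta.
- move=> /mapP[i + ->]; rewrite mem_iota add0n => ih.
  by have [e0 _] := H i.+1 ih; exact: e0.
move=> /mapP[_ /allpairsPdep[i [v [ih]]]] /allpairsPdep[j [v' [+ v'in ->]]] -> ->.
rewrite mem_filter !mem_iota !add0n in ih * => /andP[/andP[/eqP ty fr] jw].
rewrite /=; have [ep /(_ j jw fr) hj] := H i ih.
have ty' : nth type2 (piece L i omega).1 j = type1 by rewrite ep.
have /branching_treeE g := hanging_branching reg' ty'.
rewrite hj in g; have [vt rt] := hanging_grown reg i j.
by have /(grownP _ vt) H' := g; apply: (H' _ v' v'in); rewrite rt.
Qed.

End pattern_event.

(** Either no regular outcome shows the pattern, and [E] is null, or one such outcome determines a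
    pattern event containing [E] almost surely. An upper bound suffices, because the proportions in
    the conditioned trees are bounded below. *)
Lemma limit_ball (E : set Om) s cs : measurable E -> (0 < size cs)%N ->
  (\forall omega \ae P, E omega -> fringe_at (size cs) (limit_tree L omega) = (s, cs, false)) ->
  P E = 0%E \/ [/\ valid_tree (plug s cs), root_type (plug s cs) = type1 &
    (P E <= (tree_weight p (plug s cs) / mean_weight p)%:E)%E].
Proof.
move=> mE cs0 sub.
have [[om [reg fr]]|none] := pselect (exists om, regular om /\
    fringe_at (size cs) (limit_tree L om) = (s, cs, false)); last first.
  left; apply/eqP; rewrite eq_le measure_ge0 andbT -(measure0 P).
  apply: ae_le_measure => //; move: regular_ae sub; apply: filterS2 => omega reg H Eo.
  by apply: none; exists omega; split=> //; exact: H.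
right; have [h eh] : exists h, size cs = h.+1 by case: (size cs) cs0 => // h _; exists h.
have [es ecs] : hanging L 0 om (piece L 0 om).2 = s /\ mkseq (spine_context L om) h.+1 = cs.
  by move: fr; rewrite eh => -[].
have [vT rT _] := plug_spine reg h.+1; rewrite es ecs in vT rT.
split=> //; have prob := pattern_event_prob h reg; rewrite es ecs in prob.
have mD : measurable (pattern_event om h).
  apply: fin_bigcap_measurable; first exact: finite_seq.
  by move=> c _; exact: measurable_part_event.
rewrite -prob fineK ?fin_num_measure //; apply: ae_le_measure => //.
move: regular_ae sub; apply: filterS2 => omega reg' H Eo.
by apply: in_pattern_event reg' _; rewrite // -eh fr H.
Qed.

End limit_ball.

(** * Weak convergence *)

Section step_functions.
Context d (T : measurableType d) (R : realType) (I : choiceType) (B : I -> set T).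
Hypothesis mB : forall c, measurable (B c).

Lemma integral_step (nu : probability T R) (l : seq I) (a : R) (b : I -> R) :
  nu.-integrable setT (EFin \o (fun x => a + \sum_(c <- l) b c * \1_(B c) x)) /\
  \int[nu]_x (a + \sum_(c <- l) b c * \1_(B c) x) = a + \sum_(c <- l) b c * fine (nu (B c)).
Proof.
elim: l => [|c l [il El]].
  have e : (fun x : T => a + \sum_(c <- [::]) b c * \1_(B c) x) = cst a.
    by apply/funext => x; rewrite big_nil addr0.
  rewrite e big_nil addr0; split; first exact: finite_measure_integrable_cst.
  by rewrite Rintegral_cst // [X in fine X]probability_setT mulr1.
have e : (fun x : T => a + \sum_(c <- c :: l) b c * \1_(B c) x) =
    (fun x => b c * \1_(B c) x + (a + \sum_(c <- l) b c * \1_(B c) x)).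
  by apply/funext => x; rewrite big_cons addrCA.
have i1 : nu.-integrable setT (EFin \o \1_(B c)) by exact: integrable_indic.
have ib : nu.-integrable setT (EFin \o (fun x => b c * \1_(B c) x)).
  by have := integrableZl measurableT (b c) i1; apply: eq_integrable.
rewrite e; split.
  by have := integrableD measurableT ib il; apply: eq_integrable.
rewrite RintegralD // El RintegralZl // big_cons addrCA.
by rewrite /Rintegral integral_indic // setIT.
Qed.

Lemma sum_indic (l : seq I) (b : I -> R) c x : uniq l -> trivIset [set` l] B -> c \in l -> B c x ->
  \sum_(c <- l) b c * \1_(B c) x = b c.
Proof.
move=> ul tl cl Bx; rewrite (bigD1_seq c) //= indicE mem_set // mulr1 big1_seq ?addr0 //.
move=> c' /andP[cc' c'l]; rewrite indicE memNset ?mulr0 // => Bx'.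
by case/negP: cc'; apply/eqP; apply: tl => //; exists x.
Qed.

Lemma sum_disjoint_le1 (nu : probability T R) (l : seq I) : uniq l -> trivIset [set` l] B ->
  \sum_(c <- l) fine (nu (B c)) <= 1.
Proof.
move=> ul tl; rewrite -lee_fin -sumEFin.
rewrite (eq_bigr (fun c => nu (B c))) => [|c _]; last by rewrite fineK // fin_num_measure.
rewrite fsbig_seq // -measure_fin_bigcup //.
by apply: probability_le1; apply: fin_bigcup_measurable => //; exact: finite_seq.
Qed.

Variables (f : T -> R) (l : seq I) (y : I -> R) (eps M : R).
Hypotheses (mf : measurable_fun setT f) (fM : forall x, `|f x| <= M).
Hypotheses (ul : uniq l) (tl : trivIset [set` l] B).
Hypotheses (yM : forall c, `|y c| <= M) (e0 : 0 <= eps).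
Hypothesis fy : forall c x, c \in l -> B c x -> `|f x - y c| <= eps.

(** On the sets [B c] the function is within [eps] of [y c]; off them it is only bounded by [M], at
    the price of the mass left over. *)
Lemma integral_near_step (nu : probability T R) :
  `|\int[nu]_x f x - \sum_(c <- l) y c * fine (nu (B c))| <=
  eps + M * (1 - \sum_(c <- l) fine (nu (B c))).
Proof.
have intf : nu.-integrable setT (EFin \o f).
  apply: measurable_bounded_integrable => //; first by rewrite [X in (X < _)%E]probability_setT ltry.
  exists M; split; first by rewrite num_real.
  by move=> K MK x _; apply: (le_trans (fM x)); exact: ltW.
(* This majorant equals [y c + eps] on [B c] and [eps + M] off all these sets. *)
have [iu Eu] := integral_step nu l (eps + M) (fun c => y c - M).
have [il El] := integral_step nu l (- (eps + M)) (fun c => y c + M).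
have split_sum (s : R) : \sum_(c <- l) (y c + s) * fine (nu (B c)) =
    \sum_(c <- l) y c * fine (nu (B c)) + s * \sum_(c <- l) fine (nu (B c)).
  by rewrite mulr_sumr -big_split; apply: eq_bigr => c _; rewrite mulrDl.
have none x : ~ (exists2 c, c \in l & B c x) -> forall b : I -> R,
    \sum_(c <- l) b c * \1_(B c) x = 0.
  move=> H b; rewrite big1_seq // => c /andP[_ cl].
  by rewrite indicE memNset ?mulr0 // => Bx; apply: H; exists c.
have up : \int[nu]_x f x <= \int[nu]_x (eps + M + \sum_(c <- l) (y c - M) * \1_(B c) x).
  apply: le_Rintegral => // x _.
  have [[c cl Bx]|n] := pselect (exists2 c, c \in l & B c x).
    by rewrite (sum_indic _ ul tl cl Bx) /=; have := fy cl Bx; rewrite ler_norml => /andP[? ?]; lra.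
  by rewrite none // addr0 (le_trans (ler_norm _)) // (le_trans (fM x)) // lerDr.
have lo : \int[nu]_x (- (eps + M) + \sum_(c <- l) (y c + M) * \1_(B c) x) <= \int[nu]_x f x.
  apply: le_Rintegral => // x _.
  have [[c cl Bx]|n] := pselect (exists2 c, c \in l & B c x).
    by rewrite (sum_indic _ ul tl cl Bx) /=; have := fy cl Bx; rewrite ler_norml => /andP[? ?]; lra.
  by rewrite none // addr0 lerNl (le_trans (ler_norm _)) // normrN (le_trans (fM x)) // lerDr.
rewrite Eu split_sum in up; rewrite El split_sum in lo.
by rewrite ler_norml; apply/andP; split; lra.
Qed.

(** Lower bounds on the masses of disjoint sets that nearly exhaust the mass 1 leave no room for
    excess elsewhere, so they control the masses from both sides. *)
Lemma integral_close (nu nu' : probability T R) (delta : R) : 0 <= delta ->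
  1 - eps <= \sum_(c <- l) fine (nu (B c)) ->
  (forall c, c \in l -> fine (nu (B c)) - delta <= fine (nu' (B c))) ->
  `|\int[nu']_x f x - \int[nu]_x f x| <=
  2 * eps + 3 * M * eps + 3 * M * (size l)%:R * delta.
Proof.
move=> d0 cov low.
have M0 : 0 <= M by apply: le_trans (fM point).
have h1 := integral_near_step nu; have h2 := integral_near_step nu'.
have s1 := sum_disjoint_le1 nu' ul tl.
have nd : \sum_(c <- l) delta = (size l)%:R * delta.
  by rewrite big_const_seq iter_addr_0 count_predT mulr_natl.
have h3 : \sum_(c <- l) fine (nu (B c)) - (size l)%:R * delta <= \sum_(c <- l) fine (nu' (B c)).
  by rewrite -nd -sumrB big_seq [leRHS]big_seq; apply: ler_sum.
(* A difference that is at least [- delta] has absolute value at most itself plus [2 * delta]. *)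
have h4 : `|\sum_(c <- l) y c * fine (nu' (B c)) - \sum_(c <- l) y c * fine (nu (B c))| <=
    M * (\sum_(c <- l) fine (nu' (B c)) - \sum_(c <- l) fine (nu (B c)) + 2 * ((size l)%:R * delta)).
  rewrite -nd -!sumrB mulr_sumr -big_split /= mulr_sumr (le_trans (ler_norm_sum _ _ _)) //.
  rewrite big_seq [leRHS]big_seq; apply: ler_sum => c cl; rewrite -mulrBr normrM.
  by apply: ler_pM => //; have := low c cl; rewrite ler_norml => ?; apply/andP; split; lra.
set N := (size l)%:R in h3 h4 *.
move: h1 h2 s1 h3 h4 cov.
set a := \int[nu]_x f x; set a' := \int[nu']_x f x.
set b := \sum_(c <- l) y c * fine (nu (B c)); set b' := \sum_(c <- l) y c * fine (nu' (B c)).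
set s := \sum_(c <- l) fine (nu (B c)); set s' := \sum_(c <- l) fine (nu' (B c)).
move: a a' b b' s s' => a a' b b' s s'; clear -M0 e0 d0 => h1 h2 s1 h3 h4 cov.
have k1 : M * (1 - s) <= M * eps by apply: ler_wpM2l => //; lra.
have k2 : M * (1 - s') <= M * (eps + N * delta) by apply: ler_wpM2l => //; lra.
have k3 : M * (s' - s + 2 * (N * delta)) <= M * (eps + 2 * (N * delta)) by apply: ler_wpM2l => //; lra.
rewrite (_ : a' - a = (a' - b') + (b' - b) - (a - b)); last by ring.
rewrite (le_trans (ler_normB _ _)) // (le_trans (lerD (ler_normD _ _) (lexx _))) //.
have := lerD (lerD h2 (le_trans h4 k3)) (le_trans h1 (lerD (lexx eps) k1)).
by move=> /le_trans; apply; lra.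
Qed.

End step_functions.

(** * Balls of the space of marked trees and weak neighbourhoods *)

Section marked_balls.
Variable R : realType.
Implicit Types (c : tree * seq context) (f : marked_space R -> R).

Definition pattern_ball c : set marked :=
  [set x | fringe_at (size c.2) x = (c.1, c.2, false)].

Lemma marked_dist_le x y h : fringe_at h x = fringe_at h y -> marked_dist R x y <= 2^-1 ^+ h.
Proof.
move=> e; rewrite /marked_dist asboolT; last exact: fringe_at_le e.
apply: ge_inf; last by exists h.
by exists 0 => _ [k _ <-]; rewrite exprn_ge0.
Qed.

Lemma marked_dist_lt x y h : marked_dist R x y < 2^-1 ^+ h -> fringe_at h x = fringe_at h y.
Proof.
have p1 : 2^-1 ^+ h <= 1 :> R by rewrite exprn_ile1 ?invf_le1 ?ler1n.
rewrite /marked_dist; case: asboolP => e lt; last first.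
  by have := lt_le_trans lt p1; rewrite ltNge ler1n.
have [_ [k ek <-] kh] : exists2 z, [set 2^-1 ^+ h | h in [set h : nat | fringe_at h x = fringe_at h y]] z
    & z < 2^-1 ^+ h :> R.
  by apply: inf_lt lt; exists (2^-1 ^+ 0); exists 0%N.
apply: fringe_at_le ek; rewrite leqNgt; apply/negP => hk.
move: kh; apply/negP; rewrite -leNgt; apply: ler_wiXn2l; rewrite ?invf_le1 ?ler1n //.
exact: ltnW.
Qed.

Lemma pattern_ball_open c : open (pattern_ball c : set (marked_space R)).
Proof.
rewrite openE => x Bx; rewrite /interior -nbhs_ballE; exists (2^-1 ^+ size c.2) => /=.
  by rewrite exprn_gt0.
by move=> y; rewrite ballEmdist => /= /marked_dist_lt e; rewrite /pattern_ball /= -e.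
Qed.

Lemma measurable_pattern_ball c : measurable (pattern_ball c : set (borel_marked R)).
Proof. by apply: sub_sigma_algebra; exact: pattern_ball_open. Qed.

Lemma measurable_continuous f : continuous f -> measurable_fun setT (f : borel_marked R -> R).
Proof.
move=> /continuousP cf; apply: (measurability _ (measurable_realfun.RGenOpens.measurableE R)).
move=> _ [_ [a [b ->] <-]]; rewrite setTI.
by apply: sub_sigma_algebra; apply: cf; exact: interval_open.
Qed.

Lemma continuous_fringe f x (e : R) : continuous f -> 0 < e ->
  exists h, forall y, fringe_at h x = fringe_at h y -> `|f x - f y| <= e.
Proof.
move=> cf e0; have /cvgrPdist_le/(_ e e0) := cf x.
rewrite -nbhs_ballE => -[r /= r0 H].
have h1 : `|2^-1 : R| < 1 by rewrite ger0_norm // invf_lt1 // ltr1n.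
have /cvgr0Pnorm_lt /(_ r r0) [n _ ne] := cvg_expr h1.
exists n => y exy; apply: H; rewrite ballEmdist /=.
have := ne n (leqnn n); rewrite /= ger0_norm ?exprn_ge0 // => /(le_lt_trans _); apply.
exact: marked_dist_le.
Qed.

Lemma fringe_at_take h k x s cs : (k <= h)%N -> size cs = h ->
  fringe_at h x = (s, cs, false) -> fringe_at k x = (s, take k cs, false).
Proof.
move=> kh sc e; have : fringe_at h x = fringe_at h (FiniteMarked s cs).
  by rewrite e /= take_oversize ?sc // ltnn.
by move=> /(fringe_at_le kh) ->; rewrite /= sc ltnNge kh.
Qed.

Lemma pattern_ball_mkseq s cs h x :
  pattern_ball (s, mkseq cs h) x = (fringe_at h x = (s, mkseq cs h, false)).
Proof. by rewrite /pattern_ball /mkset /= size_mkseq. Qed.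

Section minimal_patterns.
Variables (f : marked_space R -> R) (e : R).

(** At least one context is required, so that for patterns of the limit tree the plugged tree has a
    root of type 1 and is described by its code. *)
Definition good_pattern c : Prop := (0 < size c.2)%N /\
  forall x y, pattern_ball c x -> pattern_ball c y -> `|f x - f y| <= e.

Definition minimal_pattern c : Prop := good_pattern c /\
  forall k, (k < size c.2)%N -> ~ good_pattern (c.1, take k c.2).

(** Two balls with a common point are nested, the longer pattern extending the shorter; minimality
    forbids a proper extension. *)
Lemma minimal_pattern_disjoint : trivIset minimal_pattern pattern_ball.
Proof.
move=> c c' mc mc' [x [Bx Bx']].
wlog le : c c' mc mc' Bx Bx' / (size c.2 <= size c'.2)%N.
  by case: (leqP (size c.2) (size c'.2)) => [le|/ltnW le] H; [|apply/esym]; exact: H.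
have e1 := fringe_at_take le (erefl _) Bx'; rewrite [LHS]Bx in e1.
have {e1}ec : c = (c'.1, take (size c.2) c'.2) by case: (c) e1 => a b /= [-> <-].
have [lt|ge] := ltnP (size c.2) (size c'.2).
  by case: (mc'.2 _ lt); rewrite -ec; exact: mc.1.
by rewrite ec take_oversize //; case: (c').
Qed.

Lemma minimal_pattern_cover s cs : continuous f -> 0 < e ->
  exists2 c, minimal_pattern c & pattern_ball c (InfiniteMarked s cs).
Proof.
move=> cf e0; have e2 : 0 < e / 2 by rewrite divr_gt0.
have [h Hh] := continuous_fringe (InfiniteMarked s cs) cf e2.
have ex : exists k, `[< good_pattern (s, mkseq cs k) >].
  exists h.+1; apply/asboolP; split; first by rewrite size_mkseq.
  have near x : pattern_ball (s, mkseq cs h.+1) x -> `|f (InfiniteMarked s cs) - f x| <= e / 2.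
    rewrite pattern_ball_mkseq => Bx; apply: Hh.
    by apply: (@fringe_at_le h h.+1) => //; rewrite Bx.
  move=> x y /near + /near; rewrite !ler_norml => /andP[? ?] /andP[? ?].
  by apply/andP; split; lra.
case: (ex_minnP ex) => k /asboolP gk mk; exists (s, mkseq cs k).
  split=> // j; rewrite /= size_mkseq => jk gj.
  suff : (k <= j)%N by rewrite leqNgt jk.
  apply: mk; apply/asboolP; move: gj; congr (good_pattern (_, _)).
  by rewrite /mkseq -map_take take_iota (minn_idPl (ltnW jk)).
by rewrite pattern_ball_mkseq.
Qed.

End minimal_patterns.

(** The balls of the minimal patterns are disjoint and cover all infinite marked trees, so finitely
    many carry almost all the mass of [nu]. Concentration on infinite trees is expressed through the
    measurable sets that contain them. *)
Lemma weak_close (f : bounded_continuous R) (nu : marked_law R) (e : R) : 0 < e ->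
  (forall D : set (borel_marked R), measurable D ->
    (forall s cs, D (InfiniteMarked s cs)) -> nu D = 1%E) ->
  exists (l : seq (tree * seq context)) (delta : R),
    [/\ 0 < delta, {in l, forall c, (0 < size c.2)%N} &
     forall nu' : marked_law R,
       {in l, forall c, fine (nu (pattern_ball c)) - delta <= fine (nu' (pattern_ball c))} ->
       `|test f nu - test f nu'| < e].
Proof.
move=> e0 inf; have [cf [M0 fM0]] := svalP f.
pose M : R := `|M0| + 1.
have M1 : 0 < M by rewrite ltr_wpDl.
have fM x : `|sval f x| <= M.
  by rewrite (le_trans (fM0 x)) // /M (le_trans (ler_norm _)) // lerDl.
(* The two error terms of [integral_close] in [eps] then add up to [e / 2]; [delta] below keeps the
   third one under [e / 4]. *)
pose eps := e / (2 * (2 + 3 * M)).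
have eps0 : 0 < eps by rewrite divr_gt0 // mulr_gt0 // addr_gt0 // mulr_gt0.
pose min := minimal_pattern (sval f) eps.
pose l n := [seq c <- undup (pmap unpickle (iota 0 n)) | `[< min c >]].
have lP n c : (c \in l n) = `[< min c >] && (c \in pmap unpickle (iota 0 n)).
  by rewrite mem_filter mem_undup.
pose U n : set (borel_marked R) := \bigcup_(c in [set` l n]) pattern_ball c.
have mU n : measurable (U n).
  apply: fin_bigcup_measurable => [|c _]; first exact: finite_seq.
  exact: measurable_pattern_ball.
have ndU : nondecreasing_seq U.
  move=> m n mn; apply/subsetPset => x [c /= cl Bx]; exists c => //=.
  move: cl; rewrite !lP => /andP[-> /=]; rewrite -(subnKC mn) iotaD pmap_cat mem_cat => ->.
  by [].
have covU s cs : (\bigcup_n U n) (InfiniteMarked s cs).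
  have [c mc Bc] := minimal_pattern_cover s cs cf eps0.
  exists (pickle c).+1 => //; exists c => //=; rewrite lP; apply/andP; split; first exact/asboolP.
  rewrite mem_pmap; apply/mapP; exists (pickle c); last by rewrite pickleK.
  by rewrite mem_iota add0n leqnn.
have mUU : measurable (\bigcup_n U n) by exact: bigcupT_measurable.
(* Continuity from below along the enumeration of the patterns by [pickle]. *)
have /fine_cvgP[_ /cvgrPdist_le/(_ eps eps0)[n _ /(_ n (leqnn n)) Hn]] : nu (U n) @[n --> \oo] --> 1%:E.
  by rewrite -(inf _ mUU covU); exact: nondecreasing_cvg_mu.
have ul : uniq (l n) by apply: filter_uniq; exact: undup_uniq.
have tl : trivIset [set` l n] pattern_ball.
  move=> c c' /=; rewrite !lP => /andP[/asboolP mc _] /andP[/asboolP mc' _].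
  exact: minimal_pattern_disjoint mc mc'.
have cov : 1 - eps <= \sum_(c <- l n) fine (nu (pattern_ball c)).
  rewrite -lee_fin -sumEFin (eq_bigr (fun c => nu (pattern_ball c))) => [|c _]; last first.
    by rewrite fineK // fin_num_measure //; exact: measurable_pattern_ball.
  rewrite fsbig_seq // -measure_fin_bigcup //; last by move=> c _; exact: measurable_pattern_ball.
  move: Hn; rewrite /= ler_norml -/(U n) => /andP[_].
  by rewrite -[X in (_ <= X)%E]fineK ?fin_num_measure // lee_fin; lra.
pose N : R := (size (l n))%:R.
pose delta := e / (4 * (3 * M * N + 1)).
have N0 : 0 <= N by rewrite ler0n.
have MN : 0 <= 3 * M * N by rewrite !mulr_ge0 // ltW.
have delta0 : 0 < delta by rewrite divr_gt0 // mulr_gt0 // ltr_wpDl.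
exists (l n), delta; split=> // [c|nu' low].
  by rewrite lP => /andP[/asboolP[[]]].
have rep c : exists x, min c -> pattern_ball c !=set0 -> pattern_ball c x.
  by have [[x Bx]|ne] := pselect (pattern_ball c !=set0); [exists x|exists (point : marked_space R)].
have [x Hx] := choice rep.
rewrite distrC /test.
have := @integral_close _ (borel_marked R) R _ pattern_ball measurable_pattern_ball (sval f) (l n)
  (fun c => sval f (x c)) eps M (measurable_continuous cf) fM ul tl (fun c => fM (x c)) (ltW eps0)
  _ nu nu' delta (ltW delta0) cov low.
move=> /(_ _)/le_lt_trans; apply.
  move=> c z; rewrite lP => /andP[/asboolP mc _] Bz; apply: mc.1.2 => //.
  by apply: Hx => //; exists z.
have k1 : 2 * eps + 3 * M * eps = e / 2.
  by rewrite /eps; field; rewrite gt_eqF // addr_gt0 // mulr_gt0.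
have k2 : 3 * M * N * delta <= e / 4.
  rewrite /delta mulrA ler_pdivrMr; last by rewrite mulr_gt0 // ltr_wpDl.
  by move: (3 * M * N) MN => z z0; nra.
rewrite -/N k1; lra.
Qed.

Lemma uniform_mark_ball t c :
  uniform_mark R t (pattern_ball c) =
  ((count_mem (plug c.1 c.2) (fringes t))%:R / (tree_size t)%:R)%:E.
Proof.
pose m : set (borel_marked R) -> \bar R :=
  msum (fun i => \d_(mark t (nth [::] (vertices t) i) : borel_marked R)) (tree_size t).
have mE (A : set (borel_marked R)) :
    m A = (count (fun v => (mark t v : borel_marked R) \in A) (vertices t))%:R%:E.
  rewrite /m /= /msum count_sum natr_sum -sumEFin (big_nth [::]) big_mkord.
  by apply: eq_bigr => i _; exact: diracE.
have mT : m setT = (tree_size t)%:R%:E.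
  by rewrite mE /tree_size -count_predT; congr (_%:R%:E); apply: eq_count => v; rewrite in_setT.
have t0 : (tree_size t)%:R != 0 :> R by rewrite pnatr_eq0 -lt0n tree_size_gt0.
have nz : (m setT == 0%E) || (m setT == +oo%E) = false by rewrite mT eqe (negbTE t0).
rewrite /uniform_mark /= /mnormalize; case: ifPn => [|_]; first by rewrite [X in is_true X]nz.
rewrite -[X in (X * _)%E]/(m (pattern_ball c)) -[X in fine X]/(m setT) mT mE -EFinM.
congr (_%:R / _)%:E; rewrite -count_pattern; apply: eq_count => v.
by apply/idP/idP => [/set_mem/fringe_at_mark //|/fringe_at_mark]; exact: mem_set.
Qed.

End marked_balls.

(** * Conditional probabilities given the size, and the convergence *)

Section tree_prob_bounds.
Context {R : realType} (p : probability word R).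

Lemma tree_prob_ge0 n Q : 0 <= tree_prob p n Q.
Proof. by apply: sumr_ge0 => m _; apply: lsum_ge0 => //; exact: pmf_ge0. Qed.

Lemma tree_prob_sum (I : Type) (l : seq I) n (Q : tree -> bool) (Qs : I -> tree -> bool) :
  (forall t, valid_tree t -> root_type t = type1 -> tree_size t = n -> Q t ->
    has (fun c => Qs c t) l) ->
  tree_prob p n Q <= \sum_(c <- l) tree_prob p n (Qs c).
Proof.
move=> H; rewrite exchange_big; apply: ler_sum => m _; rewrite -lsum_sum.
apply: le_lsum; first exact: pmf_ge0.
move=> s _ _; case: (boolP (_ && _)) => [/and3P[ls ws Qs']|_]; last exact: sumr_ge0.
have [vt rt ct] := decodeP ls; rewrite ls ws /= -natr_sum -count_sum ler_nat -has_count.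
by apply: H => //; rewrite tree_size_weight // ct; exact/eqP.
Qed.

Lemma tree_prob_le n (Q Q' : tree -> bool) : (forall t, Q t -> Q' t) ->
  tree_prob p n Q <= tree_prob p n Q'.
Proof.
move=> H; apply: (@le_trans _ _ (\sum_(c <- [:: Q']) tree_prob p n c)).
  by apply: tree_prob_sum => t _ _ _ Qt /=; rewrite orbF; exact: H.
by rewrite big_seq1.
Qed.

Lemma tree_weight_le_prob t : valid_tree t -> root_type t = type1 ->
  tree_weight p t <= tree_prob p (tree_size t) xpredT.
Proof.
move=> vt rt; rewrite tree_size_weight //.
have [pos|] := boolP (0 < tree_weight p t); last first.
  by rewrite -leNgt => /le_trans; apply; exact: tree_prob_ge0.
have lt : (size (code t) < (weight (code t)).+1)%N by rewrite ltnS size_le_weight.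
rewrite /tree_prob (bigD1 (Ordinal lt)) //=.
have wds : all (mem (words p (weight (code t)))) (code t).
  apply/allP => w wt; rewrite /= mem_words; apply/andP; split; last first.
    rewrite lt_neqAle pmf_ge0 andbT eq_sym; apply: contraTneq pos => w0.
    by rewrite /tree_weight (big_rem w) //= w0 mul0r ltxx.
  exact: ltnW (size_word_lt_weight (lukasiewicz_code vt rt) wt).
have := @lsum_prefix_le _ _ (words p (weight (code t))) (pmf p) (pmf_ge0 p) 0 (code t)
  (fun s => [&& lukasiewicz s, weight s == weight (code t) & true]%:R)
  (fun s => ler0n _ _) wds (uniq_words _ _).
rewrite lsum0 cats0 addn0 lukasiewicz_code // eqxx /= mulr1 => /le_trans; apply.
rewrite lerDl sumr_ge0 // => m _; apply: lsum_ge0 => //; exact: pmf_ge0.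
Qed.

End tree_prob_bounds.

Section span_gt0.
Context {R : realType} (p : probability word R).
Hypothesis hvar_xi : (fun w : word => (xi w)%:R : R) \in Lfun p 2%:E.
Hypothesis hvar_zeta : (fun w : word => (zeta w)%:R : R) \in Lfun p 2%:E.
Hypothesis hxi0 : (0 < p [set w | xi w = 0%N])%E.
Hypothesis hxi2 : (0 < p [set w | (2 <= xi w)%N])%E.

(** If [D] were zero, all trees of positive probability would have the same size. But [t2], obtained
    by hanging copies of [t0] at the type 1 children of a root, is larger than [t0]. Positivity
    makes the sizes a + D k tend to infinity. *)
Lemma span_gt0 a D : is_minimum [set n | 0 < tree_prob p n xpredT] a ->
  is_span [set n | 0 < tree_prob p n xpredT] a D -> (0 < D)%N.
Proof.
move=> [_ amin] [div _]; rewrite lt0n; apply/eqP => D0.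
have onlya n : 0 < tree_prob p n xpredT -> n = a.
  move=> pn; have := div n pn; rewrite D0 dvd0n subn_eq0 => na.
  by apply/eqP; rewrite eqn_leq na; exact: amin.
have [w0 /= x0 p0] := measure_gt0_word hvar_xi hvar_zeta hxi0.
have [w2 /= x2 p2] := measure_gt0_word hvar_xi hvar_zeta hxi2.
pose t0 := Node type1 (map leaf w0).
have leaves w : map root_type (map leaf w) = w.
  by rewrite -map_comp -[RHS]map_id; exact: eq_map.
have v0 : valid_tree t0 by rewrite /= all_map; apply/allP => g _; rewrite /= orbT.
have tw0 : 0 < tree_weight p t0.
  rewrite tree_weight_Node leaves big_map big1_seq ?mulr1 // => g /andP[_ gw].
  case: g gw => [|_]; last by rewrite /tree_weight /= big_nil.
  by move: x0; rewrite /xi => /eqP; rewrite -leqn0 leqNgt -has_count has_pred1 => /negP.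
pose ch g := if g is type1 then t0 else leaf type2.
pose t2 := Node type1 (map ch w2).
have v2 : valid_tree t2 by rewrite /= all_map; apply/allP => -[].
have tw2 : 0 < tree_weight p t2.
  have e2 : map root_type (map ch w2) = w2.
    by rewrite -map_comp -[RHS]map_id; apply: eq_map => -[].
  rewrite tree_weight_Node e2 big_map mulr_gt0 //; apply: prodr_gt0 => -[] _ //=.
  by rewrite /tree_weight /= big_nil.
have s0 := onlya _ (lt_le_trans tw0 (tree_weight_le_prob p v0 (erefl _))).
have s2 := onlya _ (lt_le_trans tw2 (tree_weight_le_prob p v2 (erefl _))).
have : (tree_size t0 < tree_size t2)%N; last by rewrite s0 s2 ltnn.
have in1 : type1 \in w2 by rewrite -has_pred1 has_count; exact: ltnW.
by rewrite [tree_size t2]tree_size_Node big_map (big_rem _ in1) /= ltnS leq_addr.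
Qed.

End span_gt0.

Section vanishing.
Context {R : realType} (p : probability word R) (size_of : nat -> nat).

(* Stated without division: given that the tree has size [n = size_of k], the conditional
   probability of [Q n] tends to [0]. *)
Definition vanishing (Q : nat -> tree -> bool) : Prop :=
  forall e : R, 0 < e -> exists K, forall k, (K <= k)%N ->
    tree_prob p (size_of k) (Q (size_of k)) <= e * tree_prob p (size_of k) xpredT.

Lemma vanishing_false (Q : nat -> tree -> bool) : (forall n t, tree_size t = n -> ~~ Q n t) -> vanishing Q.
Proof.
move=> H e e0; exists 0%N => k _.
apply: (@le_trans _ _ (\sum_(c <- [::] : seq bool) tree_prob p (size_of k) (fun=> c))).
  by apply: tree_prob_sum => t _ _ ts; rewrite (negbTE (H _ t ts)).
by rewrite big_nil mulr_ge0 ?tree_prob_ge0 // ltW.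
Qed.

Lemma vanishing_or (Q Q1 Q2 : nat -> tree -> bool) : vanishing Q1 -> vanishing Q2 ->
  (forall n t, tree_size t = n -> Q n t -> Q1 n t || Q2 n t) -> vanishing Q.
Proof.
move=> v1 v2 H e e0; have e2 : 0 < e / 2 by rewrite divr_gt0.
have [K1 h1] := v1 _ e2; have [K2 h2] := v2 _ e2.
exists (maxn K1 K2) => k; rewrite geq_max => /andP[k1 k2]; set n := size_of k.
apply: (@le_trans _ _ (\sum_(c <- [:: true; false]) tree_prob p n (if c then Q1 n else Q2 n))).
  by apply: tree_prob_sum => t _ _ ts Qt /=; rewrite orbF; exact: H.
rewrite !big_cons big_nil addr0 [leRHS](_ : _ = e / 2 * tree_prob p n xpredT + e / 2 * tree_prob p n xpredT).
  by apply: lerD; [exact: h1|exact: h2].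
by field.
Qed.

Lemma vanishing_has (I : eqType) (l : seq I) (Q : nat -> tree -> bool) (Qs : I -> nat -> tree -> bool) :
  {in l, forall c, vanishing (Qs c)} ->
  (forall n t, tree_size t = n -> Q n t -> has (fun c => Qs c n t) l) -> vanishing Q.
Proof.
elim: l Q => [|c l ih] Q vQ H; first by apply: vanishing_false => n t ts; apply/negP => /(H n t ts).
apply: (@vanishing_or _ (Qs c) (fun n t => has (fun c => Qs c n t) l)).
- by apply: vQ; rewrite mem_head.
- by apply: ih => // c' c'l; apply: vQ; rewrite inE c'l orbT.
- by move=> n t ts /(H n t ts).
Qed.

(** The sets of laws to which the empirical law belongs with conditional probability tending to 1.
    They form a filter, and convergence in probability to a constant is convergence of this
    filter. *)
Definition likely (V : set (marked_law R)) : Prop :=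
  vanishing (fun _ t => ~~ `[< V (uniform_mark R t) >]).

Lemma likely_filter : Filter likely.
Proof.
split.
- by apply: vanishing_false => n t _; rewrite negbK; exact/asboolP.
- move=> V W v w; apply: (vanishing_or v w) => n t _.
  rewrite -negb_and; apply: contra => /andP[/asboolP ? /asboolP ?]; exact/asboolP.
- move=> V W VW v; apply: (vanishing_or v v) => n t _.
  by rewrite orbb; apply: contra => /asboolP/VW ?; exact/asboolP.
Qed.

(** The weak topology is a supremum of initial topologies, so it suffices to consider one test
    function at a time. *)
Lemma likely_nbhs (nu : weak_law R) :
  (forall (f : bounded_continuous R) e, 0 < e ->
    likely [set nu' | `|test f nu - test f nu'| < e]) ->
  forall U, nbhs nu U -> likely U.
Proof.
have FF := likely_filter.
move=> H U hU; apply: ((@cvg_sup (marked_law R) _ _ likely nu FF).2 _ U hU) => f A /= [_ [[B oB <-] Bnu sBA]].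
have /nbhs_ballP[e /= e0 eB] : nbhs (test f nu) B by exact: open_nbhs_nbhs.
apply: (@filterS _ likely FF _ _ _ (H f e e0)) => nu' d; apply: sBA; apply: eB.
exact: d.
Qed.

End vanishing.

(** Convergence in probability is tested on each weak neighbourhood [U] of the limit law. This law
    is that of a Borel measurable map [That] which is almost surely equal to [limit_tree]. *)
Theorem theorem4 (R : realType)
    (p : probability word R)
    (hxi0 : (0 < p [set w | xi w = 0%N])%E)
    (hxi2 : (0 < p [set w | (2 <= xi w)%N])%E)
    (hline : ~ support_on_line p)
    (hcrit : 'E_p[fun w => (xi w)%:R]%E = 1%E)
    (hvar_xi : (fun w : word => (xi w)%:R : R) \in Lfun p 2%:E)
    (hvar_zeta : (fun w : word => (zeta w)%:R : R) \in Lfun p 2%:E)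
    (d : measure_display) (Om : measurableType d) (P : probability Om R)
    (sigma : seq nat -> {RV P >-> word})
    (hsigma : iid_copies p sigma)
    (a D : nat)
    (ha : is_minimum (size_support P (random_tree sigma)) a)
    (hD : is_span (size_support P (random_tree sigma)) a D)
    (d' : measure_display) (Om' : measurableType d') (P' : probability Om' R)
    (L : limit_parts P' p)
    (That : {RV P' >-> borel_marked R})
    (hThat : \forall omega \ae P', That omega = limit_tree L omega)
    (U : set (weak_law R))
    (hU : nbhs (distribution P' That : weak_law R) U) :
  cond_prob P
    [set omega | exists2 t, random_tree sigma omega = Some t & ~ U (uniform_mark R t)]
    (size_event (random_tree sigma) (a + D * k)%N) @[k --> \oo] --> (0 : R).
Proof.
have size_prob n : P (size_event (random_tree sigma) n) = (tree_prob p n xpredT)%:E.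
  rewrite -(random_tree_prob _ _ hsigma); congr (P _); apply/seteqP; split=> [omega h|omega []//].
  split=> //; move: h; rewrite /size_event /=.
  by case: (random_tree sigma omega) => // t _; exists t.
have supportE : size_support P (random_tree sigma) = [set n | 0 < tree_prob p n xpredT].
  by apply/seteqP; split=> n; rewrite /size_support /mkset size_prob lte_fin.
rewrite supportE in ha hD.
have D0 := span_gt0 hvar_xi hvar_zeta hxi0 hxi2 ha hD.
have [c0 c0_gt0 [N0 lower]] := tree_prob_lower hcrit hvar_xi hvar_zeta hline ha hD.
pose n k := (a + D * k)%N.
have n_ge k : (k <= n k)%N by rewrite (leq_trans _ (leq_addl _ _)) // leq_pmull.
have mB c : measurable (That @^-1` pattern_ball c).
  by apply: measurable_preimage; exact: measurable_pattern_ball.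
have inf (A : set (borel_marked R)) : measurable A ->
    (forall s cs, A (InfiniteMarked s cs)) -> distribution P' That A = 1%E.
  move=> mA H; apply/eqP; rewrite eq_le probability_le1 //= -(probability_setT P').
  apply: ae_le_measure => //; first exact: measurable_preimage.
  by move: hThat; apply: filterS => omega e _; rewrite /= e; exact: H.
have ball_small (c : tree * seq context) (delta : R) : (0 < size c.2)%N -> 0 < delta ->
    vanishing p n (fun n t => (count_mem (plug c.1 c.2) (fringes t))%:R <
      (fine (P' (That @^-1` pattern_ball c)) - delta) * n%:R).
  move=> c_gt0 delta0.
  have [|z|[vT rT le]] := limit_ball hcrit hvar_xi hvar_zeta hxi2 hline (L := L)
      (s := c.1) (mB c) c_gt0.
  - by move: hThat; apply: filterS => omega e; rewrite /= /pattern_ball /= e.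
  (* For a null ball the threshold is not positive, and no count lies below it. *)
  - apply: vanishing_false => m t _; rewrite z /= sub0r -leNgt mulNr.
    by rewrite (le_trans _ (ler0n _ _)) // oppr_le0 mulr_ge0 // ltW.
  (* The bound [e * c0] is chosen so that division by the lower bound [c0 / n ^+ 2] for the law of
     the size leaves [e]. *)
  move=> e e0; have [N HN] := bad_trees_negligible hcrit hvar_xi hvar_zeta vT rT delta0 (mulr_gt0 e0 c0_gt0).
  exists (maxn 1 (maxn N N0)) => k; rewrite !geq_max => /and3P[k0 kN kN0].
  have nk0 : 0 < (n k)%:R ^+ 2 :> R by rewrite exprn_gt0 // ltr0n (leq_trans k0).
  apply: (@le_trans _ _ (e * (c0 / (n k)%:R ^+ 2))); last first.
    by rewrite ler_wpM2l ?(ltW e0) //; apply: lower; exact: leq_trans kN0 (n_ge k).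
  rewrite mulrA ler_pdivlMr // mulrC; apply: le_trans (HN _ (leq_trans kN (n_ge k))).
  rewrite ler_wpM2l ?(ltW nk0) //.
  apply: tree_prob_le => t /lt_le_trans; apply.
  rewrite ler_wpM2r // lerD2r -lee_fin fineK //.
  by rewrite fin_num_measure.
have lik : likely p n U.
  apply: likely_nbhs hU => f e e0; have [l [delta [d0 l0 close]]] := weak_close f e0 inf.
  apply: (vanishing_has (l := l) (Qs := fun c m t => (count_mem (plug c.1 c.2) (fringes t))%:R <
      (fine (P' (That @^-1` pattern_ball c)) - delta) * m%:R)).
    by move=> c cl; apply: ball_small => //; exact: l0.
  move=> m t tm; apply: contraR => /hasPn low; apply/asboolP; apply: close => c cl.
  rewrite uniform_mark_ball /= ler_pdivlMr; last by rewrite ltr0n tree_size_gt0.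
  by rewrite tm leNgt; exact: low.
apply/cvgrPdist_le => e e0; have [K HK] := lik e e0.
exists K => // k Kk /=; rewrite sub0r normrN /cond_prob.
have -> : [set omega | exists2 t, random_tree sigma omega = Some t & ~ U (uniform_mark R t)] =
    [set omega | exists2 t, random_tree sigma omega = Some t & ~~ `[< U (uniform_mark R t) >]].
  apply/seteqP; split=> omega [t e1 e2]; exists t => //; first exact/asboolPn.
  exact/asboolPn.
rewrite (random_tree_prob _ _ hsigma) size_prob /= ger0_norm; last first.
  by rewrite divr_ge0 ?tree_prob_ge0.
(* If the size has probability zero, the quotient [cond_prob] is zero by the convention on
   inverses. *)
have [->|z] := eqVneq (tree_prob p (a + D * k) xpredT) 0; first by rewrite invr0 mulr0 ltW.
rewrite ler_pdivrMr ?HK //.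
by rewrite lt_neqAle eq_sym z tree_prob_ge0.
Qed.
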